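(* Let $(D,g)$ be a metrised $\mathbb R$-divisor on $X$. For $x\in X^{(1)}$ let $$\mu_{\inf,x}(g):=\inf_{\xi\in\mathopen{]}\eta_0,x_0\mathclose{[}}\frac{g(\xi)}{t(\xi)}\in\mathbb R\cup\{-\infty\},\qquad \mu_{\inf}(g):=\sum_{x\in X^{(1)}}\mu_{\inf,x}(g)[k(x):k]\in\mathbb R\cup\{-\infty\}.$$ Then the following assertions hold. (1) $(D,g)$ is pseudo-effective if and only if $\mu_{\inf}(g)\geqslant0$. (2) $(D,g)$ is $\mathbb R$-linearly equivalent to an effective metrised $\mathbb R$-divisor if and only if $\mu_{\inf,x}(g)\geqslant0$ for all but finitely many $x\in X^{(1)}$ and one of the following conditions holds: (a) $\mu_{\inf}(g)>0$; (b) $\sum_{x\in X^{(1)}}\mu_{\inf,x}(g)\,x$ is a principal $\mathbb R$-divisor.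
   Context: Let $k$ be a field equipped with the trivial absolute value and $X$ a regular irreducible projective curve over $\operatorname{Spec} k$. $X^{(1)}$ is the set of closed points, $k(x)$ the residue field of $x$, $\operatorname{Rat}(X)$ the field of rational functions. Berkovich space. $X^{\mathrm{an}}$ is identified with the following tree: the quotient of $\coprod_{x\in X^{(1)}}[0,+\infty]$ obtained by gluing all points $0$ into one root point $\eta_0$. For $x\in X^{(1)}$, $\xi_x:[0,+\infty]\to X^{\mathrm{an}}$ is the map on the copy indexed by $x$, $x_0:=\xi_x(+\infty)$, $[\eta_0,x_0]:=\xi_x([0,+\infty])$ (similarly for half-open and open intervals), and $t(\xi)\in[0,+\infty]$ is the unique number with $\xi_x(t(\xi))=\xi$ for $\xi\in[\eta_0,x_0]$. A subset $U$ is open iff each $\xi_x^{-1}(U)$ is open in $[0,+\infty]$ and, if $\eta_0\in U$, $U\supseteq[\eta_0,x_0]$ for all but finitely many $x$. Divisors. An $\mathbb R$-divisor is a finite formal sum $D=\sum_x\operatorname{ord}_x(D)\,x$ with real coefficients; $\deg(D)=\sum_x[k(x):k]\operatorname{ord}_x(D)$; $D$ is effective ($D\geqslant0$) if all $\operatorname{ord}_x(D)\geqslant0$. $\operatorname{Rat}(X)^\times_{\mathbb R}:=\operatorname{Rat}(X)^\times\otimes_{\mathbb Z}\mathbb R$, and $s\mapsto(s)=\sum_x\operatorname{ord}_x(s)x$ is the $\mathbb R$-linear extension of the principal divisor map; an $\mathbb R$-divisor is principal if it is of the form $(s)$ with $s\in\operatorname{Rat}(X)^\times_{\mathbb R}$.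 $H^0(D):=\{f\in\operatorname{Rat}(X)^\times:(f)+D\geqslant0\}\cup\{0\}$, a finite-dimensional $k$-vector space. Green functions. A Green function of $D$ is a continuous map $g:X^{\mathrm{an}}\to[-\infty,+\infty]$ for which there is a continuous $\varphi_g:X^{\mathrm{an}}\to\mathbb R$ with $\varphi_g(\xi)=g(\xi)-\operatorname{ord}_x(D)t(\xi)$ for all $x$ and all $\xi\in[\eta_0,x_0[$. A metrised $\mathbb R$-divisor is a pair $(D,g)$ with $g$ a Green function of $D$. These form a real vector space; the sum of two Green functions is the Green function equal to the pointwise sum away from the leaves $x_0$. $g_D$ denotes the canonical Green function $\xi\in[\eta_0,x_0]\mapsto\operatorname{ord}_x(D)t(\xi)$ (equal to $0$ where $\operatorname{ord}_x(D)=0$). One has $\mu_{\inf,x}(g)\leqslant\operatorname{ord}_x(D)$, so $\mu_{\inf,x}(g)\leqslant0$ for all but finitely many $x$ and $\mu_{\inf}(g)$ is well defined; when $\mu_{\inf,x}(g)\geqslant 0$ for all but finitely many $x$, $\mu_{\inf,x}(g)=0$ for all but finitely many $x$. Effectivity. $(D,g)$ is effective if $D$ is effective and $g\geqslant0$. $(D_1,g_1)$ and $(D_2,g_2)$ are $\mathbb R$-linearly equivalent if $(D_2,g_2)=(D_1,g_1)+((\phi),g_{(\phi)})$ for some $\phi\in\operatorname{Rat}(X)^\times_{\mathbb R}$. Bigness. For non-zero $s\in H^0(D)$, $\|s\|_g:=\exp(-\inf_{\xi\in X^{\mathrm{an}}}(g_{(s)}+g)(\xi))$, and $\|0\|_g=0$;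 this is an ultrametric norm on $H^0(D)$. For a finite-dimensional ultrametrically normed $k$-space $(E,\|\cdot\|)$ of dimension $r$, $\widehat{\deg}(E,\|\cdot\|):=-\ln\|\eta\|_{\det}$ for any non-zero $\eta\in\Lambda^rE$, where $\|\eta\|_{\det}=\inf\{\|s_1\|\cdots\|s_r\|:s_1\wedge\cdots\wedge s_r=\eta\}$ (it is $0$ for $E=0$), and $\widehat{\deg}_+(E,\|\cdot\|):=\sup_{F\subseteq E}\widehat{\deg}(F,\|\cdot\||_F)$ over all vector subspaces $F$. The volume is $\widehat{\mathrm{vol}}(D,g):=\limsup_{n\to+\infty}\frac{\widehat{\deg}_+(H^0(nD),\|\cdot\|_{ng})}{n^2/2}$. $(D,g)$ is big if $\widehat{\mathrm{vol}}(D,g)>0$; it is pseudo-effective if $(D+D_0,g+g_0)$ is big for every big metrised $\mathbb R$-divisor $(D_0,g_0)$. *)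

(* Defs.v *)
From HB Require Import structures.
From mathcomp Require Import all_boot all_order all_algebra.
From mathcomp Require mpoly.

Set Implicit Arguments.
Unset Strict Implicit.
Unset Printing Implicit Defensive.

Import Order.TTheory GRing.Theory Num.Theory.
Local Open Scope ring_scope.

(* The notations of mpoly and of MathComp-Analysis clash, so everything that
   mentions polynomials is confined to this module. *)
Module ProjectiveGeometry.
Import mpoly.

(* A scheme-theoretic point of P^n_k: a homogeneous prime ideal of
   k[T_0, ..., T_n] that does not contain all the T_i. *)
Record relevant_prime (k : fieldType) (n : nat)
    (P : {mpoly k[n.+1]} -> Prop) : Prop := {
  rp_zero : P 0;
  rp_add : forall F G, P F -> P G -> P (F + G);
  rp_mul : forall F G, P G -> P (F * G);
  rp_prime : forall F G, P (F * G) -> P F \/ P G;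
  rp_homog : forall d F, P F -> P (pihomog mdeg d F);
  rp_relevant : exists i : 'I_n.+1, ~ P 'X_i }.

(* An integral closed subscheme X of P^n_k, given by its homogeneous prime
   ideal, together with its function field: [Rat] is the field of quotients
   F/G of forms of the same degree modulo the ideal. It is presented by an
   extension k -> Rat and by the homogeneous coordinates in Rat of the generic
   point of X; this determines (Rat, Rat_const) up to unique isomorphism. *)
Record projective_variety (k : fieldType) := ProjectiveVariety {
  adim : nat;
  hideal : {mpoly k[adim.+1]} -> Prop;
  hideal_prime : relevant_prime hideal;
  Rat : fieldType;
  Rat_const : {rmorphism k -> Rat};
  gcoord : 'I_adim.+1 -> Rat;
  gcoord_vanish : forall d (F : {mpoly k[adim.+1]}), F \is d.-homog ->
    (mmap Rat_const gcoord F = 0 <-> hideal F);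
  Rat_frac : forall f : Rat, exists d (F G : {mpoly k[adim.+1]}),
    [/\ F \is d.-homog, G \is d.-homog, ~ hideal G &
        f = mmap Rat_const gcoord F / mmap Rat_const gcoord G] }.

Section Points.
Variables (k : fieldType) (X : projective_variety k).
Implicit Types P Q : {mpoly k[(adim X).+1]} -> Prop.

Definition incl P Q := forall F, P F -> Q F.

Definition is_point P := relevant_prime P /\ incl (@hideal k X) P.

(* y lies in the closure of x iff the ideal of x is included in that of y. *)
Definition is_closed_point P :=
  is_point P /\ forall Q, is_point Q -> incl P Q -> incl Q P.

Definition strict_specialization P Q :=
  [/\ is_point P, is_point Q, incl P Q & ~ incl Q P].

(* Chains of irreducible closed subsets are chains of points. *)
Definition krull_dim1 :=
  (exists P Q, strict_specialization P Q) /\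
  (forall P Q S, ~ (strict_specialization P Q /\ strict_specialization Q S)).

Definition local_ring P (f : Rat X) := exists d (F G : {mpoly k[(adim X).+1]}),
  [/\ F \is d.-homog, G \is d.-homog, ~ P G &
      f = mmap (@Rat_const k X) (@gcoord k X) F
          / mmap (@Rat_const k X) (@gcoord k X) G].

Definition local_max P (f : Rat X) := exists d (F G : {mpoly k[(adim X).+1]}),
  [/\ F \is d.-homog, G \is d.-homog, P F, ~ P G &
      f = mmap (@Rat_const k X) (@gcoord k X) F
          / mmap (@Rat_const k X) (@gcoord k X) G].

Definition uniformizer P (w : Rat X) :=
  forall f, local_max P f <-> exists2 a, local_ring P a & f = a * w.

End Points.

(* On an integral curve the local rings at closed points have dimension 1 and
   the local ring at the generic point is a field, so regularity says that the
   maximal ideal at each closed point is generated by one element. *)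
Record regular_projective_curve (k : fieldType) := RegularProjectiveCurve {
  curve_variety :> projective_variety k;
  curve_dim1 : krull_dim1 curve_variety;
  curve_regular : forall P, @is_closed_point k curve_variety P ->
    exists w, uniformizer P w }.

Record closed_point (k : fieldType) (X : projective_variety k) := ClosedPoint {
  cp_ideal : {mpoly k[(adim X).+1]} -> Prop;
  cp_closed : is_closed_point cp_ideal }.

End ProjectiveGeometry.
Export ProjectiveGeometry.

From mathcomp Require Import all_classical all_reals all_analysis.
Import numFieldNormedType.Exports.
Local Open Scope classical_set_scope.
Local Open Scope ring_scope.

HB.instance Definition _ (k : fieldType) (X : projective_variety k) :=
  gen_eqMixin (closed_point X).
HB.instance Definition _ (k : fieldType) (X : projective_variety k) :=
  gen_choiceMixin (closed_point X).

Section Curve.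
Variables (k : fieldType) (X : regular_projective_curve k).
Local Notation K := (Rat X).
Local Notation cst := (@Rat_const k X).
Implicit Types (x : closed_point X) (f : K).

Definition local_unit x f :=
  local_ring (cp_ideal x) f /\ ~ local_max (cp_ideal x) f.

(* ord_x(f) = m iff f = w^m u with w a uniformizer and u a unit at x
   (and, by convention, ord_x(0) = 0). *)
Definition ord x f : int :=
  xget 0 [set m : int | exists w u,
    [/\ uniformizer (cp_ideal x) w, local_unit x u & f = w ^ m * u]].

(* [k(x) : k], the dimension over k of local ring / maximal ideal. *)
Definition residue_degree x : nat :=
  xget 0%N [set r : nat | exists e : 'I_r -> K,
    (forall i, local_ring (cp_ideal x) (e i)) /\
    (forall f, local_ring (cp_ideal x) f -> exists! c : 'rV[k]_r,
       local_max (cp_ideal x) (f - \sum_i cst (c 0 i) * e i))].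

Definition subspace_Rat (F : set K) :=
  F 0 /\ forall (c : k) f g, F f -> F g -> F (cst c * f + g).

Definition is_basis (F : set K) (r : nat) (e : 'I_r -> K) :=
  (forall i, F (e i)) /\
  (forall f, F f -> exists! c : 'rV[k]_r, f = \sum_i cst (c 0 i) * e i).

Section Degree.
Variables (R : realType) (N : K -> R).

(* The determinant norm of e_1 /\ ... /\ e_r in the top exterior power of the
   span of e: if s_i = \sum_j A_ij e_j, then
   s_1 /\ ... /\ s_r = det(A) e_1 /\ ... /\ e_r. *)
Definition det_norm (r : nat) (e : 'I_r -> K) : R :=
  inf [set \prod_i N (\sum_j cst (A i j) * e j) |
       A in [set A : 'M[k]_r | \det A = 1]].

(* Every non-zero element of the top exterior power of F is of the form
   e_1 /\ ... /\ e_r for some basis e of F. *)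
Definition is_adeg (F : set K) (d : R) :=
  exists r (e : 'I_r -> K), is_basis F e /\ d = - ln (det_norm e).

Definition adeg_plus (E : set K) : \bar R :=
  ereal_sup [set d%:E | d in [set d : R |
    exists F : set K, [/\ subspace_Rat F, F `<=` E & is_adeg F d]]].

End Degree.

Section Divisors.
Variable R : realType.
Implicit Types D : closed_point X -> R.

Definition Rdivisor D := finite_set [set x | D x != 0].

Definition effective_div D := forall x, 0 <= D x.

Definition pdiv f : closed_point X -> R := fun x => (ord x f)%:~R.

(* Elements \sum_i a_i (x) f_i of the tensor product of Rat(X)^* with R over Z
   are represented by the finite lists of the (a_i, f_i). The principal divisor
   depends only on the tensor, and the tensor is used only through it. *)
Definition RatR := seq (R * {f : K | f != 0}).

Definition pdivR (s : RatR) : closed_point X -> R :=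
  fun x => \sum_(p <- s) p.1 * pdiv (val p.2) x.

Definition principal D := exists s : RatR, D = pdivR s.

Definition H0 D : set K :=
  [set f | f = 0 \/ (f != 0 /\ effective_div (fun x => pdiv f x + D x))].

End Divisors.
End Curve.

(* Every point but the root lies on exactly one branch, at a unique parameter
   t in ]0, +oo]. *)
Inductive berkovich (R : realType) (k : fieldType)
    (X : regular_projective_curve k) : Type :=
| eta0
| branch of closed_point X & {t : \bar R | (0 < t)%E}.
Arguments eta0 {R k X}.
Arguments branch {R k X}.

HB.instance Definition _ (R : realType) (k : fieldType)
  (X : regular_projective_curve k) := gen_eqMixin (berkovich R X).
HB.instance Definition _ (R : realType) (k : fieldType)
  (X : regular_projective_curve k) := gen_choiceMixin (berkovich R X).

Section Berkovich.
Variables (R : realType) (k : fieldType) (X : regular_projective_curve k).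
Local Notation Xan := (berkovich R X).

(* Only used for t in [0, +oo]; negative t are sent to the root. *)
Definition xi (x : closed_point X) (t : \bar R) : Xan :=
  if insub t is Some u then branch x u else eta0.

Definition segment : set (\bar R) := [set t | (0 <= t)%E].

Definition berkovich_open (U : set Xan) :=
  (forall x, open (xi x @^-1` U : set (subspace segment))) /\
  (U eta0 -> finite_set [set x | ~ (xi x @` segment `<=` U)]).

Lemma berkovich_openT : berkovich_open setT.
Proof.
split=> [x|_]; first by rewrite preimage_setT; exact: openT.
by apply: sub_finite_set (finite_set0 _) => x /= [].
Qed.

Lemma berkovich_openI : setI_closed berkovich_open.
Proof.
move=> U V [oU fU] [oV fV]; split=> [x|[/fU{}fU /fV{}fV]].
  by rewrite preimage_setI; exact: openI.
apply: (@sub_finite_set _ _ ([set x | ~ (xi x @` segment `<=` U)] `|`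
                             [set x | ~ (xi x @` segment `<=` V)])).
  move=> x /= nUV; apply: contrapT => /not_orP[/contrapT sU /contrapT sV].
  by apply: nUV => y ys; split; [exact: sU|exact: sV].
by rewrite finite_setU.
Qed.

Lemma berkovich_open_bigU (I : Type) (U : I -> set Xan) :
  (forall i, berkovich_open (U i)) -> berkovich_open (\bigcup_i U i).
Proof.
move=> oU; split=> [x|[i _ Ui]].
  by rewrite preimage_bigcup; apply: bigcup_open => i _; exact: (oU i).1.
apply: sub_finite_set ((oU i).2 Ui) => x /= nU sU; apply: nU.
by move=> y /sU Uy; exists i.
Qed.

HB.instance Definition _ := isOpenTopological.Build Xan
  berkovich_openT berkovich_openI berkovich_open_bigU.

End Berkovich.

Section Metrised.
Variables (R : realType) (k : fieldType) (X : regular_projective_curve k).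
Local Notation Xan := (berkovich R X).
Local Notation K := (Rat X).
Implicit Types (x : closed_point X) (D : closed_point X -> R).
Implicit Types g : Xan -> \bar R.

Definition green D g :=
  continuous g /\
  exists phi : Xan -> R, continuous phi /\
    forall x (t : R), 0 <= t ->
      ((phi (xi x t%:E))%:E = g (xi x t%:E) - (D x * t)%:E)%E.

Definition metrised D g := Rdivisor D /\ green D g.

Definition canonical_green D : Xan -> \bar R := fun p =>
  if p is branch x t then ((D x)%:E * val t)%E else 0%E.

(* The pointwise sum away from the leaves xi x +oo, extended by continuity. *)
Definition green_add g1 g2 : Xan -> \bar R := fun p =>
  match p with
  | branch x t =>
    if val t == +oo%E
    then lim ((g1 (xi x s%:E) + g2 (xi x s%:E))%E @[s --> +oo])
    else (g1 p + g2 p)%E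
  | eta0 => (g1 p + g2 p)%E
  end.

(* At a leaf with ord_x(D) = 0 the value of a Green function is finite;
   otherwise it is infinite and n * +-oo is as expected for n > 0. *)
Definition green_scale (n : nat) g : Xan -> \bar R := fun p => ((n%:R : R)%:E * g p)%E.

Definition effective D g := effective_div D /\ forall p, (0 <= g p)%E.

Definition linearly_equivalent D1 g1 D2 g2 := exists s : RatR X R,
  D2 = D1 \+ pdivR s /\ g2 = green_add g1 (canonical_green (pdivR s)).

(* The infimum is finite when g is a Green function of D and s is in H0 D. *)
Definition green_norm g (s : K) : R :=
  if s == 0 then 0
  else expR (- fine (ereal_inf (range (green_add (canonical_green (pdiv R s)) g)))).

Definition avol D g : \bar R :=
  limn_esup (fun n : nat =>
    adeg_plus (green_norm (green_scale n g)) (H0 (fun x => (n%:R * D x)%R))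
    * ((n%:R ^+ 2 / 2 : R)^-1)%:E)%E.

Definition big D g := (0 < avol D g)%E.

Definition pseudo_effective D g := forall D0 g0,
  metrised D0 g0 -> big D0 g0 -> big (D \+ D0) (green_add g g0).

Definition mu_inf_at g x : \bar R :=
  ereal_inf [set (g (xi x t%:E) * (t^-1)%:E)%E | t in [set t : R | 0 < t]].

(* All but finitely many terms are <= 0, so that the first sum is finite. *)
Definition mu_inf g : \bar R :=
  let m x := (mu_inf_at g x * ((residue_degree x)%:R : R)%:E)%E in
  (\esum_(x in [set: closed_point X]) maxe (m x) 0
   - \esum_(x in [set: closed_point X]) maxe (- m x) 0)%E.

End Metrised.

(* Main.v *)
(* A metrised divisor (D, g) is big if and only if g >= rho + g_E for some
   rho > 0 and some R-divisor E of positive degree. Given such a bound, the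
   elements of H^0(nE) have norm at most exp(- n rho), and their dimension grows
   linearly in n by Riemann's inequality. Conversely, independent elements of
   H^0(nD) of norm < 1 lie in H^0(nE) for some E with g >= rho + g_E, and the
   dimension of H^0(nE) stays bounded when deg E <= 0. As mu_{inf,x}(g) is the
   largest slope a such that g >= a t on the branch of x, assertion (1) follows
   by adding to (D, g) arbitrarily small big metrised divisors; assertion (2)
   holds because every R-divisor of positive degree is linearly equivalent to an
   effective one, while principal divisors have degree 0.

   The geometry of the curve comes from valuations. By Chevalley's theorem and
   properness, the places of the function field K over k are exactly the closed
   points. Hence K is finite over k(z) for every z transcendental over k. Weak
   approximation bounds the number of zeros of z by [K : k(z)], and sections with
   poles along the polar divisor of z show that [K : k(z)] is at most the number
   of poles. Applied to z and 1/z, this gives deg (z) = 0, and the same sections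
   give Riemann's inequality. *)

Require Import Defs.
From mathcomp Require Import all_boot all_order all_algebra.
From mathcomp Require Import all_classical.
From mathcomp Require mpoly.
From mathcomp Require Import ring lra zify.
Set Implicit Arguments.
Unset Strict Implicit.
Unset Printing Implicit Defensive.
Import Order.TTheory GRing.Theory Num.Theory.
Local Open Scope classical_set_scope.
Local Open Scope ring_scope.

(** * Places of a field *)

(** Riemann's inequality is reached without differentials or cohomology. Linear algebra over k(z) is
    replaced by independence over k[z], so that [K : k(z)] occurs only as the maximal length of a
    [zindep] family, and dimensions of spaces of sections occur only through lower bounds [dim_ge].
    [ord] and [residue_degree] are choices with a default value: they mean nothing until orders are
    shown to exist and residue fields to be finite over k. The first needs the powers of a maximal
    ideal to intersect in 0, which is drawn from dimension one; the second rests on the fact that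
    lifts of independent residues are independent over k[w], for w a uniformizer. Green functions
    may be infinite at the leaves, where their sum is a limit. Each is therefore written phi + g_D
    with phi finite and continuous, and inequalities are tested at finite parameters only. If (D, g)
    is not big, boundedly many independent sections have norm below 1, and each of these still has
    norm at least exp(-nC). Arithmetic degrees are then O(n) and disappear after division by n^2. *)

Record place (K : fieldType) (O J : set K) : Prop := Place {
  place1 : O 1;
  placeB : forall a b, O a -> O b -> O (a - b);
  placeM : forall a b, O a -> O b -> O (a * b);
  place_sub : J `<=` O;
  place_id0 : J 0;
  place_idB : forall a b, J a -> J b -> J (a - b);
  place_idM : forall a b, O a -> J b -> J (a * b);
  place_id1 : ~ J 1;
  place_total : forall z, J z \/ O z^-1 }.

Section Chevalley.
Variables (K : fieldType) (F : set K).

(** Zorn's lemma is applied to subalgebras without unit instead of pairs (ring, proper ideal): the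
    ring need not be carried along, since it is recovered at the end as the set of multipliers of
    J. *)
Record nonunital (J : set K) : Prop := Nonunital {
  nuB : forall a b, J a -> J b -> J (a - b);
  nuM : forall a b, J a -> J b -> J (a * b);
  nuF : forall c a, F c -> J a -> J (c * a);
  nu1 : ~ J 1 }.

Section Maximal.
Variable J : set K.
Hypotheses (nuJ : nonunital J) (J0 : J 0).
Hypothesis maxJ : forall B, nonunital B -> J `<=` B -> B `<=` J.

Let O : set K := [set z | forall a, J a -> J (z * a)].

Let JN a : J a -> J (- a).
Proof. by move=> Ja; rewrite -sub0r; exact: nuB. Qed.

Let JD a b : J a -> J b -> J (a + b).
Proof. by move=> Ja Jb; rewrite -[b]opprK; apply: nuB => //; exact: JN. Qed.

Let JS (I : Type) (r : seq I) (P : pred I) (f : I -> K) :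
  (forall i, P i -> J (f i)) -> J (\sum_(i <- r | P i) f i).
Proof. by move=> Jf; apply: big_ind. Qed.

Let O1 : O 1. Proof. by move=> a Ja; rewrite mul1r. Qed.

Let OB a b : O a -> O b -> O (a - b).
Proof. by move=> Oa Ob c Jc; rewrite mulrBl; apply: nuB => //; [exact: Oa|exact: Ob]. Qed.

Let OM a b : O a -> O b -> O (a * b).
Proof. by move=> Oa Ob c Jc; rewrite -mulrA; apply: Oa; exact: Ob. Qed.

Let JO : J `<=` O. Proof. by move=> a Ja b Jb; exact: nuM. Qed.

Let OD a b : O a -> O b -> O (a + b).
Proof. by move=> Oa Ob c Jc; rewrite mulrDl; apply: JD => //; [exact: Oa|exact: Ob]. Qed.

Let adjoin z : set K := [set q.[z] | q in [set q : {poly K} | forall i, J q`_i]].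

Let adjoinP z : adjoin z 1 \/ O z.
Proof.
have [|n1] := pselect (adjoin z 1); [by left|right].
have nuA : nonunital (adjoin z).
  split=> // [_ _ [p Jp <-] [q Jq <-]|_ _ [p Jp <-] [q Jq <-]|c _ Fc [p Jp <-]].
  - by exists (p - q); rewrite ?hornerE // => i; rewrite coefB; exact: nuB.
  - exists (p * q); rewrite ?hornerE // => i; rewrite coefM; apply: JS => j _.
    exact: nuM.
  - by exists (c *: p); rewrite ?hornerE // => i; rewrite coefZ; exact: nuF.
move=> a Ja; apply: (maxJ nuA).
  by move=> b Jb; exists b%:P; rewrite ?hornerE // => i /=; rewrite coefC; case: eqP.
by exists (a *: 'X); rewrite ?hornerE 1?mulrC // => i /=; rewrite coefZ coefX; case: eqP => _;
  rewrite ?mulr1 ?mulr0.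
Qed.

(** Inverting 1 - j in J keeps it non-unital, because (1 - j)^r is congruent to 1 modulo J and so
    never lies in J. Maximality then says that J is already stable under division by 1 - j. *)
Let unit_near1 j : J j -> O (1 - j)^-1.
Proof.
move=> Jj; have nj : 1 - j != 0.
  by rewrite subr_eq0; apply/eqP => j1; apply: (nu1 nuJ); rewrite j1.
have Je a r : J a -> J (a * (1 - j) ^+ r).
  elim: r a => [|r IH] a Ja; first by rewrite expr0 mulr1.
  by rewrite exprS mulrA; apply: IH; rewrite mulrBr mulr1; apply: nuB => //; exact: nuM.
have J1e r : J (1 - (1 - j) ^+ r).
  elim: r => [|r IH]; first by rewrite expr0 subrr.
  rewrite exprS; have -> : 1 - (1 - j) * (1 - j) ^+ r = (1 - (1 - j) ^+ r) + j * (1 - j) ^+ r.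
    by ring.
  by apply: JD => //; exact: Je.
pose B := [set x | exists r, J (x * (1 - j) ^+ r)].
have nuB' : nonunital B.
  split.
  - move=> a b [r Ja] [s Jb]; exists (r + s)%N; rewrite mulrBl exprD.
    apply: nuB => //; first by rewrite mulrA; exact: Je.
    by rewrite [_ ^+ r * _]mulrC mulrA; exact: Je.
  - by move=> a b [r Ja] [s Jb]; exists (r + s)%N; rewrite exprD mulrACA; exact: nuM.
  - by move=> c a Fc [r Ja]; exists r; rewrite -mulrA; exact: nuF.
  - case=> r; rewrite mul1r => Jr; apply: (nu1 nuJ).
    by rewrite -(subrK ((1 - j) ^+ r) 1); exact: JD.
move=> a Ja; apply: (maxJ nuB').
  by move=> b Jb; exists 0%N; rewrite expr0 mulr1.
by exists 1%N; rewrite expr1 mulrAC mulVf // mul1r.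
Qed.

(** Chevalley's descent: the shorter of the two relations, cleared of negative powers, rewrites the
    leading power in the longer one and lowers its degree. The situation is symmetric in z and its
    inverse. *)
Let no_relations z (p q : {poly K}) : z != 0 -> (forall i, J p`_i) -> (forall i, J q`_i) ->
  p.[z] = 1 -> q.[z^-1] = 1 -> False.
Proof.
have [N leN] := ubnP (size p + size q); elim: N => // N IH in z p q leN *.
wlog spq : z p q leN / (size q <= size p)%N.
  move=> W z0 Jp Jq pz qz; have /orP[] := leq_total (size q) (size p).
    by move=> h; apply: (W z p q).
  by move=> h; apply: (W z^-1 q p) => //; rewrite ?invr_eq0 ?invrK // addnC.
move=> z0 Jp Jq pz qz.
case sp : (size p) => [|n].
  by move/eqP: sp pz; rewrite size_poly_eq0 => /eqP->; rewrite horner0 => /eqP; rewrite eq_sym oner_eq0.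
set u := (1 - q`_0)^-1; have Ou : O u by exact: unit_near1.
have nq : 1 - q`_0 != 0.
  by rewrite subr_eq0; apply/eqP => j1; apply: (nu1 nuJ); rewrite j1.
(* Multiply q(1/z) = 1 by z^n and move the constant term of q to the other side; its cofactor 1 -
   q_0 is invertible in O. *)
have zn : z ^+ n = \sum_(i < n) u * q`_(n - i) * z ^+ i.
  have : (1 - q`_0) * z ^+ n = \sum_(i < n) q`_(n - i) * z ^+ i.
    rewrite mulrBl mul1r -{1}(mul1r (z ^+ n)) -qz (@horner_coef_wide _ n.+1) -?sp //.
    rewrite mulr_suml sp big_ord_recl /= expr0 mulr1 addrAC subrr add0r.
    rewrite (reindex_inj rev_ord_inj) /=; apply: eq_bigr => i _.
    rewrite /bump /= add1n subnSK // exprVn -mulrA; congr (_ * _).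
    by rewrite -[in X in _ * X](subnK (ltnW (ltn_ord i))) exprD mulrA mulVf ?mul1r // expf_neq0.
  move=> /(congr1 ( *%R u)); rewrite mulrA mulVf // mul1r => ->; rewrite mulr_sumr.
  by apply: eq_bigr => i _; rewrite mulrA.
pose p' := \poly_(i < n) (p`_i + p`_n * u * q`_(n - i)).
have sp' : (size p' <= n)%N by exact: size_poly.
apply: (IH z p' q) => //.
- by move: leN; rewrite sp addSn ltnS; apply: leq_trans; rewrite ltnS leq_add2r.
- move=> i; rewrite coef_poly; case: ifP => // _; apply: JD => //.
  by rewrite -mulrA mulrC; apply: nuM => //; apply: Ou.
- rewrite -pz (@horner_coef_wide _ n) // (@horner_coef_wide _ n.+1) ?sp // big_ord_recr /= zn.
  rewrite mulr_sumr -big_split /=; apply: eq_bigr => i _.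
  by rewrite coef_poly ltn_ord mulrDl !mulrA.
Qed.

Lemma maximal_nonunital_place : place O J.
Proof.
apply: (Place O1 OB OM JO J0 (nuB nuJ) _ (nu1 nuJ)); first by move=> a b Oa; exact: Oa.
move=> z; have [Oz|nOz] := pselect (O z^-1); [by right|left].
have [->//|z0] := eqVneq z 0.
have [[q Jq q1]|//] := adjoinP z^-1.
have Oz : O z.
  have [[p Jp p1]|//] := adjoinP z; by case: (no_relations z0 Jp Jq p1 q1).
(* If 1 = j + z o, then 1/z = o / (1 - j) would lie in O, against the assumption. So this set misses
   1, and maximality absorbs z into J. *)
have : nonunital [set j + z * o | j in J & o in O].
  split=> [_ _ [j Jj [o Oo <-]] [j' Jj' [o' Oo' <-]]|
           _ _ [j Jj [o Oo <-]] [j' Jj' [o' Oo' <-]]|c _ Fc [j Jj [o Oo <-]]|].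
  - exists (j - j'); first exact: nuB.
    by exists (o - o'); [exact: OB|rewrite mulrBr opprD addrACA].
  - exists (j * j'); first exact: nuM.
    exists (j * o' + o * j' + o * o' * z).
      by do 2?[apply: OD]; do ?[apply: OM => //]; exact: JO.
    by ring.
  - exists (c * j); first exact: nuF.
    by exists (c * o); [apply: OM => // a Ja; exact: nuF|rewrite mulrDr mulrCA].
  - move=> [j Jj [o Oo jo1]]; apply: nOz.
    have -> : z^-1 = o * (1 - j)^-1.
      have zo : z * o = 1 - j by rewrite -jo1 addrAC subrr add0r.
      have o0 : o != 0.
        apply/eqP => o0; move: zo; rewrite o0 mulr0 => /esym/eqP.
        by rewrite subr_eq0 => /eqP j1; apply: (nu1 nuJ); rewrite j1.
      by rewrite -zo invfM mulrCA divff // mulr1.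
    by apply: OM => //; exact: unit_near1.
move=> /maxJ; apply.
  by move=> a Ja; exists a => //; exists 0; rewrite ?mulr0 ?addr0 //; exact: JO.
by exists 0 => //; exists 1; rewrite ?mulr1 ?add0r.
Qed.

End Maximal.

(* Chevalley's extension theorem: a maximal proper [J] containing [I] is the
   maximal ideal of a valuation ring, namely of its idealizer. *)
Lemma exists_place (I : set K) : I 0 -> nonunital I ->
  exists O J, [/\ place O J, I `<=` J & F `<=` O].
Proof.
move=> I0 nuI.
pose P := [set J : set K | J = set0 \/ (I `<=` J /\ nonunital J)].
have [|J [PJ maxJ]] := @Zorn_bigcup K P.
  move=> C CP tC; pose U := \bigcup_(A in C) A.
  have [/eqP U0|/set0P[a0 [A0 CA0 A0a]]] := boolP (U == set0); first by left.
  right; have good A a : C A -> A a -> I `<=` A /\ nonunital A.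
    by move=> CA Aa; case: (CP _ CA) => // A0'; move: Aa; rewrite A0'.
  have two a b : U a -> U b -> exists A, [/\ C A, A a & A b].
    move=> [A CA Aa] [B CB Bb]; have [AB|BA] := tC _ _ CA CB.
      by exists B; split=> //; exact: AB.
    by exists A; split=> //; exact: BA.
  split; first by move=> x Ix; exists A0 => //; exact: (good _ _ CA0 A0a).1.
  split.
  - move=> a b /two h /h[A [CA Aa Ab]]; exists A => //.
    by have [_ nuA] := good _ _ CA Aa; exact: nuB.
  - move=> a b /two h /h[A [CA Aa Ab]]; exists A => //.
    by have [_ nuA] := good _ _ CA Aa; exact: nuM.
  - move=> c a Fc [A CA Aa]; exists A => //.
    by have [_ nuA] := good _ _ CA Aa; exact: nuF.
  - move=> [A CA A1]; have [_ nuA] := good _ _ CA A1; exact: (nu1 nuA).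
have [J0|[IJ nuJ]] := PJ.
  exfalso; apply: (maxJ I); last by right; split.
  by rewrite J0; split=> [x []|/(_ _ I0) []].
have mJ B : nonunital B -> J `<=` B -> B `<=` J.
  move=> nuB' JB; apply: contrapT => nBJ; apply: (maxJ B) => //.
  by right; split=> //; apply: subset_trans JB.
exists [set z | forall a, J a -> J (z * a)], J; split=> //.
- by apply: maximal_nonunital_place => //; exact: IJ.
- by move=> c Fc a Ja; exact: nuF.
Qed.

End Chevalley.

(** * Linear algebra over the constants *)

Section LinearAlgebra.
Variables (k K : fieldType) (cst : {rmorphism k -> K}).
Implicit Types V A : set K.

Definition lcomb m (c : 'rV[k]_m) (u : 'I_m -> K) : K := \sum_i cst (c 0 i) * u i.

Definition lin_subset V := V 0 /\ forall c f g, V f -> V g -> V (cst c * f + g).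

Definition indep_mod A m (u : 'I_m -> K) := forall c : 'rV[k]_m, A (lcomb c u) -> c = 0.

(** Stating only lower bounds avoids having to know in advance that a space of sections is
    finite-dimensional. *)
Definition dim_ge V m :=
  exists u : 'I_m -> K, (forall i, V (u i)) /\ indep_mod [set 0] u.

Lemma lin_subsetD V f g : lin_subset V -> V f -> V g -> V (f + g).
Proof. by move=> [_ lV] Vf Vg; rewrite -[f]mul1r -(rmorph1 cst); exact: lV. Qed.

Lemma lin_subsetZ V c f : lin_subset V -> V f -> V (cst c * f).
Proof. by move=> [V0 lV] Vf; rewrite -[_ * _]addr0; exact: lV. Qed.

Lemma lin_subsetB V f g : lin_subset V -> V f -> V g -> V (f - g).
Proof.
move=> lV Vf Vg; apply: lin_subsetD => //.
by rewrite -mulN1r -(rmorph1 cst) -rmorphN; exact: lin_subsetZ.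
Qed.

Lemma lin_subset_sum V (I : Type) (r : seq I) (f : I -> K) :
  lin_subset V -> (forall i, V (f i)) -> V (\sum_(i <- r) f i).
Proof.
move=> lV Vf; elim/big_ind: _ => //; first exact: lV.1.
by move=> x y; exact: lin_subsetD.
Qed.

Lemma lin_subset_lcomb V m (c : 'rV[k]_m) u :
  lin_subset V -> (forall i, V (u i)) -> V (lcomb c u).
Proof. by move=> lV Vu; apply: lin_subset_sum => // i; exact: lin_subsetZ. Qed.

Lemma lcomb0 m (u : 'I_m -> K) : lcomb 0 u = 0.
Proof. by rewrite /lcomb big1 // => i _; rewrite mxE rmorph0 mul0r. Qed.

Lemma lcombP m (a : k) (c d : 'rV[k]_m) u :
  lcomb (a *: c + d) u = cst a * lcomb c u + lcomb d u.
Proof.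
rewrite /lcomb mulr_sumr -big_split /=; apply: eq_bigr => i _.
by rewrite !mxE rmorphD rmorphM mulrDl mulrA.
Qed.

Lemma lcombB m (c d : 'rV[k]_m) u : lcomb (c - d) u = lcomb c u - lcomb d u.
Proof. by rewrite addrC -scaleN1r lcombP rmorphN1 mulN1r addrC. Qed.

Lemma lcombM m n (c : 'rV[k]_n) (B : 'M[k]_(n, m)) u :
  lcomb (c *m B) u = lcomb c (fun i => lcomb (row i B) u).
Proof.
rewrite /lcomb; under eq_bigr => i _ do rewrite mxE rmorph_sum mulr_suml.
rewrite exchange_big /=; apply: eq_bigr => j _; rewrite mulr_sumr.
by apply: eq_bigr => i _; rewrite mxE rmorphM mulrA.
Qed.

Lemma lcomb_mull m (c : 'rV[k]_m) (u : 'I_m -> K) a :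
  lcomb c (fun i => a * u i) = a * lcomb c u.
Proof. by rewrite /lcomb mulr_sumr; apply: eq_bigr => i _; rewrite mulrCA. Qed.

Lemma eq_lcomb m (c : 'rV[k]_m) (u u' : 'I_m -> K) :
  u =1 u' -> lcomb c u = lcomb c u'.
Proof. by move=> uu'; apply: eq_bigr => i _; rewrite uu'. Qed.

Definition glue m n (u : 'I_m -> K) (u' : 'I_n -> K) (i : 'I_(m + n)) : K :=
  match fintype.split i with inl j => u j | inr j => u' j end.

Lemma lcomb_glue m n (c : 'rV[k]_(m + n)) (u : 'I_m -> K) (u' : 'I_n -> K) :
  lcomb c (glue u u') = lcomb (lsubmx c) u + lcomb (rsubmx c) u'.
Proof.
rewrite /lcomb big_split_ord /=; congr (_ + _); apply: eq_bigr => i _; rewrite !mxE /glue.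
  by case: split_ordP => j /eqP; rewrite ?eq_lshift ?eq_lrshift // => /eqP <-.
by case: split_ordP => j /eqP; rewrite ?eq_rshift ?eq_rlshift // => /eqP <-.
Qed.

Lemma glue_in V m n (u : 'I_m -> K) (u' : 'I_n -> K) :
  (forall i, V (u i)) -> (forall i, V (u' i)) -> forall i, V (glue u u' i).
Proof. by move=> Vu Vu' i; rewrite /glue; case: fintype.split. Qed.

Lemma indep_mod_mul A m n (B : 'M[k]_(n, m)) (u : 'I_m -> K) :
  row_free B -> indep_mod A u -> indep_mod A (fun i => lcomb (row i B) u).
Proof.
move=> fB iu c; rewrite -lcombM => /iu /eqP.
by rewrite mulmx_free_eq0 // => /eqP.
Qed.

Lemma dim_ge_leq V m n : lin_subset V -> (n <= m)%N -> dim_ge V m -> dim_ge V n.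
Proof.
move=> lV nm [u [Vu iu]]; pose B : 'M[k]_(n, m) := pid_mx n.
exists (fun i => lcomb (row i B) u); split=> [i|]; first exact: lin_subset_lcomb.
by apply: indep_mod_mul => //; rewrite /row_free rank_pid_mx.
Qed.

Lemma dim_ge_sub V V' m : V `<=` V' -> dim_ge V m -> dim_ge V' m.
Proof. by move=> VV' [u [Vu iu]]; exists u; split=> // i; exact: VV'. Qed.

(** Rank-nullity for r linear conditions. Linearity is asked on V only, since residue maps are
    linear only where they are defined; the truncated subtraction makes the bound trivial when r
    exceeds m. *)
Lemma dim_ge_ker V m r (phi : K -> 'rV[k]_r) : lin_subset V ->
  (forall c f g, V f -> V g -> phi (cst c * f + g) = c *: phi f + phi g) ->
  dim_ge V m -> dim_ge [set f | V f /\ phi f = 0] (m - r).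
Proof.
move=> lV lphi [u [Vu iu]].
have phi0 : phi 0 = 0.
  have /eqP := lphi 1 0 0 lV.1 lV.1.
  by rewrite mulr0 addr0 scale1r -subr_eq subrr eq_sym => /eqP.
have phiE c : phi (lcomb c u) = c *m \matrix_i phi (u i).
  suff H (s : seq 'I_m) : V (\sum_(i <- s) cst (c 0 i) * u i) /\
      phi (\sum_(i <- s) cst (c 0 i) * u i) = \sum_(i <- s) c 0 i *: phi (u i).
    have [_ ->] := H (index_enum 'I_m); apply/rowP => j; rewrite summxE mxE.
    by apply: eq_bigr => i _; rewrite !mxE.
  elim: s => [|i s [Vs IH]]; first by rewrite !big_nil; split=> //; exact: lV.1.
  by rewrite !big_cons; split; [exact: lV.2|rewrite lphi // IH].
set M := \matrix_i phi (u i) in phiE.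
pose B := row_base (kermx M).
have lW : lin_subset [set f | V f /\ phi f = 0].
  split; first by split=> //; exact: lV.1.
  move=> c f g [Vf pf] [Vg pg]; split; first exact: lV.2.
  by rewrite lphi // pf pg scaler0 addr0.
apply: (@dim_ge_leq _ (\rank (kermx M))) => //.
  by rewrite mxrank_ker leq_sub2l // rank_leq_col.
exists (fun i => lcomb (row i B) u); split; last first.
  by apply: indep_mod_mul => //; exact: row_base_free.
move=> i; split; first exact: lin_subset_lcomb.
rewrite phiE; apply/sub_kermxP; apply: submx_trans (row_sub _ _) _.
by rewrite eq_row_base.
Qed.

Lemma dim_ge0 m : dim_ge [set 0] m -> m = 0%N.
Proof.
case: m => // m [u [u0 iu]]; have /rowP/(_ ord0) : const_mx 1 = 0 :> 'rV[k]_m.+1.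
  by apply: iu; rewrite /lcomb big1 /= // => i _; rewrite u0 mulr0.
by rewrite !mxE => /eqP; rewrite oner_eq0.
Qed.

Lemma indep_neq0 m (u : 'I_m -> K) i : indep_mod [set 0] u -> u i != 0.
Proof.
move=> iu; apply/eqP => ui0.
have /rowP/(_ i) : delta_mx 0 i = 0 :> 'rV[k]_m.
  apply: iu; rewrite /lcomb big1 //= => j _; rewrite mxE eqxx /=.
  by case: eqP => [->|_]; rewrite ?ui0 ?mulr0 // rmorph0 mul0r.
by rewrite !mxE !eqxx => /eqP; rewrite oner_eq0.
Qed.

Lemma exists_quotient_basis V A N : lin_subset V -> lin_subset A -> A `<=` V ->
  (forall m (u : 'I_m -> K), (forall i, V (u i)) -> indep_mod A u -> (m <= N)%N) ->
  exists r (e : 'I_r -> K), (forall i, V (e i)) /\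
    forall f, V f -> exists! c : 'rV[k]_r, A (f - lcomb c e).
Proof.
move=> lV lA AV bd.
pose Q m := `[< exists u : 'I_m -> K, (forall i, V (u i)) /\ indep_mod A u >].
have exQ : exists m, Q m.
  exists 0%N; apply/asboolP; exists (fun _ => 0).
  by split=> [[]//|c _]; apply/rowP => -[].
have ubQ m : Q m -> (m <= N)%N by move=> /asboolP[u [Vu iu]]; exact: bd iu.
case: (ex_maxnP exQ ubQ) => r /asboolP[e [Ve ie]] maxr.
exists r, e; split=> // f Vf.
(* By maximality of r, adding f to e creates a relation modulo A. The coefficient of f in it is
   non-zero because e is independent, so f can be solved for. *)
have : ~ indep_mod A (glue (fun _ : 'I_1 => f) e).
  move=> ix; suff : (1 + r <= r)%N by rewrite ltnn.
  by apply: maxr; apply/asboolP; exists (glue (fun _ : 'I_1 => f) e); split=> //; exact: glue_in.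
move=> /existsNP[c /not_implyP[]]; rewrite lcomb_glue => Ac c0.
set a := lsubmx c 0 0.
have E1 : lcomb (lsubmx c) (fun=> f) = cst a * f by rewrite /lcomb big_ord1.
have a0 : a != 0.
  apply/eqP => a0; apply: c0; rewrite -(hsubmxK c).
  have -> : lsubmx c = 0 by apply/rowP => j; rewrite ord1 -/a a0 mxE.
  by move: Ac; rewrite E1 a0 rmorph0 mul0r add0r => /ie ->; rewrite row_mx0.
exists (- a^-1 *: rsubmx c); split.
  have -> : f - lcomb (- a^-1 *: rsubmx c) e = cst a^-1 * (lcomb (lsubmx c) (fun=> f) + lcomb (rsubmx c) e).
    rewrite E1 mulrDr mulrA -rmorphM mulVf // rmorph1 mul1r; congr (_ + _).
    by rewrite -[_ *: _]addr0 lcombP lcomb0 addr0 rmorphN mulNr opprK.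
  exact: lin_subsetZ.
move=> d Ad; apply/eqP; rewrite -subr_eq0; apply/eqP/ie.
rewrite lcombB; set x := lcomb _ _; set y := lcomb _ _.
have -> : x - y = (f - y) - (f - x) by ring.
apply: lin_subsetB => //.
have -> : f - x = cst a^-1 * (lcomb (lsubmx c) (fun=> f) + lcomb (rsubmx c) e).
  rewrite /x E1 mulrDr mulrA -rmorphM mulVf // rmorph1 mul1r; congr (_ + _).
  by rewrite -[_ *: _]addr0 lcombP lcomb0 addr0 rmorphN mulNr opprK.
exact: lin_subsetZ.
Qed.

End LinearAlgebra.

(** * Independence over k[z] *)

Section PolynomialIndependence.
Variables (k K : fieldType) (cst : {rmorphism k -> K}).
Local Notation lcomb := (lcomb cst).

Definition ev (z : K) (p : {poly k}) : K := (map_poly cst p).[z].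

Lemma evD z p q : ev z (p + q) = ev z p + ev z q.
Proof. by rewrite /ev rmorphD hornerD. Qed.

Lemma evM z p q : ev z (p * q) = ev z p * ev z q.
Proof. by rewrite /ev rmorphM hornerM. Qed.

Lemma ev0 z : ev z 0 = 0. Proof. by rewrite /ev rmorph0 horner0. Qed.

Lemma ev1 z : ev z 1 = 1. Proof. by rewrite /ev rmorph1 hornerC. Qed.

Lemma evC z c : ev z c%:P = cst c. Proof. by rewrite /ev map_polyC hornerC. Qed.

Lemma evX z : ev z 'X = z. Proof. by rewrite /ev map_polyX hornerX. Qed.

Lemma evN z p : ev z (- p) = - ev z p.
Proof. by rewrite /ev rmorphN hornerN. Qed.

Lemma ev_sum z (I : Type) (r : seq I) (p : I -> {poly k}) :
  ev z (\sum_(i <- r) p i) = \sum_(i <- r) ev z (p i).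
Proof. by apply: (big_morph (ev z)); [exact: evD|exact: ev0]. Qed.

Lemma ev_coef z n (p : {poly k}) : (size p <= n)%N ->
  ev z p = \sum_(j < n) cst p`_j * z ^+ j.
Proof.
move=> sp; rewrite /ev (@horner_coef_wide _ n) ?size_map_poly //.
by apply: eq_bigr => i _; rewrite coef_map.
Qed.

(* Independence of the [u i] over the subring k[z]; [c j] collects the
   coefficients of [z ^+ j]. *)
Definition zindep (z : K) m (u : 'I_m -> K) := forall D (c : nat -> 'rV[k]_m),
  \sum_(j < D) z ^+ j * lcomb (c j) u = 0 -> forall j, (j < D)%N -> c j = 0.

Definition transc z := zindep z (fun _ : 'I_1 => 1).

(** Multiplying a relation over k[1/z] by z^D reverses the order of its coefficients. *)
Lemma zindep_inv z m (u : 'I_m -> K) : z != 0 -> zindep z u -> zindep z^-1 u.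
Proof.
move=> z0 iu [//|D] c c0 j jD.
have : \sum_(i < D.+1) z ^+ i * lcomb (c (D - i)%N) u = 0.
  transitivity (z ^+ D * (\sum_(i < D.+1) z^-1 ^+ i * lcomb (c i) u)); last by rewrite c0 mulr0.
  rewrite mulr_sumr (reindex_inj rev_ord_inj) /=.
  apply: eq_bigr => i _; rewrite subSS subKn -1?ltnS // mulrA; congr (_ * _).
  rewrite exprVn -[in X in _ = X / _](subnK (_ : i <= D)%N) -1?ltnS //.
  by rewrite exprD mulfK // expf_neq0.
move=> /(iu D.+1 (fun i => c (D - i)%N)) /(_ (D - j)%N).
by rewrite ltnS leq_subr subKn -1?ltnS //; exact.
Qed.

Lemma transcV z : z != 0 -> transc z -> transc z^-1.
Proof. exact: zindep_inv. Qed.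

Lemma transc_ev z p : transc z -> p != 0 -> ev z p != 0.
Proof.
move=> tz p0; apply/eqP => pz.
have sp : ((size p).-1 < size p)%N by rewrite prednK // size_poly_gt0.
have : const_mx p`_(size p).-1 = 0 :> 'rV_1.
  apply: (tz (size p) (fun j => const_mx p`_j)) => //.
  transitivity (ev z p) => //; rewrite (ev_coef _ (leqnn _)).
  by apply: eq_bigr => i _; rewrite /lcomb big_ord1 !mxE mulr1 mulrC.
by move=> /rowP/(_ ord0); rewrite !mxE => /eqP; rewrite lead_coef_eq0 (negPf p0).
Qed.

Lemma transc_neq0 z : transc z -> z != 0.
Proof. by move=> tz; rewrite -[z]evX transc_ev // polyX_eq0. Qed.

Definition alg_over z y := exists d (q : nat -> {poly k}),
  q d != 0 /\ \sum_(i < d.+1) ev z (q i) * y ^+ i = 0.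

Inductive gen_alg (a : seq K) : K -> Prop :=
| gen_cst c : gen_alg a (cst c)
| gen_mem y : y \in a -> gen_alg a y
| gen_add f g : gen_alg a f -> gen_alg a g -> gen_alg a (f + g)
| gen_mul f g : gen_alg a f -> gen_alg a g -> gen_alg a (f * g).

(* Up to denominators, the k(z)-span of the [s t]. *)
Definition spanZ z (T : finType) (s : T -> K) : set K := [set w |
  exists q (p : T -> {poly k}), q != 0 /\ ev z q * w = \sum_t ev z (p t) * s t].

Section SpanZ.
Variables (z : K) (T : finType) (s : T -> K).
Local Notation S := (spanZ z s).

Lemma spanZ_mem t : S (s t).
Proof.
exists 1, (fun t' => if t' == t then 1 else 0); split; first exact: oner_neq0.
rewrite (bigD1 t) //= eqxx ev1 mul1r big1 ?addr0 ?mul1r // => i /negPf->.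
by rewrite ev0 mul0r.
Qed.

Lemma spanZ0 : S 0.
Proof.
exists 1, (fun=> 0); split; first exact: oner_neq0.
by rewrite mulr0 big1 // => t _; rewrite ev0 mul0r.
Qed.

Lemma spanZD w w' : S w -> S w' -> S (w + w').
Proof.
move=> [q [p [q0 e]]] [q' [p' [q0' e']]].
exists (q * q'), (fun t => q' * p t + q * p' t); split; first by rewrite mulf_neq0.
under eq_bigr => t _ do rewrite evD !evM mulrDl -!mulrA.
by rewrite big_split /= -!mulr_sumr -e -e' evM mulrDr; ring.
Qed.

Lemma spanZ_sum (I : Type) (r : seq I) (P : pred I) (f : I -> K) :
  (forall i, P i -> S (f i)) -> S (\sum_(i <- r | P i) f i).
Proof. by move=> Sf; apply: big_ind => //; [exact: spanZ0|exact: spanZD]. Qed.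

Lemma spanZZ r w : S w -> S (ev z r * w).
Proof.
move=> [q [p [q0 e]]]; exists q, (fun t => r * p t); split=> //.
by rewrite mulrCA e mulr_sumr; apply: eq_bigr => t _; rewrite evM mulrA.
Qed.

Lemma spanZ_div r w : r != 0 -> S (ev z r * w) -> S w.
Proof.
move=> r0 [q [p [q0 e]]]; exists (q * r), p; split; first by rewrite mulf_neq0.
by rewrite evM -mulrA.
Qed.

Lemma spanZ_stable b w : (forall t, S (b * s t)) -> S w -> S (b * w).
Proof.
move=> Sb [q [p [q0 e]]]; apply: (spanZ_div q0).
rewrite mulrCA e mulr_sumr; apply: spanZ_sum => t _.
by rewrite mulrCA; exact: spanZZ.
Qed.

End SpanZ.

(** The generators are monomials in the elements of [a] with bounded exponents: a power beyond the
    bound is rewritten by the algebraic equation, whose leading coefficient is a denominator that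
    [spanZ] tolerates. *)
Lemma alg_finite z (a : seq K) : transc z -> (forall y, y \in a -> alg_over z y) ->
  exists (T : finType) (s : T -> K), spanZ z s 1 /\
    forall y w, y \in a -> spanZ z s w -> spanZ z s (y * w).
Proof.
move=> tz; elim: a => [_|b a IH ha].
  exists unit, (fun=> 1); split=> //; exact: (spanZ_mem z (fun=> 1) tt).
have [|T [s [s1 sa]]] := IH; first by move=> y ya; apply: ha; rewrite inE ya orbT.
have [d [q [qd e]]] : alg_over z b by apply: ha; rewrite mem_head.
case: d => [|d] in qd e *.
  by move: e; rewrite big_ord1 expr0 mulr1 => /eqP; rewrite (negPf (transc_ev tz qd)).
pose s' (x : 'I_d.+1 * T) := b ^+ x.1 * s x.2.
have mem' e' w : (e' < d.+1)%N -> spanZ z s w -> spanZ z s' (b ^+ e' * w).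
  move=> ed [r [p [r0 er]]]; apply: (spanZ_div r0).
  rewrite mulrCA er mulr_sumr; apply: spanZ_sum => t _.
  rewrite mulrCA; apply: spanZZ.
  by rewrite (_ : _ * _ = s' (Ordinal ed, t)) //; exact: spanZ_mem.
exists ('I_d.+1 * T)%type, s'; split.
  by have := mem' 0%N 1 isT s1; rewrite expr0 mulr1.
move=> y w; rewrite inE => /orP[/eqP->|ya]; apply: spanZ_stable => -[i t]; rewrite /s' /=.
  rewrite mulrA -exprS; have [id|di] := ltnP i.+1 d.+1; first by apply: mem' => //; exact: spanZ_mem.
  have -> : i.+1 = d.+1 by apply/eqP; rewrite eqn_leq di ltn_ord.
  apply: (spanZ_div qd); move: e; rewrite big_ord_recr /= => /eqP; rewrite addrC addr_eq0 => /eqP e.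
  rewrite mulrA e mulNr -mulrN mulr_suml; apply: spanZ_sum => j _.
  rewrite mulrN -mulrA -mulrN -mulN1r mulrCA -(ev1 z) -evN; apply: spanZZ; apply: spanZZ.
  by apply: mem' => //; exact: spanZ_mem.
rewrite mulrCA; apply: mem' => //; apply: sa => //; exact: spanZ_mem.
Qed.

(** More than |T| vectors in a k(z)-space spanned by |T| elements satisfy a relation, which can be
    taken over k[z]. The factor b is a common denominator of the u i. *)
Lemma zindep_spanZ z m (u : 'I_m -> K) (T : finType) (s : T -> K) b :
  transc z -> b != 0 -> (forall i, spanZ z s (u i * b)) -> zindep z u -> (m <= #|T|)%N.
Proof.
move=> tz b0 su iu; rewrite leqNgt; apply/negP => Tm.
have /choice[q /choice[p /all_and2[q0 e]]] : forall i, exists q (p : T -> {poly k}),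
    q != 0 /\ ev z q * (u i * b) = \sum_t ev z (p t) * s t by [].
pose Q := \prod_i q i; have Q0 : Q != 0 by apply/prodf_neq0 => i _; exact: q0.
pose P i t := p i t * \prod_(l | l != i) q l.
have eP i : ev z Q * (u i * b) = \sum_t ev z (P i t) * s t.
  rewrite /Q (bigD1 i) //= mulrC evM mulrA [_ * ev z (q i)]mulrC e mulr_suml.
  by apply: eq_bigr => t _; rewrite /P evM mulrAC.
(* The coefficient matrix is padded with zero columns to be square. Its determinant vanishes, so it
   has a non-zero left kernel vector with entries in k[z]. *)
pose A : 'M[{poly k}]_m := \matrix_(i, j)
  (if insub (nat_of_ord j) is Some j' then P i (@enum_val T predT j') else 0).
have detA : \det A == 0.
  rewrite -det_tr (expand_det_row _ (Ordinal Tm)) big1 // => j _.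
  by rewrite !mxE insubN ?mul0r //= -leqNgt.
have [v v0 vA] := det0P detA.
have vP t : \sum_i v 0 i * P i t = 0.
  have := congr1 (fun M : 'rV_m => M 0 (widen_ord (ltnW Tm) (enum_rank t))) vA.
  rewrite !mxE => H; rewrite -[RHS]H; apply: eq_bigr => i _; rewrite mxE /=.
  by rewrite valK enum_rankK.
have uv : \sum_i ev z (v 0 i) * u i = 0.
  suff: (\sum_i ev z (v 0 i) * u i) * (b * ev z Q) = 0.
    by move/eqP; rewrite mulf_eq0 mulf_eq0 (negPf b0) (negPf (transc_ev tz Q0)) !orbF => /eqP.
  rewrite mulr_suml; transitivity (\sum_i \sum_t ev z (v 0 i * P i t) * s t).
    apply: eq_bigr => i _; rewrite -mulrA [u i * _]mulrA [_ * ev z Q]mulrC eP mulr_sumr.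
    by apply: eq_bigr => t _; rewrite (evM z (v 0 i)) mulrA.
  rewrite exchange_big big1 //= => t _; rewrite -mulr_suml -ev_sum.
  by rewrite vP ev0 mul0r.
pose D := (\max_i size (v 0%R i))%N.
have := iu D (fun j => \row_i (v 0 i)`_j) _.
move=> H; move/eqP: v0; apply; apply/rowP => i; rewrite mxE; apply/polyP => j.
rewrite coef0; have [jD|Dj] := ltnP j D; last first.
  by rewrite nth_default //; apply: leq_trans Dj; exact: (leq_bigmax i).
suff /H/(_ _ jD)/rowP/(_ i) : \sum_(j < D) z ^+ j * lcomb (\row_i (v 0 i)`_j) u = 0 by rewrite !mxE.
rewrite -[RHS]uv; transitivity (\sum_(j' < D) \sum_i' (cst (v 0 i')`_j' * z ^+ j') * u i').
  apply: eq_bigr => j' _; rewrite /lcomb mulr_sumr; apply: eq_bigr => i' _.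
  by rewrite mxE mulrCA mulrA.
rewrite exchange_big /=; apply: eq_bigr => i' _; rewrite -mulr_suml -ev_coef //.
exact: (leq_bigmax i').
Qed.

(** With K the fraction field of the algebra generated by [a], a common denominator moves a finite
    family into that algebra, which lies in a span of fixed size. *)
Lemma zindep_bounded z (a : seq K) : transc z ->
  (forall y, y \in a -> alg_over z y) ->
  (forall f, exists g h, [/\ gen_alg a g, gen_alg a h, h != 0 & f = g / h]) ->
  exists N, forall m (u : 'I_m -> K), zindep z u -> (m <= N)%N.
Proof.
move=> tz ha ga; have [T [s [s1 sa]]] := alg_finite tz ha.
have ga_stable f w : gen_alg a f -> spanZ z s w -> spanZ z s (f * w).
  move=> gf; elim: gf w => [c|y ya|f1 f2 _ IH1 _ IH2|f1 f2 _ IH1 _ IH2] w Sw.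
  - by rewrite -(evC z); exact: spanZZ.
  - exact: sa.
  - by rewrite mulrDl; apply: spanZD; [exact: IH1|exact: IH2].
  - by rewrite -mulrA; apply: IH1; exact: IH2.
exists #|T| => m u iu.
have /choice[g /choice[h ghP]] : forall i, exists g h, [/\ gen_alg a g, gen_alg a h, h != 0 & u i = g / h].
  by move=> i; exact: ga.
have gprod (r : seq 'I_m) P : gen_alg a (\prod_(l <- r | P l) h l).
  elim/big_ind: _ => [|x y|l _]; [by rewrite -(rmorph1 cst); exact: gen_cst|exact: gen_mul|by case: (ghP l)].
apply: (@zindep_spanZ z m u T s (\prod_l h l)) => //.
  by apply/prodf_neq0 => l _; case: (ghP l).
move=> i; have [gg gh h0 ->] := ghP i.
rewrite (bigD1 i) //= mulrA divfK // -[_ * _]mulr1; apply: ga_stable => //.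
exact: gen_mul.
Qed.

End PolynomialIndependence.

(** * Independent discrete valuations and approximation *)

(** Zero is added by hand: the value of v at 0 is a mere convention, not +oo. *)
Definition vge (K : fieldType) (P : Type) (v : P -> K -> int) (x : P) (m : int) : set K :=
  [set f | f = 0 \/ m <= v x f].

Record valuations (k K : fieldType) (cst : {rmorphism k -> K}) (P : eqType)
    (v : P -> K -> int) : Prop := Valuations {
  valM : forall x f g, f != 0 -> g != 0 -> v x (f * g) = v x f + v x g;
  valD : forall x m f g, vge v x m f -> vge v x m g -> vge v x m (f + g);
  val_cst : forall x c, v x (cst c) = 0;
  val_unif : forall x, exists2 w, w != 0 & v x w = 1;
  val_sep : forall x y, x != y -> exists a, [/\ a != 0, 0 <= v x a & v y a < 0] }.

Section Valuations.
Variables (k K : fieldType) (cst : {rmorphism k -> K}) (P : eqType) (v : P -> K -> int).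
Hypothesis vP : valuations cst v.
Local Notation V := (vge v).
Local Notation lcomb := (lcomb cst).
Local Notation zindep := (zindep cst).
Local Notation transc := (transc cst).
Implicit Types (x y : P) (f g : K) (m n : int) (s : seq P).

Lemma val1 x : v x 1 = 0. Proof. by rewrite -(rmorph1 cst) (val_cst vP). Qed.

Lemma valN1 x : v x (- 1) = 0.
Proof. by rewrite -(rmorphN1 cst) (val_cst vP). Qed.

Lemma valN x f : f != 0 -> v x (- f) = v x f.
Proof. by move=> f0; rewrite -mulN1r (valM vP) ?oppr_eq0 ?oner_neq0 // valN1 add0r. Qed.

Lemma valV x f : f != 0 -> v x f^-1 = - v x f.
Proof.
move=> f0; apply/eqP; rewrite -addr_eq0 -(valM vP) ?invr_eq0 // mulVf //.
by rewrite val1.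
Qed.

Lemma valX x f (r : nat) : f != 0 -> v x (f ^+ r) = v x f *+ r.
Proof.
move=> f0; elim: r => [|r IH]; first by rewrite expr0 val1.
by rewrite exprS (valM vP) ?expf_neq0 // IH mulrS.
Qed.

Lemma valXz x f (r : nat) : f != 0 -> v x (f ^+ r) = v x f * r%:Z.
Proof. by move=> f0; rewrite valX // -mulr_natr natz. Qed.

Lemma vge0 x m : V x m 0. Proof. by left. Qed.

Lemma vgeN x m f : V x m f -> V x m (- f).
Proof.
case=> [->|h]; first by rewrite oppr0; left.
by have [->|f0] := eqVneq f 0; [rewrite oppr0; left|right; rewrite valN].
Qed.

Lemma vgeB x m f g : V x m f -> V x m g -> V x m (f - g).
Proof. by move=> Vf Vg; apply: (valD vP) => //; exact: vgeN. Qed.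

Lemma vgeM x m n f g : V x m f -> V x n g -> V x (m + n) (f * g).
Proof.
have [->|f0] := eqVneq f 0; first by rewrite mul0r; left.
have [->|g0] := eqVneq g 0; first by rewrite mulr0; left.
case=> [/eqP|hf]; first by rewrite (negPf f0).
case=> [/eqP|hg]; first by rewrite (negPf g0).
by right; rewrite (valM vP) // lerD.
Qed.

Lemma vge_le x m n f : m <= n -> V x n f -> V x m f.
Proof. by move=> mn [->|h]; [left|right; exact: le_trans h]. Qed.

Lemma vge_val x f : V x (v x f) f. Proof. by right. Qed.

Lemma vge_nz x m f : f != 0 -> V x m f -> m <= v x f.
Proof. by move=> f0 [/eqP|//]; rewrite (negPf f0). Qed.

Lemma vge_cst x c : V x 0 (cst c). Proof. by right; rewrite (val_cst vP). Qed.

Lemma vge_cstM x m c f : V x m f -> V x m (cst c * f).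
Proof. by rewrite -{2}(add0r m) => Vf; apply: vgeM => //; exact: vge_cst. Qed.

Lemma vge0X x f (r : nat) : V x 0 f -> V x 0 (f ^+ r).
Proof.
move=> Vf; elim: r => [|r IH]; first by right; rewrite val1.
by rewrite exprS -(add0r 0); exact: vgeM.
Qed.

Lemma vgeX_cancel x m f g : f != 0 -> V x (v x f + m) (f * g) -> V x m g.
Proof.
move=> f0; have [->|g0] := eqVneq g 0; first by left.
by move=> /vge_nz; rewrite mulf_neq0 // (valM vP) // lerD2l => /(_ isT); right.
Qed.

Lemma vge_lin x m : lin_subset cst (V x m).
Proof. by split=> [|c f g Vf Vg]; [left|apply: (valD vP) => //; exact: vge_cstM]. Qed.

Lemma val_addl x f g : f != 0 -> g != 0 -> v x f < v x g ->
  f + g != 0 /\ v x (f + g) = v x f.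
Proof.
move=> f0 g0 lt.
have fg0 : f + g != 0.
  by apply/eqP => /eqP; rewrite addr_eq0 => /eqP e; move: lt; rewrite e valN // ltxx.
split=> //; apply/eqP; rewrite eq_le; apply/andP; split; last first.
  by apply: vge_nz => //; apply: (valD vP); [exact: vge_val|right; exact: ltW].
rewrite leNgt; apply/negP => lt'.
have : V x (Order.min (v x (f + g)) (v x g)) f.
  rewrite -[X in V _ _ X](addrK g); apply: vgeB; right; rewrite ge_min lexx ?orbT //.
by move=> /(vge_nz f0); rewrite leNgt lt_min lt' lt.
Qed.

Definition reg (s : seq P) (n : P -> int) : set K := [set f | forall x, x \in s -> V x (n x) f].

Lemma reg_lin s (n : P -> int) : lin_subset cst (reg s n).
Proof.
split=> [x _|c f g Vf Vg x xs]; first exact: vge0.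
by apply: (vge_lin x _).2; [exact: Vf|exact: Vg].
Qed.

Lemma val_sep2 x y : x != y -> exists z, [/\ z != 0, 0 < v x z & v y z < 0].
Proof.
move=> xy; have [a [a0 xa ya]] := val_sep vP xy.
have yx : y != x by rewrite eq_sym.
have [b [b0 yb xb]] := val_sep vP yx.
exists (a / b); rewrite mulf_neq0 ?invr_eq0 // !(valM vP) ?invr_eq0 // !valV //.
by split=> //; lia.
Qed.

Lemma val_sep_seq x s : x \notin s ->
  exists h, [/\ h != 0, 0 < v x h & forall y, y \in s -> v y h < 0].
Proof.
elim: s => [_|y s IH]; first by have [w w0 w1] := val_unif vP x; exists w; rewrite w1.
rewrite inE negb_or => /andP[xy /IH[h [h0 xh sh]]].
have [yh|yh] := ltP (v y h) 0.
  by exists h; split=> // t; rewrite inE => /orP[/eqP->|/sh].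
have [z [z0 xz yz]] := val_sep2 xy.
(* As r exceeds every |v_t(h)|, the term z^r dominates h wherever z has a pole, and h dominates at
   the other points of s. In no case do the two terms cancel. *)
pose r := (1 + \sum_(t <- s) `|v t h|)%N.
have rP t : t \in s -> - (r%:Z) < v t h.
  move=> ts; have : (`|v t h| <= \sum_(t <- s) `|v t h|)%N by rewrite (big_rem t) //= leq_addr.
  by rewrite /r; lia.
have r0 : (0 < r)%N by [].
move: r rP r0 => r rP r0.
have zr0 : z ^+ r != 0 by rewrite expf_neq0.
have [hz0 vy] : z ^+ r + h != 0 /\ v y (z ^+ r + h) = v y (z ^+ r).
  by apply: val_addl => //; rewrite valXz //; nia.
exists (z ^+ r + h); split=> //.
  have : V x 1 (z ^+ r + h) by apply: (valD vP); right; rewrite ?valXz //; nia.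
  by move=> /(vge_nz hz0).
move=> t; rewrite inE => /orP[/eqP->|ts]; first by rewrite vy valXz //; nia.
have ht := sh _ ts; have rt := rP _ ts; have [zt|zt] := ltP (v t z) 0.
  have [_ ->] : z ^+ r + h != 0 /\ v t (z ^+ r + h) = v t (z ^+ r).
    by apply: val_addl => //; rewrite valXz //; nia.
  by rewrite valXz //; nia.
have [_] : h + z ^+ r != 0 /\ v t (h + z ^+ r) = v t h.
  by apply: val_addl => //; rewrite valXz //; nia.
by rewrite addrC => ->.
Qed.

(** Take a = 1 / (1 + h^(N+1)) with h vanishing at x and having poles on s: the power is negligible
    at x, so that a is close to 1, and large on s, so that a is close to 0. *)
Lemma approximation x s (N : nat) : x \notin s ->
  exists a, V x N%:Z (a - 1) /\ forall y, y \in s -> V y N%:Z a.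
Proof.
move=> /val_sep_seq[h [h0 xh sh]]; pose d := h ^+ N.+1.
have d0 : d != 0 by rewrite expf_neq0.
have [d1 xd1] : 1 + d != 0 /\ v x (1 + d) = v x 1.
  by apply: val_addl => //; rewrite ?oner_neq0 // val1 valXz //; nia.
exists (1 + d)^-1; split.
  have -> : (1 + d)^-1 - 1 = - (d / (1 + d)).
    by apply: (mulIf d1); rewrite mulrBl mulVf // mulNr divfK //; ring.
  by apply: vgeN; right; rewrite (valM vP) ?invr_eq0 // valV // xd1 val1 valXz //; nia.
move=> y /sh yh; right; rewrite valV //.
have [_] : d + 1 != 0 /\ v y (d + 1) = v y d.
  by apply: val_addl; rewrite ?oner_neq0 // val1 valXz //; nia.
by rewrite addrC => ->; rewrite valXz //; nia.
Qed.

(* The constant terms of a relation over k[z] vanish modulo [z], after which the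
   relation can be divided by [z]. *)
Lemma reg_zindep z s (m : nat) (u : 'I_m -> K) :
  (forall x, x \in s -> 0 < v x z) -> z != 0 ->
  (forall i, reg s (fun=> 0) (u i)) -> indep_mod cst (reg s (v^~ z)) u ->
  zindep z u.
Proof.
move=> sz z0 Vu iu D; elim: D => [//|D IH] c.
rewrite big_ord_recl expr0 mul1r => c0.
have zr : lcomb (c 0%N) u = - (z * \sum_(j < D) z ^+ j * lcomb (c j.+1) u).
  move/eqP: c0; rewrite addr_eq0 => /eqP ->; congr (- _); rewrite mulr_sumr.
  by apply: eq_bigr => j _; rewrite mulrA -exprS.
have rS : reg s (fun=> 0) (\sum_(j < D) z ^+ j * lcomb (c j.+1) u).
  apply: lin_subset_sum; first exact: reg_lin.
  move=> j x xs; rewrite -[X in V _ X _](add0r 0); apply: vgeM.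
    by apply: vge0X; right; rewrite ltW // sz.
  by apply: (lin_subset_lcomb _ (reg_lin s (fun=> 0))) => //.
have c00 : c 0%N = 0.
  apply: iu => x xs; rewrite zr; apply: vgeN; rewrite -[X in V _ X _]addr0.
  by apply: vgeM; [exact: vge_val|exact: rS].
move: zr; rewrite c00 lcomb0 => /eqP; rewrite eq_sym oppr_eq0 mulf_eq0 (negPf z0) /=.
move=> /eqP /(IH (fun j => c j.+1)) {}IH [//|j]; exact: IH.
Qed.

(** Up to inversion f vanishes at x. A non-zero constant has valuation 0, so 1 is independent modulo
    elements of valuation at least v_x(f), and [reg_zindep] applies. *)
Lemma val_transc x f : v x f != 0 -> transc f.
Proof.
have [->|f0] := eqVneq f 0; first by rewrite -(rmorph0 cst) (val_cst vP) eqxx.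
wlog xf : f f0 / 0 < v x f.
  move=> W; rewrite neq_lt => /orP[xf|/[dup] xf /W]; last by apply; rewrite ?gt_eqF.
  rewrite -[f]invrK; apply: transcV; rewrite ?invr_eq0 //.
  by apply: W; rewrite ?invr_eq0 // valV ?oppr_eq0 ?oppr_gt0 // lt_eqF.
move=> _; apply: (@reg_zindep _ [:: x]) => //.
- by move=> y; rewrite inE => /eqP->.
- by move=> i y _; right; rewrite val1.
- move=> c /(_ x (mem_head _ _)); rewrite /lcomb big_ord1 mulr1 => Vc.
  apply/rowP => j; rewrite ord1 mxE; apply/eqP; rewrite -(fmorph_eq0 cst).
  apply/negP => /negP c0; have := vge_nz c0 Vc.
  by rewrite (val_cst vP) leNgt xf.
Qed.

Definition residue_basis x r (e : 'I_r -> K) := (forall i, V x 0 (e i)) /\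
  forall f, V x 0 f -> exists! c : 'rV[k]_r, V x 1 (f - lcomb c e).

Section ResidueDegree.
Variable dg : P -> nat.
Hypothesis dgP : forall x, exists e : 'I_(dg x) -> K, residue_basis x e.

Lemma residue_degree_gt0 x : (0 < dg x)%N.
Proof.
rewrite lt0n; apply/eqP => d0; have [e [_ eP]] := dgP x.
have V1 : V x 0 1 by right; rewrite val1.
have [c [c1 _]] := eP 1 V1.
move: c1; have -> : lcomb c e = 0.
  by rewrite /lcomb big1 // => i; have := leq_trans (ltn_ord i) (eq_leq d0).
by rewrite subr0 => /(vge_nz (oner_neq0 _)); rewrite val1.
Qed.

Lemma residue_basis_indep x r (e : 'I_r -> K) : residue_basis x e -> indep_mod cst (V x 1) e.
Proof.
move=> [Ve eP] c Vc; have [d [d1 du]] := eP 0 (vge0 x 0).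
rewrite -[c]opprK -(du (- c)); last first.
  by rewrite sub0r -[- c]addr0 -scaleN1r lcombP lcomb0 addr0 rmorphN1 mulN1r opprK.
by rewrite (du 0) ?oppr0 // lcomb0 subr0; left.
Qed.

(** The family consists of the w^j e_i with j < n, where w is a uniformizer and e lifts a basis of
    the residue field. *)
Lemma local_family x (n : nat) : exists u : 'I_(n * dg x) -> K,
  (forall i, V x 0 (u i)) /\ indep_mod cst (V x n%:Z) u.
Proof.
have [e eb] := dgP x; have [w w0 w1] := val_unif vP x.
have ie := residue_basis_indep eb; have Ve := eb.1.
elim: n => [|n [u [Vu iu]]].
  by rewrite mul0n; exists (fun=> 0); split=> [[]//|c _]; apply/rowP => -[].
rewrite mulSn; exists (glue e (fun i => w * u i)); split.
  apply: glue_in => // i; apply: vge_le (vgeM (vge_val x w) (Vu i)).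
  by rewrite w1.
move=> c; rewrite lcomb_glue lcomb_mull => Vc.
have Vr : V x 0 (lcomb (rsubmx c) u) by apply: lin_subset_lcomb => //; exact: vge_lin.
have cl : lsubmx c = 0.
  apply: ie; rewrite -[lcomb _ _](addrK (w * lcomb (rsubmx c) u)); apply: vgeB.
    by apply: vge_le Vc; lia.
  by rewrite -[X in V _ X _]addr0 -w1; apply: vgeM => //; exact: vge_val.
rewrite -[c]hsubmxK cl (_ : rsubmx c = 0) ?row_mx0 //; apply: iu.
apply: (@vgeX_cancel _ _ w) => //; rewrite w1; move: Vc; rewrite cl lcomb0 add0r.
by apply: vge_le; lia.
Qed.

Lemma vge_bound x (m : nat) (u : 'I_m -> K) : exists N : nat, forall i, V x (- N%:Z) (u i).
Proof.
exists (\sum_i `|v x (u i)|)%N => i; right.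
have : (`|v x (u i)| <= \sum_i `|v x (u i)|)%N by rewrite (bigD1 i) //= leq_addr.
by lia.
Qed.

Lemma global_family s (n : P -> nat) : uniq s ->
  exists u : 'I_(\sum_(x <- s) n x * dg x) -> K,
  (forall i, reg s (fun=> 0) (u i)) /\ indep_mod cst (reg s (fun x => (n x)%:Z)) u.
Proof.
elim: s => [_|x s IH /andP[xs /IH[u [Vu iu]]]].
  by rewrite big_nil; exists (fun=> 0); split=> [[]//|c _]; apply/rowP => -[].
rewrite big_cons; have [e [Ve ie]] := local_family x (n x).
have [N1 VN1] := vge_bound x u.
have [N2 VN2] : exists N : nat, forall y i, y \in s -> V y (- N%:Z) (e i).
  elim: (s) => [|y s' [N HN]]; first by exists 0%N.
  have [N' HN'] := vge_bound y e; exists (N + N')%N => y' i; rewrite inE => /orP[/eqP->|ys].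
    by apply: vge_le (HN' i); lia.
  by apply: vge_le (HN _ i ys); lia.
(* This precision outweighs the poles of u at x, those of e on s, and all the required orders. Hence
   a e + (1 - a) u behaves like the first family at x and like the second on s. *)
pose N := (N1 + N2 + n x + \sum_(y <- s) n y)%N.
have nN y : y \in s -> (n y <= \sum_(y <- s) n y)%N.
  by move=> ys; rewrite (big_rem y) //= leq_addr.
have [a [xa sa]] := approximation N xs.
have Va : V x 0 a.
  rewrite -[a](subrK 1); apply: (valD vP); last by right; rewrite val1.
  by apply: vge_le xa.
have Vb y : y \in s -> V y 0 (1 - a).
  move=> ys; apply: vgeB; first by right; rewrite val1.
  by apply: vge_le (sa _ ys).
have xa' : V x N%:Z (1 - a) by rewrite -opprB; exact: vgeN.
exists (glue (fun i => a * e i) (fun i => (1 - a) * u i)); split.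
  apply: glue_in => i y; rewrite inE => /orP[/eqP->|ys].
  - by rewrite -[0]addr0; apply: vgeM.
  - by apply: vge_le (vgeM (sa _ ys) (VN2 y i ys)); rewrite /N; lia.
  - by apply: vge_le (vgeM xa' (VN1 i)); rewrite /N; lia.
  - by rewrite -[0]addr0; apply: vgeM; [exact: Vb|exact: Vu].
move=> c; rewrite lcomb_glue !lcomb_mull => Vc.
set A := lcomb (lsubmx c) e in Vc *; set B := lcomb (rsubmx c) u in Vc *.
have VA : V x 0 A by apply: lin_subset_lcomb => //; exact: vge_lin.
have VB : V x (- N1%:Z) B by apply: lin_subset_lcomb => //; exact: vge_lin.
have cl : lsubmx c = 0.
  apply: ie; rewrite -/A.
  have -> : A = (a * A + (1 - a) * B) - (a - 1) * A - (1 - a) * B by ring.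
  apply: vgeB; first apply: vgeB.
  - by apply: Vc; exact: mem_head.
  - by apply: vge_le (vgeM xa VA); rewrite /N; lia.
  - by apply: vge_le (vgeM xa' VB); rewrite /N; lia.
rewrite -[c]hsubmxK cl (_ : rsubmx c = 0) ?row_mx0 //; apply: iu => y ys; rewrite -/B.
have -> : B = (a * A + (1 - a) * B) + a * B by rewrite /A cl lcomb0; ring.
apply: (valD vP); first by apply: Vc; rewrite inE ys orbT.
have VBy : V y 0 B.
  by apply: lin_subset_lcomb => [|i]; [exact: vge_lin|exact: Vu].
by apply: vge_le (vgeM (sa _ ys) VBy); have := nN _ ys; rewrite /N; lia.
Qed.

(** The residues of regular functions modulo z at the points of s fill a space of dimension at least
    this sum, and families independent modulo z are independent over k[z]. *)
Lemma zeros_bound z s (n : nat) : z != 0 -> uniq s -> (forall x, x \in s -> 0 < v x z) ->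
  (forall (m : nat) (u : 'I_m -> K), zindep z u -> (m <= n)%N) ->
  (\sum_(x <- s) `|v x z| * dg x <= n)%N.
Proof.
move=> z0 us sz; have [u [Vu iu]] := global_family (fun x => `|v x z|%N) us.
apply; apply: (@reg_zindep _ s) => // c Vc; apply: iu => x xs /=.
by have := Vc x xs; rewrite -{1}(gtz0_abs (sz _ xs)).
Qed.

End ResidueDegree.
End Valuations.

(** * Degree zero and the Riemann inequality *)

Record complete_valuations (k K : fieldType) (cst : {rmorphism k -> K}) (P : eqType)
    (v : P -> K -> int) : Prop := CompleteValuations {
  cval : valuations cst v;
  cval_pole : forall f, transc cst f -> exists x, v x f < 0;
  cval_finite : forall z, transc cst z ->
    exists N, forall m (u : 'I_m -> K), zindep cst z u -> (m <= N)%N }.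

Lemma Posz_sum (I : Type) (r : seq I) (F : I -> nat) :
  (\sum_(i <- r) F i)%N%:Z = \sum_(i <- r) (F i)%:Z.
Proof. exact: (big_morph Posz PoszD (erefl _)). Qed.

Section Curve.
Variables (k K : fieldType) (cst : {rmorphism k -> K}) (P : eqType) (v : P -> K -> int).
Hypothesis vP : complete_valuations cst v.
Variable dg : P -> nat.
Hypothesis dgP : forall x, exists e : 'I_(dg x) -> K, residue_basis cst v x e.
Local Notation V := (vge v).
Local Notation lcomb := (lcomb cst).
Local Notation zindep := (zindep cst).
Local Notation transc := (transc cst).
Local Notation dim_ge := (dim_ge cst).
Implicit Types (x y : P) (f g z : K) (s : seq P) (E : P -> int).
Let vP0 := cval vP.

Definition sections E : set K := [set f | forall x, V x (- E x) f].
Local Notation L := sections.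

Lemma sections_lin E : lin_subset cst (L E).
Proof.
split=> [x|c f g Lf Lg x]; first exact: vge0.
by apply: (vge_lin vP0 _ _).2; [exact: Lf|exact: Lg].
Qed.

Lemma val_surj x (n : int) : exists2 w, w != 0 & v x w = n.
Proof.
have [w w0 w1] := val_unif vP0 x; case: n => n.
  by exists (w ^+ n); rewrite ?expf_neq0 // (valX vP0) // w1 natz.
exists (w ^+ n.+1)^-1; first by rewrite invr_eq0 expf_neq0.
by rewrite (valV vP0) ?expf_neq0 // (valX vP0) // w1 natz NegzE.
Qed.

Lemma residue_coords x : exists phi : K -> 'rV[k]_(dg x),
  (forall f, V x 0 f -> phi f = 0 -> V x 1 f) /\
  forall c f g, V x 0 f -> V x 0 g -> phi (cst c * f + g) = c *: phi f + phi g.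
Proof.
have [e [Ve eP]] := dgP x.
have /choice[phi phiP] : forall f, exists c : 'rV[k]_(dg x), V x 0 f ->
    V x 1 (f - lcomb c e) /\ forall d, V x 1 (f - lcomb d e) -> d = c.
  move=> f; have [/eP[c [c1 c2]]|nV] := pselect (V x 0 f); last by exists 0.
  by exists c => _; split=> // d /c2.
exists phi; split=> [f /phiP[h _] f0|c f g Vf Vg]; first by rewrite f0 lcomb0 subr0 in h.
have [h1 _] := phiP _ Vf; have [h2 _] := phiP _ Vg.
apply/esym/(phiP _ _).2; first by apply: (vge_lin vP0 _ _).2.
rewrite lcombP; have -> : cst c * f + g - (cst c * lcomb (phi f) e + lcomb (phi g) e) =
  cst c * (f - lcomb (phi f) e) + (g - lcomb (phi g) e) by ring.
exact: (vge_lin vP0 _ _).2.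
Qed.

(** With v_x(w) = E x, the new condition at x is that the residue of w f vanishes, which amounts to
    [dg x] linear equations. *)
Lemma dim_ge_drop x E m : dim_ge (L E) m ->
  dim_ge (L (fun y => E y - (y == x)%:Z)) (m - dg x).
Proof.
have [w w0 wE] := val_surj x (E x); have [phi [phi0 philin]] := residue_coords x.
have Vw f : L E f -> V x 0 (w * f).
  by move=> Lf; rewrite -(addrN (E x)) -{1}wE; apply: (vgeM vP0) => //; exact: vge_val.
move=> /(dim_ge_ker (phi := fun f => phi (w * f)) (sections_lin E)) H.
apply: dim_ge_sub (H _) => [f [Lf f0] y|c f g Lf Lg].
  have [->|yx] := eqVneq y x; last by rewrite subr0; exact: Lf.
  apply: (@vgeX_cancel _ _ _ _ _ vP0 _ _ w) => //.
  by rewrite wE opprB addrCA subrr addr0; apply: phi0 => //; exact: Vw.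
by rewrite mulrDr mulrCA philin //; exact: Vw.
Qed.

Lemma eq_sections E E' : E =1 E' -> L E = L E'.
Proof. by move=> /funext->. Qed.

Lemma dim_ge_sub_at x E (n : nat) m : dim_ge (L E) m ->
  dim_ge (L (fun y => E y - ((y == x)%:Z * n%:Z))) (m - n * dg x).
Proof.
elim: n => [|n IH] h.
  by rewrite mul0n subn0 (@eq_sections _ E) // => y; rewrite mulr0 subr0.
have := dim_ge_drop x (IH h); rewrite mulSnr subnDA.
by rewrite (@eq_sections _ (fun y => E y - (y == x)%:Z * n.+1%:Z)) // => y; lia.
Qed.

Lemma dim_ge_diff s E E' m : uniq s -> (forall x, x \in s -> E' x <= E x) ->
  (forall x, x \notin s -> E x = E' x) -> dim_ge (L E) m ->
  dim_ge (L E') (m - \sum_(x <- s) `|E x - E' x| * dg x).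
Proof.
elim: s E m => [|x s IH] E m.
  by move=> _ _ EE' h; rewrite big_nil subn0 -(@eq_sections E) // => x; exact: EE'.
move=> /andP[xs us] le eq h.
have := dim_ge_sub_at x `|E x - E' x|%N h; rewrite big_cons subnDA.
set F := (fun y : P => _) => hF.
have -> : (\sum_(y <- s) `|E y - E' y| * dg y = \sum_(y <- s) `|F y - E' y| * dg y)%N.
  apply: eq_big_seq => y ys; rewrite /F; case: eqP => [yx|_]; last by rewrite mul0r subr0.
  by rewrite -yx ys in xs.
apply: IH => // y ys; rewrite /F.
  case: eqP => [yx|_]; first by rewrite -yx ys in xs.
  by rewrite mul0r subr0; apply: le; rewrite inE ys orbT.
have := le x (mem_head _ _); have := eq y; rewrite inE (negPf ys) orbF.
by case: eqP => [->|] /=; lia.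
Qed.

Lemma sections0_const f x : L (fun=> 0) f -> f != 0 -> v x f = 0.
Proof.
move=> Lf f0; apply/eqP; apply: contraT => /(val_transc vP0) /(cval_pole vP)[y].
by have := vge_nz f0 (Lf y); rewrite oppr0 leNgt => /negPf->.
Qed.

(** A non-zero section of the divisor -x would be without poles, hence of valuation 0 everywhere,
    although it vanishes at x. So L(-x) = 0, and passing to it costs at most [dg x] dimensions. *)
Lemma dim_sections0 x m : dim_ge (L (fun=> 0)) m -> (m <= dg x)%N.
Proof.
move=> /(dim_ge_drop x); set W := L _ => dW.
suff W0 : W `<=` [set 0] by have /eqP := dim_ge0 (dim_ge_sub W0 dW); rewrite subn_eq0.
move=> f Wf; apply/eqP; apply: contraT => f0.
have Lf : L (fun=> 0) f.
  by move=> y; apply: vge_le (Wf y); rewrite oppr0 sub0r opprK; case: eqP.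
have := vge_nz f0 (Wf x); rewrite sub0r opprK eqxx (sections0_const x Lf f0).
by rewrite lexx0 || done.
Qed.

Lemma finite_list (Q : P -> Prop) n :
  (forall s, uniq s -> (forall x, x \in s -> Q x) -> (size s <= n)%N) ->
  exists s, uniq s /\ forall x, x \in s <-> Q x.
Proof.
move=> bd; pose R m := `[< exists s, [/\ uniq s, forall x, x \in s -> Q x & size s = m] >].
have exR : exists m, R m by exists 0%N; apply/asboolP; exists [::].
have ubR m : R m -> (m <= n)%N by move=> /asboolP[s [us Qs <-]]; exact: bd.
case: (ex_maxnP exR ubR) => m /asboolP[s [us Qs sm]] maxm.
exists s; split=> // x; split=> [/Qs//|Qx]; apply: contrapT => /negP xs.
suff : (size (x :: s) <= m)%N by rewrite /= sm ltnn.
apply: maxm; apply/asboolP; exists (x :: s); split=> //=; first by rewrite xs.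
by move=> y; rewrite inE => /orP[/eqP->|/Qs].
Qed.

Lemma zeros_list z : transc z -> exists s, uniq s /\ forall x, x \in s <-> 0 < v x z.
Proof.
move=> tz; have [n nP] := cval_finite vP tz.
apply: (@finite_list _ n) => s us sz.
apply: leq_trans (zeros_bound vP0 dgP (transc_neq0 tz) us sz nP).
rewrite -sum1_size big_seq [X in (_ <= X)%N]big_seq; apply: leq_sum => x xs.
by have := sz x xs; have := residue_degree_gt0 vP0 dgP x; nia.
Qed.

Lemma poles_list z : transc z -> exists s, uniq s /\ forall x, x \in s <-> v x z < 0.
Proof.
move=> tz; have z0 := transc_neq0 tz.
have [s [us sP]] := zeros_list (transcV z0 tz); exists s; split=> // x.
by apply: iff_trans (sP x) _; rewrite (valV vP0) // oppr_gt0.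
Qed.

Lemma val_support f : f != 0 -> exists s, uniq s /\ forall x, x \in s <-> v x f != 0.
Proof.
move=> f0; have [tf|ntf] := pselect (transc f); last first.
  by exists [::]; split=> // x; split=> // /(val_transc vP0).
have [s [us sP]] := zeros_list tf; have [t [ut tP]] := poles_list tf.
exists (s ++ t); split.
  rewrite cat_uniq us ut andbT /=; apply/hasPn => x /tP xf.
  by apply/negP => /sP; rewrite ltNge ltW.
move=> x; rewrite mem_cat neq_lt; split.
  by case/orP => [/sP|/tP] ->; rewrite ?orbT.
by case/orP => [/tP|/sP] ->; rewrite ?orbT.
Qed.

Lemma powers_family z m (u : 'I_m -> K) l : zindep z u ->
  exists U : 'I_(l * m) -> K, indep_mod cst [set 0] U /\
    forall p, exists j i, (j < l)%N /\ U p = z ^+ j * u i.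
Proof.
move=> iu; pose M : 'M[K]_(l, m) := \matrix_(j, i) (z ^+ j * u i).
exists (fun p => mxvec M 0 p); split; last first.
  by case/mxvec_indexP => j i; exists (nat_of_ord j), i; split=> //; rewrite mxvecE mxE.
move=> c c0; rewrite -[c]vec_mxK (_ : vec_mx c = 0) ?linear0 //.
pose d j : 'rV[k]_m := if insub j is Some j' then row j' (vec_mx c) else 0.
suff /(iu l d) dP : \sum_(j < l) z ^+ j * lcomb (d j) u = 0.
  by apply/row_matrixP => j; have := dP _ (ltn_ord j); rewrite /d valK row0.
rewrite -[RHS]c0 /lcomb (reindex _ (curry_mxvec_bij l m)) /=.
transitivity (\sum_(p : 'I_l * 'I_m) cst (vec_mx c p.1 p.2) * (z ^+ p.1 * u p.2)).
  2: by apply: eq_bigr => -[i j] _; rewrite /= mxvecE !mxE.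
rewrite -(pair_bigA _ (fun i j => cst (vec_mx c i j) * (z ^+ i * u j))) /=.
apply: eq_bigr => j _; rewrite /d valK mulr_sumr; apply: eq_bigr => i _.
by rewrite mxE mulrCA.
Qed.

Definition polar z x : int := Num.max 0 (- v x z).

Lemma vge_polar z x : V x (- polar z x) z.
Proof. by right; rewrite /polar; lia. Qed.

(* The sections [z ^+ j * u i] show that multiples of the polar divisor of [z]
   have many sections. *)
Lemma polar_sections z m (u : 'I_m -> K) : transc z -> zindep z u ->
  exists c : nat, forall l,
    dim_ge (L (fun x => polar z x * l%:Z)) (l.+1 * m - c).
Proof.
move=> tz iu.
have u0 i : u i != 0.
  apply/eqP => ui0; have := iu 1%N (fun=> delta_mx 0 i).
  rewrite big_ord1 expr0 mul1r => /(_ _ 0%N isT) H.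
  have /rowP/(_ i) : delta_mx 0 i = 0 :> 'rV[k]_m.
    apply: H; rewrite /lcomb big1 // => j _; rewrite mxE eqxx /=.
    by case: eqP => [->|_]; rewrite ?ui0 ?mulr0 // rmorph0 mul0r.
  by rewrite !mxE !eqxx => /eqP; rewrite oner_eq0.
(* C bounds the poles of all the u i at once. Removing it again costs its degree, which does not
   depend on l. *)
pose C x := \sum_i (polar (u i) x).
have polar0 f x : 0 <= polar f x by rewrite /polar; lia.
have CP x i : polar (u i) x <= C x.
  by rewrite /C (bigD1 i) //= lerDl sumr_ge0.
have C0 x : 0 <= C x by rewrite /C sumr_ge0.
have [s [us sC]] : exists s, uniq s /\ forall x, C x != 0 -> x \in s.
  have /choice[t tP] : forall i, exists s, forall x, x \in s <-> v x (u i) != 0.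
    by move=> i; have [s [_ sP]] := val_support (u0 i); exists s.
  exists (undup (flatten [seq t i | i <- enum 'I_m])); split; first exact: undup_uniq.
  move=> x; rewrite mem_undup; apply: contraR => xs; rewrite /C big1 // => i _.
  rewrite /polar (_ : v x (u i) = 0) ?oppr0 //; apply/eqP; apply: contraR xs => /tP xt.
  by apply/flattenP; exists (t i) => //; apply/mapP; exists i; rewrite ?mem_enum.
exists (\sum_(x <- s) `|C x| * dg x)%N => l.
have [U [iU UP]] := powers_family l.+1 iu.
have dU : dim_ge (L (fun x => polar z x * l%:Z + C x)) (l.+1 * m).
  exists U; split=> // p x; have [j [i [jl ->]]] := UP p.
  have Vz : V x (- (polar z x * j%:Z)) (z ^+ j).
    by right; rewrite (valXz vP0) ?(transc_neq0 tz) // /polar; nia.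
  apply: vge_le (vgeM vP0 Vz (vge_polar (u i) x)).
  by have := CP x i; have := polar0 z x; nia.
have := @dim_ge_diff s _ (fun x => polar z x * l%:Z) _ us _ _ dU.
rewrite (_ : (\sum_(x <- s) _)%N = (\sum_(x <- s) `|C x| * dg x)%N); last first.
  by apply: eq_bigr => x _; rewrite addrAC subrr add0r.
apply=> x xs; first by rewrite lerDl.
by have /contraR/(_ xs)/eqP-> := sC x; rewrite addr0.
Qed.

(** The instance l = c already contradicts a >= b + 1. *)
Lemma leq_linear_slope a b c : (forall l : nat, l.+1 * a <= l * b + c)%N -> (a <= b)%N.
Proof. by move=> H; have := H c; rewrite leqNgt => h; rewrite leqNgt; apply/negP => ab; nia. Qed.

(** Compare growth in l: l times the polar divisor has at least (l+1) m - c independent sections,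
    and at most l times its degree plus the bound on L(0). *)
Lemma polar_ge z s m (u : 'I_m -> K) : transc z -> zindep z u -> uniq s ->
  (forall x, x \in s <-> v x z < 0) -> (m <= \sum_(x <- s) `|v x z| * dg x)%N.
Proof.
move=> tz iu us sP; have [c cP] := polar_sections tz iu.
have [x0 _] := cval_pole vP tz.
apply: (@leq_linear_slope _ _ (c + dg x0)) => l.
have := @dim_ge_diff s _ (fun=> 0) _ us _ _ (cP l).
rewrite (_ : (\sum_(x <- s) _)%N = (l * \sum_(x <- s) `|v x z| * dg x)%N); last first.
  rewrite big_distrr /= big_seq [RHS]big_seq; apply: eq_bigr => x /sP xz.
  by rewrite subr0 /polar; nia.
move=> /(_ _ _)/(dim_sections0 x0) H.
suff : (l.+1 * m - c - l * \sum_(x <- s) `|v x z| * dg x <= dg x0)%N by rewrite !leq_subLR; lia.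
apply: H => x xs; first by rewrite /polar; nia.
by have : ~ v x z < 0 by [move=> /sP; apply/negP]; rewrite /polar; nia.
Qed.

(* [n] is the degree of the function field over k(z). *)
Lemma maximal_zindep z : transc z -> exists n (u : 'I_n -> K), zindep z u /\
  forall m (u' : 'I_m -> K), zindep z u' -> (m <= n)%N.
Proof.
move=> tz; have [N NP] := cval_finite vP tz.
pose R m := `[< exists u : 'I_m -> K, zindep z u >].
have exR : exists m, R m by exists 1%N; apply/asboolP; exists (fun=> 1).
have ubR m : R m -> (m <= N)%N by move=> /asboolP[u]; exact: NP.
case: (ex_maxnP exR ubR) => n /asboolP[u iu] maxn; exists n, u; split=> // m u' iu'.
by apply: maxn; apply/asboolP; exists u'.
Qed.

(** The reverse inequality is the bound on zeros for 1/z, whose zeros are the poles of z.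
    Independence over k[z] and over k[1/z] is the same, so the two degrees agree. *)
Lemma polar_deg z s : transc z -> uniq s -> (forall x, x \in s <-> v x z < 0) ->
  exists n (u : 'I_n -> K), zindep z u /\ n = (\sum_(x <- s) `|v x z| * dg x)%N.
Proof.
move=> tz us sP; have [n [u [iu max_n]]] := maximal_zindep tz; exists n, u; split=> //.
have z0 := transc_neq0 tz.
apply/eqP; rewrite eqn_leq (polar_ge tz iu us sP) /=.
have -> : (\sum_(x <- s) `|v x z| * dg x = \sum_(x <- s) `|v x z^-1| * dg x)%N.
  by apply: eq_bigr => x _; rewrite (valV vP0) // abszN.
apply: (zeros_bound vP0 dgP) => //; rewrite ?invr_eq0 //.
  by move=> x /sP; rewrite (valV vP0) // oppr_gt0.
move=> m u' /(zindep_inv (_ : z^-1 != 0)); rewrite invrK invr_eq0 => /(_ z0).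
exact: max_n.
Qed.

Lemma degree_eq0 f s : f != 0 -> uniq s -> (forall x, v x f != 0 -> x \in s) ->
  \sum_(x <- s) v x f * (dg x)%:Z = 0.
Proof.
move=> f0 us sP; have [tf|ntf] := pselect (transc f); last first.
  by apply: big1 => x _; case: eqVneq (val_transc vP0 (x := x) (f := f)) => [->|_ /(_ isT)//]; rewrite mul0r.
have tV := transcV f0 tf; have V0 : f^-1 != 0 by rewrite invr_eq0.
pose s1 := [seq x <- s | 0 < v x f]; pose s2 := [seq x <- s | v x f < 0].
have s1P x : x \in s1 <-> v x f^-1 < 0.
  rewrite (valV vP0) // oppr_lt0 mem_filter; split=> [/andP[]//|xf]; rewrite xf sP ?gt_eqF //.
have s2P x : x \in s2 <-> v x f < 0.
  rewrite mem_filter; split=> [/andP[]//|xf]; rewrite xf sP ?lt_eqF //.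
have us1 : uniq s1 by exact: filter_uniq.
have us2 : uniq s2 by exact: filter_uniq.
have [n1 [u1 [i1 e1]]] := polar_deg tV us1 s1P.
have [n2 [u2 [i2 e2]]] := polar_deg tf us2 s2P.
have n12 : n1 = n2.
  have i1' : zindep f u1 by have := zindep_inv V0 i1; rewrite invrK.
  apply/eqP; rewrite eqn_leq {1}e2 (polar_ge tf i1' us2 s2P) /=.
  by rewrite e1 (polar_ge tV (zindep_inv f0 i2) us1 s1P).
have -> : \sum_(x <- s) v x f * (dg x)%:Z = n1%:Z - n2%:Z; last by rewrite n12 subrr.
rewrite e1 e2 !Posz_sum !big_filter [X in X - _]big_mkcond [X in _ - X]big_mkcond -sumrB /=.
apply: eq_bigr => x _; rewrite (valV vP0) // abszN.
by case: (ltgtP (v x f) 0) => xf; rewrite ?xf ?mul0r ?subr0 ?sub0r //; lia.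
Qed.

Lemma sum_support (A : zmodType) (F : P -> A) s t : uniq s -> uniq t ->
  (forall x, F x != 0 -> x \in s) -> (forall x, F x != 0 -> x \in t) ->
  \sum_(x <- s) F x = \sum_(x <- t) F x.
Proof.
move=> us ut Fs Ft.
have H r : \sum_(x <- r) F x = \sum_(x <- [seq x <- r | F x != 0]) F x.
  by rewrite big_filter [RHS]big_mkcond /=; apply: eq_bigr => x _; case: eqP.
rewrite H [RHS]H; apply: perm_big; apply: uniq_perm; rewrite ?filter_uniq //.
by move=> x; rewrite !mem_filter; case: eqVneq => //= /[dup] /Fs-> /Ft->.
Qed.

Lemma dim_ge_gt0 (W : set K) m : (0 < m)%N -> dim_ge W m -> exists2 f, f != 0 & W f.
Proof.
by case: m => // m _ [u [Wu iu]]; exists (u ord0) => //; exact: indep_neq0 iu.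
Qed.

Lemma dim_ge_mul E f m : f != 0 -> dim_ge (L E) m -> dim_ge (L (fun x => E x + v x f)) m.
Proof.
move=> f0 [u [Lu iu]]; exists (fun i => f^-1 * u i); split.
  move=> i x; apply: vge_le (vgeM vP0 (vge_val v x f^-1) (Lu i x)).
  by rewrite (valV vP0) // opprD addrC.
move=> c; rewrite lcomb_mull => /eqP; rewrite mulf_eq0 invr_eq0 (negPf f0) /= => /eqP.
exact: iu.
Qed.

(** E is placed below a divisor E' linearly equivalent to l times the polar divisor of z, which has
    at least (l+1) n - c sections. Principal divisors have degree 0, so descending from E' to E
    costs l n - deg E. What remains is at least deg E - c, and c comes from z alone, so that it is
    uniform in E. *)
Lemma riemann_inequality : P -> exists c : nat, forall s E (m : nat), uniq s ->
  (forall x, x \notin s -> E x = 0) ->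
  m%:Z + c%:Z <= \sum_(x <- s) E x * (dg x)%:Z -> dim_ge (L E) m.
Proof.
move=> x0; have [z z0 xz] := val_unif vP0 x0.
have tz : transc z by apply: (val_transc vP0 (x := x0)); rewrite xz.
have [p [up pP]] := poles_list tz.
have [n [u [iu nE]]] := polar_deg tz up pP.
have n0 : (0 < n)%N.
  have [y /pP yp] := cval_pole vP tz; rewrite nE (big_rem y) //= addn_gt0.
  by rewrite muln_gt0 (residue_degree_gt0 vP0 dgP) absz_gt0 lt_eqF //; exact/pP.
have [c cP] := polar_sections tz iu; exists c => s E m us Es deg.
pose E1 x := Num.max 0 (E x); pose d1 := (\sum_(x <- s) `|E1 x| * dg x)%N.
pose l := (c + d1)%N.
have h1 : dim_ge (L (fun x => polar z x * l%:Z - E1 x)) (l.+1 * n - c - d1).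
  have := @dim_ge_diff s _ (fun x => polar z x * l%:Z - E1 x) _ us _ _ (cP l).
  rewrite (_ : (\sum_(x <- s) _)%N = d1); last by apply: eq_bigr => x _; rewrite subKr.
  apply=> x xs; first by rewrite /E1; lia.
  by rewrite /E1 Es // maxxx subr0.
(* With l = c + d1 and n >= 1, the bound (l+1) n - c - d1 is positive. The resulting f satisfies l
   polar(z) + (f) >= max(0, E). *)
have [|f f0 Lf] := dim_ge_gt0 _ h1; first by rewrite /l; nia.
have := dim_ge_mul f0 (cP l); set E' := (fun x => _) => h2.
have le x : E x <= E' x.
  by have := vge_nz f0 (Lf x); rewrite /E' /E1; lia.
have [q [uq qP]] := val_support f0.
pose t := undup (s ++ p ++ q).
have st x : x \in s -> x \in t by rewrite mem_undup mem_cat => ->.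
have pt x : x \in p -> x \in t by rewrite mem_undup !mem_cat => ->; rewrite orbT.
have qt x : x \in q -> x \in t by rewrite mem_undup !mem_cat => ->; rewrite !orbT.
have polarp x : polar z x != 0 -> x \in p.
  by move=> zx; apply/pP; move: zx; rewrite /polar; lia.
have ut : uniq t by exact: undup_uniq.
have := @dim_ge_diff t _ E _ ut _ _ h2; rewrite -subnDA => h3.
apply: dim_ge_leq (h3 _ _); [exact: sections_lin| |by move=> x _; exact: le|]; last first.
  move=> x xt; have xs : x \notin s by apply: contra xt; exact: st.
  have xp : polar z x = 0 by apply/eqP; apply: contraNT xt => /polarp/pt.
  have xq : v x f = 0 by apply/eqP; apply: contraNT xt => /qP/qt.
  by rewrite /E' xp xq Es // mul0r addr0.
have degE : (\sum_(x <- t) `|E' x - E x| * dg x)%N%:Z =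
    l%:Z * n%:Z - \sum_(x <- s) E x * (dg x)%:Z.
  rewrite Posz_sum.
  have -> : \sum_(x <- s) E x * (dg x)%:Z = \sum_(x <- t) E x * (dg x)%:Z.
    by apply: sum_support => // x; [|move=> Ex; apply: st; move: Ex];
      rewrite mulf_eq0 negb_or => /andP[Ex _]; apply: contraNT Ex => /Es->.
  have -> : n%:Z = \sum_(x <- t) polar z x * (dg x)%:Z.
    rewrite nE Posz_sum.
    transitivity (\sum_(x <- p) polar z x * (dg x)%:Z).
      by rewrite big_seq [RHS]big_seq; apply: eq_bigr => x /pP xz'; rewrite /polar; nia.
    by apply: sum_support => // x; rewrite mulf_eq0 negb_or => /andP[/polarp // xp _]; exact: pt.
  have dz : \sum_(x <- t) v x f * (dg x)%:Z = 0.
    by apply: degree_eq0 => // x /qP/qt.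
  transitivity (\sum_(x <- t) (l%:Z * (polar z x * (dg x)%:Z) - E x * (dg x)%:Z + v x f * (dg x)%:Z)).
    by apply: eq_bigr => x _; rewrite PoszM gez0_abs ?subr_ge0 // /E'; ring.
  by rewrite big_split sumrB /= dz addr0 mulr_sumr.
by move: degE; set d := (\sum_(x <- t) _)%N; move: deg; rewrite mulSn; nia.
Qed.

End Curve.

(** * Points of a projective variety and places of its function field *)

Module CurveValuations.
Import mpoly.

Section Variety.
Variables (k : fieldType) (X : projective_variety k).
Local Notation K := (ProjectiveGeometry.Rat X).
Local Notation cst := (@Rat_const k X).
Local Notation c := (@gcoord k X).
Local Notation form := {mpoly k[(adim X).+1]}.
Local Notation me F := (mmap cst c F).
Implicit Types (F G : form) (P Q : form -> Prop).
Local Notation incl := ProjectiveGeometry.incl.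

Lemma me_eq0 d F : F \is d.-homog -> (me F = 0 <-> hideal F).
Proof. exact: gcoord_vanish. Qed.

Lemma hideal_point : is_point (@hideal k X).
Proof. by split; [exact: hideal_prime|move=> F]. Qed.

Section Point.
Variable Q : form -> Prop.
Hypothesis ptQ : is_point Q.
Let rQ := ptQ.1.

Lemma pointN F : Q F -> Q (- F).
Proof. by move=> QF; rewrite -mulN1r; exact: rp_mul. Qed.

Lemma pointB F G : Q F -> Q G -> Q (F - G).
Proof. by move=> QF QG; apply: rp_add => //; exact: pointN. Qed.

Lemma point_not1 : ~ Q 1.
Proof. by move=> Q1; have [i] := rp_relevant rQ; apply; rewrite -[X in Q X]mulr1; exact: rp_mul. Qed.

Lemma point_sum (I : Type) (r : seq I) (F : I -> form) :
  (forall i, Q (F i)) -> Q (\sum_(i <- r) F i).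
Proof. by move=> QF; elim/big_ind: _ => //; [exact: rp_zero|exact: rp_add]. Qed.

Lemma me_neq0 d F : F \is d.-homog -> ~ Q F -> me F != 0.
Proof. by move=> hF nQ; apply/eqP => /(me_eq0 hF)/ptQ.2. Qed.

Lemma point_eqval d F G : F \is d.-homog -> G \is d.-homog -> me F = me G -> Q F -> Q G.
Proof.
move=> hF hG FG QF; rewrite -(subKr F G); apply: pointB => //.
by apply: ptQ.2; apply/(me_eq0 (d := d)); rewrite ?rpredB // mmapB FG subrr.
Qed.

Lemma point_components F : (forall d, Q (pihomog mdeg d F)) -> Q F.
Proof. by move=> QF; rewrite (pihomog_partitionE (leqnn (mmeasure mdeg F))); exact: point_sum. Qed.

Lemma homogX i : ('X_i : form) \is 1.-homog.
Proof. by rewrite dhomogX; apply/eqP; exact: mdeg1. Qed.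

Lemma homogC (a : k) : (a%:MP : form) \is 0.-homog.
Proof. by apply/dhomogP => m; rewrite msuppC; case: eqP => // _; rewrite inE => /eqP->; rewrite /= mdeg0. Qed.

Lemma homog1 : (1 : form) \is 0.-homog.
Proof. by rewrite -mpolyC1; exact: homogC. Qed.

Local Notation lr := (@local_ring k X Q).
Local Notation lm := (@local_max k X Q).

Lemma meM F G : me (F * G) = me F * me G. Proof. exact: rmorphM. Qed.

Lemma me1 : me 1 = 1. Proof. exact: rmorph1. Qed.

Lemma homogXn i n : ('X_i ^+ n : form) \is n.-homog.
Proof.
elim: n => [|n IH]; first by rewrite expr0 homog1.
by rewrite exprS; exact: (dhomogM (homogX i) IH).
Qed.

Lemma me_Xn i n : me ('X_i ^+ n) = c i ^+ n.
Proof. by rewrite rmorphXn /= mmapX mmap1U. Qed.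

Lemma point_notM F G : ~ Q F -> ~ Q G -> ~ Q (F * G).
Proof. by move=> nF nG /(rp_prime rQ)[]. Qed.

Lemma lr_cst a : lr (cst a).
Proof.
exists 0%N, a%:MP, 1; split; [exact: homogC|exact: homog1|exact: point_not1|].
by rewrite mmapC me1 divr1.
Qed.

Lemma lr1 : lr 1. Proof. by rewrite -(rmorph1 cst); exact: lr_cst. Qed.

Lemma lm_lr f : lm f -> lr f.
Proof. by move=> [d [F [G [hF hG _ nG ->]]]]; exists d, F, G. Qed.

Lemma lrM f g : lr f -> lr g -> lr (f * g).
Proof.
move=> [d [F [G [hF hG nG ->]]]] [d' [F' [G' [hF' hG' nG' ->]]]].
exists (d + d')%N, (F * F'), (G * G'); split; try exact: dhomogM.
  exact: point_notM.
by rewrite !meM mulf_div.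
Qed.

Lemma lmM f g : lr f -> lm g -> lm (f * g).
Proof.
move=> [d [F [G [hF hG nG ->]]]] [d' [F' [G' [hF' hG' QF' nG' ->]]]].
exists (d + d')%N, (F * F'), (G * G'); split; try exact: dhomogM.
- exact: rp_mul.
- exact: point_notM.
by rewrite !meM mulf_div.
Qed.

Lemma lrB f g : lr f -> lr g -> lr (f - g).
Proof.
move=> [d [F [G [hF hG nG ->]]]] [d' [F' [G' [hF' hG' nG' ->]]]].
exists (d + d')%N, (F * G' - F' * G), (G * G'); split.
- by apply: rpredB; [exact: dhomogM|rewrite addnC; exact: dhomogM].
- exact: dhomogM.
- exact: point_notM.
- by rewrite mmapB !meM -mulNr addf_div ?(me_neq0 hG) ?(me_neq0 hG') // mulNr.
Qed.

Lemma lmB f g : lm f -> lm g -> lm (f - g).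
Proof.
move=> [d [F [G [hF hG QF nG ->]]]] [d' [F' [G' [hF' hG' QF' nG' ->]]]].
exists (d + d')%N, (F * G' - F' * G), (G * G'); split.
- by apply: rpredB; [exact: dhomogM|rewrite addnC; exact: dhomogM].
- exact: dhomogM.
- by apply: pointB; rewrite mulrC; exact: rp_mul.
- exact: point_notM.
- by rewrite mmapB !meM -mulNr addf_div ?(me_neq0 hG) ?(me_neq0 hG') // mulNr.
Qed.

Lemma lm_frac d F G : F \is d.-homog -> G \is d.-homog -> ~ Q G ->
  lm (me F / me G) -> Q F.
Proof.
move=> hF hG nG [d' [F' [G' [hF' hG' QF' nG' e]]]].
have {e} : me (F' * G) = me (F * G').
  rewrite !meM; apply/eqP; rewrite -eqr_div ?(me_neq0 hG) ?(me_neq0 hG') //.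
  by rewrite e.
move=> /(point_eqval (d := (d' + d)%N)) H.
have : Q (F * G').
  by apply: H; [exact: dhomogM|rewrite addnC; exact: dhomogM|rewrite mulrC; exact: rp_mul].
by case/(rp_prime rQ).
Qed.

Lemma lm_not1 : ~ lm 1.
Proof.
rewrite -(divr1 1) -me1 => /(lm_frac homog1 homog1 point_not1).
exact: point_not1.
Qed.

Lemma lrV f : lr f -> ~ lm f -> lr f^-1.
Proof.
move=> [d [F [G [hF hG nG fE]]]] nm; exists d, G, F; split=> //.
  by move=> QF; apply: nm; exists d, F, G.
by rewrite fE invf_div.
Qed.

Lemma lm_prime f g : lr f -> lr g -> lm (f * g) -> lm f \/ lm g.
Proof.
move=> lf lg m; have [|nf] := pselect (lm f); [by left|right].
have f0 : f != 0.
  apply/eqP => f0; apply: nf; rewrite f0 -(subrr (f * g)); exact: lmB.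
by rewrite -[g](mulKf f0); apply: lmM => //; exact: lrV.
Qed.

Lemma lm0 : lm 0.
Proof.
exists 0%N, 0, 1; split; [exact: rpred0|exact: homog1|exact: rp_zero|exact: point_not1|].
by rewrite mmap0 mul0r.
Qed.

End Point.

Lemma incl_homog P Q : is_point P -> is_point Q ->
  (forall d F, F \is d.-homog -> P F -> Q F) -> incl P Q.
Proof.
move=> pP pQ H F PF; apply: (point_components pQ) => d.
by apply: H (pihomogP _ _ _) _; exact: (rp_homog pP.1).
Qed.

(** * Centres of prime ideals on a projective variety *)

Section Center.
Variables (A p : set K) (i : 'I_(adim X).+1).
Hypotheses (Acst : forall a, A (cst a)) (AB : forall f g, A f -> A g -> A (f - g)).
Hypotheses (AM : forall f g, A f -> A g -> A (f * g)) (pA : p `<=` A).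
Hypotheses (p0 : p 0) (pB : forall f g, p f -> p g -> p (f - g)).
Hypotheses (pM : forall f g, A f -> p g -> p (f * g)) (p1 : ~ p 1).
Hypothesis pP : forall f g, A f -> A g -> p (f * g) -> p f \/ p g.
Hypotheses (ci : c i != 0) (Ac : forall j, A (c j / c i)).

Let a j := c j / c i.
(* A form F of degree d is sent to F(c_0/c_i, ..., c_n/c_i) 'X^d. *)
Let phi : form -> {poly K} := mmap (polyC \o cst) (fun j => (a j)%:P * 'X).
Let Q F := forall d, p (phi F)`_d.

Let AD f g : A f -> A g -> A (f + g).
Proof.
move=> Af Ag; rewrite -[g]opprK; apply: AB => //; rewrite -sub0r; apply: AB => //.
exact: pA.
Qed.

Let pD f g : p f -> p g -> p (f + g).
Proof. by move=> pf pg; rewrite -[g]opprK; apply: pB => //; rewrite -sub0r; apply: pB. Qed.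

Let mmap1_phi (m : 'X_{1.. (adim X).+1}) :
  mmap1 (fun j => (a j)%:P * 'X) m = (mmap1 a m)%:P * 'X^(mdeg m).
Proof.
rewrite /mmap1; under eq_bigr => j _ do rewrite exprMn -rmorphXn.
rewrite big_split /= -rmorph_prod; congr (_ * _).
by rewrite mdegE prodrXr.
Qed.

Let mmap1_a (m : 'X_{1.. (adim X).+1}) : mmap1 a m = mmap1 c m / c i ^+ mdeg m.
Proof.
rewrite /mmap1 mdegE -prodrXr -prodf_div; apply: eq_bigr => j _.
by rewrite /a expr_div_n.
Qed.

Let phi_homog d F : F \is d.-homog -> phi F = (me F / c i ^+ d)%:P * 'X^d.
Proof.
move=> /dhomogP hF; rewrite /phi /mmap mulr_suml rmorph_sum mulr_suml big_seq [RHS]big_seq.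
apply: eq_bigr => m mF; rewrite mmap1_phi mmap1_a /= (hF _ mF) mulrA -rmorphM /=.
by rewrite mulrA.
Qed.

Let phi_pihomog d F e : (phi (pihomog mdeg d F))`_e = if e == d then (phi F)`_d else 0.
Proof.
have term m : (phi 'X_[m])`_e = mmap1 a m *+ (e == mdeg m).
  by rewrite /phi mmapX mmap1_phi coefCM coefXn mulr_natr.
have coefE m b : ((b%:P : {poly K}) * mmap1 (fun j => (a j)%:P * 'X) m)`_e =
    b * mmap1 a m *+ (e == mdeg m).
  by rewrite mmap1_phi mulrA -rmorphM coefCM coefXn mulr_natr.
case: eqVneq => [<-|ed]; last first.
  by rewrite (phi_homog (pihomogP mdeg d F)) coefCM coefXn (negPf ed) mulr0.
rewrite pihomogE /phi raddf_sum /= coef_sum {2}/mmap coef_sum big_mkcond /=.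
apply: eq_bigr => m _; rewrite coefE eq_sym; case: ifP => h; last by rewrite mulr0n.
by rewrite mmapZ mmapX coefE; move: h => /= ->.
Qed.

Let Asum (I : eqType) (r : seq I) (f : I -> K) :
  (forall j, j \in r -> A (f j)) -> A (\sum_(j <- r) f j).
Proof.
move=> Af; rewrite big_seq; elim/big_ind: _ => //; exact: pA.
Qed.

Let psum (I : eqType) (r : seq I) (f : I -> K) :
  (forall j, j \in r -> p (f j)) -> p (\sum_(j <- r) f j).
Proof. by move=> Af; rewrite big_seq; elim/big_ind: _. Qed.

Let A1 : A 1. Proof. by rewrite -(rmorph1 cst). Qed.

Lemma center_homog d F : F \is d.-homog -> A (me F / c i ^+ d).
Proof.
move=> /dhomogP hF; rewrite /mmap mulr_suml; apply: Asum => m mF.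
rewrite -mulrA -(hF _ mF) -mmap1_a; apply: AM => //.
rewrite /mmap1; elim/big_ind: _ => // j _; elim: (m j) => [|n IH]; rewrite ?expr0 // exprS.
by apply: AM => //; exact: Ac.
Qed.

Let A_phi F e : A (phi F)`_e.
Proof.
have -> : (phi F)`_e = (phi (pihomog mdeg e F))`_e by rewrite phi_pihomog eqxx.
rewrite (phi_homog (pihomogP mdeg e F)) coefCM coefXn eqxx mulr1.
by apply: center_homog; exact: pihomogP.
Qed.

Let Q_homog d F : F \is d.-homog -> (Q F <-> p (me F / c i ^+ d)).
Proof.
move=> hF; rewrite /Q (phi_homog hF); split=> [/(_ d)|pF e].
  by rewrite coefCM coefXn eqxx mulr1.
by rewrite coefCM coefXn; case: eqP => _; rewrite ?mulr1 ?mulr0.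
Qed.

Let phiM F G : phi (F * G) = phi F * phi G. Proof. exact: rmorphM. Qed.

(** The chart c_i != 0 sends A-valued coordinates to a point of affine space, and P is the prime of
    forms vanishing there modulo p. The extra variable keeps the components of different degrees
    apart, so that P is homogeneous by construction. *)
Lemma exists_center : exists P, is_point P /\
  forall d F, F \is d.-homog -> (P F <-> p (me F / c i ^+ d)).
Proof.
exists Q; split=> //; split.
  split.
  - by move=> d; rewrite /phi mmap0 coef0.
  - by move=> F G QF QG d; rewrite /phi mmapD coefD; exact: pD.
  - move=> F G QG d; rewrite phiM coefM; apply: psum => j _; apply: pM => //.
  - move=> F G QFG; apply: contrapT => /not_orP[/existsNP exF /existsNP exG].
    (* As in Gauss's lemma, take the lowest coefficients of the two factors outside p. In the
       product, every other contribution to the coefficient in the sum of their degrees lies in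
       p. *)
    have ex2 H : (exists e, ~ p (phi H)`_e) ->
        exists e, ~ p (phi H)`_e /\ forall e', (e' < e)%N -> p (phi H)`_e'.
      move=> [e0 pe0]; pose S e := `[< ~ p (phi H)`_e >].
      have exS : exists e, S e by exists e0; exact/asboolP.
      case: (ex_minnP exS) => e /asboolP pe mine; exists e; split=> // e' lt.
      apply: contrapT => npe'; have /mine : S e' by exact/asboolP.
      by rewrite leqNgt lt.
    have [e [pe mine]] := ex2 _ exF; have [e' [pe' mine']] := ex2 _ exG.
    have := QFG (e + e')%N; rewrite phiM coefM.
    have lt : (e < (e + e').+1)%N by rewrite ltnS leq_addr.
    rewrite (bigD1 (Ordinal lt)) //= addKn => pS.
    suff : p ((phi F)`_e * (phi G)`_e') by case/(pP (A_phi _ _) (A_phi _ _)).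
    rewrite -[X in p X](addrK (\sum_(j < (e + e').+1 | j != Ordinal lt) (phi F)`_j * (phi G)`_(e + e' - j))).
    apply: pB => //; elim/big_ind: _ => // j jE.
    have /orP[je|ej] : (j < e)%N || (e < j)%N by rewrite -neq_ltn; move: jE; rewrite -val_eqE.
      by rewrite mulrC; apply: pM => //; exact: mine.
    by apply: pM => //; apply: mine'; have := ltn_ord j; lia.
  - by move=> d F QF e; rewrite phi_pihomog; case: ifP.
  - exists i => /(Q_homog (homogX i)); rewrite mmapX mmap1U expr1 divff //.
move=> F HF d; have -> : (phi F)`_d = (phi (pihomog mdeg d F))`_d by rewrite phi_pihomog eqxx.
have hF := pihomogP mdeg d F; rewrite (phi_homog hF).
have -> : me (pihomog mdeg d F) = 0.
  by apply/(me_eq0 hF); exact: (rp_homog (@hideal_prime k X)).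
by rewrite mul0r polyC0 mul0r coef0.
Qed.

End Center.
End Variety.

(** * The valuative criterion of properness *)

Section PlaceCenter.
Variables (k : fieldType) (X : projective_variety k).
Local Notation K := (ProjectiveGeometry.Rat X).
Local Notation cst := (@Rat_const k X).
Local Notation c := (@gcoord k X).
Local Notation form := {mpoly k[(adim X).+1]}.
Local Notation me F := (mmap cst c F).
Implicit Types (F G : form) (P Q : form -> Prop).
Local Notation incl := ProjectiveGeometry.incl.

Lemma coord_neq0 Q i : is_point Q -> ~ Q 'X_i -> c i != 0.
Proof. by move=> pQ /(me_neq0 pQ (homogX i)); rewrite mmapX mmap1U. Qed.

Lemma lr_coord Q i j : is_point Q -> ~ Q 'X_i -> local_ring Q (c j / c i).
Proof.
move=> pQ nQ; exists 1%N, 'X_j, 'X_i; split=> //; [exact: homogX|exact: homogX|].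
by rewrite !mmapX !mmap1U.
Qed.

Lemma lr_form Q i d F : is_point Q -> ~ Q 'X_i -> F \is d.-homog ->
  local_ring Q (me F / c i ^+ d).
Proof.
move=> pQ nQ hF; rewrite -me_Xn; exists d, F, ('X_i ^+ d); split=> //; first exact: homogXn.
elim: d {hF} => [|d IH]; first by rewrite expr0; exact: point_not1.
by rewrite exprS; exact: point_notM.
Qed.

Lemma lm_form Q i d F : is_point Q -> ~ Q 'X_i -> F \is d.-homog ->
  (local_max Q (me F / c i ^+ d) <-> Q F).
Proof.
move=> pQ nQ hF; rewrite -me_Xn; have nX : ~ Q ('X_i ^+ d).
  elim: d {hF} => [|d IH]; first by rewrite expr0; exact: point_not1.
  by rewrite exprS; exact: point_notM.
split; first exact: (lm_frac pQ hF (homogXn i d) nX).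
by move=> QF; exists d, F, ('X_i ^+ d); split=> //; exact: homogXn.
Qed.

Lemma divr_div_pow (a b x : K) d : x != 0 -> a / b = (a / x ^+ d) / (b / x ^+ d).
Proof.
move=> x0; have xd : x ^+ d != 0 by rewrite expf_neq0.
by rewrite invf_div mulrA divfK.
Qed.

(** Divide the homogeneous coordinates by the one of largest absolute value for the place: all
    ratios then lie in O, and J has a centre on that chart. *)
Lemma place_center O J : place O J -> (forall a, O (cst a)) ->
  exists i P, [/\ c i != 0, forall j, O (c j / c i), is_point P,
    forall d F, F \is d.-homog -> (P F <-> J (me F / c i ^+ d)) &
    local_ring P `<=` O /\ local_max P `<=` J].
Proof.
move=> pl Ocst.
have coord_nz : exists i, c i != 0.
  have [i ni] := rp_relevant (@hideal_prime k X); exists i.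
  exact: (coord_neq0 (hideal_point X)).
have [i [ci Oc]] : exists i, c i != 0 /\ forall j, O (c j / c i).
  suff H (s : seq 'I_(adim X).+1) : exists i, c i != 0 /\ forall j, j \in s -> O (c j / c i).
    have [i [ci h]] := H (enum 'I_(adim X).+1); exists i; split=> // j.
    by apply: h; rewrite mem_enum.
  elim: s => [|j s [i [ci Os]]]; first by have [i ci] := coord_nz; exists i.
  (* Either c_i still dominates, or c_i / c_j lies in O and c_j takes over, unless c_j = 0 and the
     ratio is harmless. *)
  have [|Oij] := place_total pl (c j / c i).
    move=> /(place_sub pl) Oji; exists i; split=> // l; rewrite inE => /orP[/eqP->//|].
    exact: Os.
  have [cj|cj] := eqVneq (c j) 0.
    exists i; split=> // l; rewrite inE => /orP[/eqP->|]; last exact: Os.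
    by rewrite cj mul0r; apply: (place_sub pl); exact: place_id0 pl.
  exists j; split=> // l; rewrite inE => /orP[/eqP->|ls].
    by rewrite divff //; exact: place1 pl.
  rewrite (_ : c l / c j = (c l / c i) * (c j / c i)^-1).
    by apply: (placeM pl) => //; exact: Os.
  by rewrite invf_div mulrA divfK.
have J_prime f g : O f -> O g -> J (f * g) -> J f \/ J g.
  move=> Of Og Jfg; have [->|f0] := eqVneq f 0; first by left; exact: place_id0 pl.
  have [Jf|Of'] := place_total pl f; [by left|right].
  by rewrite -[g](mulKf f0); exact: (place_idM pl).
have [P [pP PJ]] := exists_center Ocst (placeB pl) (placeM pl) (place_sub pl)
  (place_id0 pl) (place_idB pl) (place_idM pl) (place_id1 pl) J_prime ci Oc.
have OF d F : F \is d.-homog -> O (me F / c i ^+ d).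
  exact: (center_homog Ocst (placeB pl) (placeM pl) (place_sub pl) (place_id0 pl) Oc).
have OV f : O f -> ~ J f -> O f^-1.
  by move=> Of nJ; have [|//] := place_total pl f.
exists i, P; split=> //; split=> f.
  move=> [d [F [G [hF hG nG ->]]]]; rewrite (divr_div_pow _ _ d ci).
  apply: (placeM pl); first exact: OF.
  by apply: OV; [exact: OF|move=> JG; apply: nG; exact/(PJ _ _ hG)].
move=> [d [F [G [hF hG PF nG ->]]]]; rewrite (divr_div_pow _ _ d ci) mulrC.
apply: (place_idM pl); last exact/(PJ _ _ hF).
by apply: OV; [exact: OF|move=> JG; apply: nG; exact/(PJ _ _ hG)].
Qed.

End PlaceCenter.

(** * Orders at closed points of a regular curve *)

Section RegularCurve.
Variables (k : fieldType) (X : regular_projective_curve k).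
Local Notation K := (ProjectiveGeometry.Rat X).
Local Notation cst := (@Rat_const k X).
Local Notation c := (@gcoord k X).
Local Notation form := {mpoly k[(adim X).+1]}.
Local Notation me F := (mmap cst c F).
Local Notation hideal := (@hideal k X).
Implicit Types (F G : form) (P Q : form -> Prop) (f g w u : K) (x y : closed_point X).
Local Notation incl := ProjectiveGeometry.incl.

Lemma closed_of_not_generic Q : is_point Q -> ~ incl Q hideal -> @is_closed_point k X Q.
Proof.
move=> pQ nQ; split=> // Q' pQ' QQ'; apply: contrapT => nQ'.
by apply: ((curve_dim1 X).2 hideal Q Q'); split; split=> //; [exact: hideal_point|exact: pQ.2].
Qed.

Lemma closed_not_generic Q : @is_closed_point k X Q -> ~ incl Q hideal.
Proof.
move=> [pQ maxQ] Qh; have [P0 [Q0 [pP0 pQ0 PQ nQP]]] := (curve_dim1 X).1.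
have Q0Q : incl Q0 Q by apply: maxQ => // G /Qh; exact: pQ0.2.
by apply: nQP => F /Q0Q/Qh; exact: pP0.2.
Qed.

Lemma closed_point_exists : inhabited (closed_point X).
Proof.
have [P0 [Q0 [pP0 pQ0 PQ nQP]]] := (curve_dim1 X).1.
have cQ : @is_closed_point k X Q0.
  by apply: closed_of_not_generic => // Qh; apply: nQP => F /Qh; exact: pP0.2.
by exists; exists Q0.
Qed.

Section AtPoint.
Variable x : closed_point X.
Let Q := cp_ideal x.
Let cQ : is_closed_point Q := cp_closed x.
Let pQ : is_point Q := cQ.1.
Local Notation lr := (@local_ring k X Q).
Local Notation lm := (@local_max k X Q).

Lemma chart_exists : exists i, ~ Q 'X_i.
Proof. exact: rp_relevant pQ.1. Qed.

Lemma lm_nonzero : exists2 f, f != 0 & lm f.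
Proof.
have [i ni] := chart_exists.
have [d [F [hF QF nF]]] : exists d F, [/\ F \is d.-homog, Q F & ~ hideal F].
  apply: contrapT => H; apply: (closed_not_generic cQ).
  apply: (incl_homog pQ (hideal_point X)) => d F hF QF.
  by apply: contrapT => nF; apply: H; exists d, F.
exists (me F / c i ^+ d); last exact/(lm_form pQ ni hF).
rewrite mulf_neq0 ?invr_eq0 ?expf_neq0 //.
  exact: (me_neq0 (hideal_point X) hF).
exact: (coord_neq0 pQ).
Qed.

Section Uniformizer.
Variable w : K.
Hypothesis uw : uniformizer Q w.

Lemma unif_lm : lm w.
Proof. by apply/uw; exists 1; [exact: lr1|rewrite mul1r]. Qed.

Lemma unif_neq0 : w != 0.
Proof.
have [f f0 /uw[a _ fE]] := lm_nonzero.
by apply: contraNneq f0 => w0; rewrite fE w0 mulr0.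
Qed.

Lemma lrX f n : lr f -> lr (f ^+ n).
Proof. by move=> lf; elim: n => [|n IH]; [rewrite expr0; exact: lr1|rewrite exprS; exact: lrM]. Qed.

Lemma not_lm_neq0 f : ~ lm f -> f != 0.
Proof. by move=> nf; apply/eqP => f0; apply: nf; rewrite f0; exact: lm0. Qed.

Lemma unit_mul f g : lr f -> lr g -> ~ lm f -> ~ lm g -> ~ lm (f * g).
Proof. by move=> lf lg nf ng /(lm_prime pQ lf lg)[]. Qed.

Let deep : set K := [set f | forall n, exists2 a, lr a & f = a * w ^+ n].

Let deep_lr : deep `<=` lr.
Proof. by move=> f /(_ 0%N)[a la ->]; rewrite expr0 mulr1. Qed.

Lemma finite_order f n : lr f -> ~ (exists2 a, lr a & f = a * w ^+ n) ->
  exists m a, [/\ lr a, ~ lm a & f = a * w ^+ m].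
Proof.
move=> lf nf; pose S m := `[< ~ exists2 a, lr a & f = a * w ^+ m >].
have exS : exists m, S m by exists n; exact/asboolP.
case: (ex_minnP exS) => -[|m] /asboolP nm minm.
  by case: nm; exists f => //; rewrite expr0 mulr1.
have [a la fE] : exists2 a, lr a & f = a * w ^+ m.
  by apply: contrapT => h; have /minm : S m by [exact/asboolP]; rewrite ltnn.
exists m, a; split=> // /uw[b lb aE]; apply: nm; exists b => //.
by rewrite fE aE exprS mulrA.
Qed.

(** Elements outside the intersection are a unit times a power of w, and the exponents of two such
    elements add up under multiplication. So their product stays outside. *)
Let deep_prime f g : lr f -> lr g -> deep (f * g) -> deep f \/ deep g.
Proof.
move=> lf lg dfg; apply: contrapT => /not_orP[/existsNP[n nf] /existsNP[m ng]].
have [n' [a [la na fE]]] := finite_order lf nf.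
have [m' [b [lb nb gE]]] := finite_order lg ng.
have [e le] := dfg (n' + m').+1; rewrite fE gE mulrACA -exprD exprS mulrA.
move=> /(mulIf (expf_neq0 _ unif_neq0)) ab.
by apply: (unit_mul la lb na nb); apply/uw; exists e.
Qed.

(* A nonzero intersection of the powers of the maximal ideal would give a
   point strictly between the generic point and x. *)
Lemma deep_eq0 f : (forall n, exists2 a, lr a & f = a * w ^+ n) -> f = 0.
Proof.
move=> df; apply/eqP; apply: contraT => f0.
have [i ni] := chart_exists; have ci := coord_neq0 pQ ni.
have d0 : deep 0 by move=> n; exists 0; rewrite ?mul0r //; apply: lm_lr; exact: lm0.
have dB a b : deep a -> deep b -> deep (a - b).
  move=> da db n; have [a' la ->] := da n; have [b' lb ->] := db n.
  by exists (a' - b'); [exact: lrB|rewrite mulrBl].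
have dM a b : lr a -> deep b -> deep (a * b).
  move=> la db n; have [b' lb ->] := db n.
  by exists (a * b'); [exact: lrM|rewrite mulrA].
have d1 : ~ deep 1.
  move=> /(_ 1%N)[a la e]; apply: (lm_not1 pQ); rewrite e expr1.
  by apply/uw; exists a.
have [P [pP PE]] := exists_center (lr_cst pQ) (@lrB _ _ _ pQ) (@lrM _ _ _ pQ)
  deep_lr d0 dB dM d1 deep_prime ci (fun j => lr_coord j pQ ni).
have deep_lm a : deep a -> lm a.
  by move=> /(_ 1%N)[b lb ->]; rewrite expr1; apply/uw; exists b.
(* Both inclusions are strict: the numerator of f lies in P but does not vanish on X, and if Q were
   contained in P, then w = a w^2 for some a, hence 1 = a w in the maximal ideal. *)
exfalso; apply: ((curve_dim1 X).2 hideal P Q); split; split=> //.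
- exact: hideal_point.
- exact: pP.2.
- move=> Ph; have : lr f by exact: deep_lr.
  move=> [d [F [G [hF hG nG fE]]]].
  suff /Ph/(me_eq0 hF) F0 : P F by move: f0; rewrite fE F0 mul0r eqxx.
  apply/(PE _ _ hF); rewrite (_ : me F = f * me G); last first.
    by rewrite fE divfK // (me_neq0 pQ hG nG).
  by rewrite -mulrA mulrC; apply: dM => //; exact: lr_form.
- apply: (incl_homog pP pQ) => d F hF /(PE _ _ hF)/deep_lm.
  by move/(lm_form pQ ni hF).
- move=> QP; have [d [F [G [hF hG QF nG wE]]]] := unif_lm.
  have : deep w.
    rewrite wE (divr_div_pow _ _ d ci) mulrC; apply: dM; last first.
      by apply/(PE _ _ hF); exact: QP.
    apply: lrV => //; first exact: lr_form.
    by move/(lm_form pQ ni hG).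
  move=> /(_ 2%N)[a la e]; apply: (lm_not1 pQ); apply/uw; exists a => //.
  by apply: (mulIf unif_neq0); rewrite mul1r -mulrA -expr2.
Qed.

Lemma lr_decomp f : f != 0 -> lr f -> exists m u, local_unit x u /\ f = w ^+ m * u.
Proof.
move=> f0 lf; have [/deep_eq0/eqP|/existsNP[n nf]] := pselect (forall n, exists2 a, lr a & f = a * w ^+ n).
  by rewrite (negPf f0).
have [m [a [la na ->]]] := finite_order lf nf.
by exists m, a; rewrite mulrC.
Qed.

Lemma local_unitV u : local_unit x u -> local_unit x u^-1.
Proof.
move=> [lu nu]; split; first exact: lrV.
move=> mu; apply: (lm_not1 pQ); rewrite -(divff (not_lm_neq0 nu)).
exact: lmM.
Qed.

Lemma local_unitM u u' : local_unit x u -> local_unit x u' -> local_unit x (u * u').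
Proof. by move=> [lu nu] [lu' nu']; split; [exact: lrM|exact: unit_mul]. Qed.

Lemma local_unit1 : local_unit x 1.
Proof. by split; [exact: lr1|exact: lm_not1]. Qed.

Lemma local_unitX u n : local_unit x u -> local_unit x (u ^+ n).
Proof.
move=> uu; elim: n => [|n IH]; first by rewrite expr0; exact: local_unit1.
by rewrite exprS; exact: local_unitM.
Qed.

Lemma local_unitXz u (n : int) : local_unit x u -> local_unit x (u ^ n).
Proof. by move=> uu; case: n => n; [exact: local_unitX|apply: local_unitV; exact: local_unitX]. Qed.

Lemma unif_decomp f : f != 0 -> exists (m : int) u, local_unit x u /\ f = w ^ m * u.
Proof.
move=> f0; have [d [F [G [hF hG nG fE]]]] := Rat_frac f.
have [i ni] := chart_exists; have ci := coord_neq0 pQ ni.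
have G0 := me_neq0 (hideal_point X) hG nG.
have F0 : me F != 0 by apply: contraNneq f0 => F0; rewrite fE F0 mul0r.
have cd : (c i ^+ d)^-1 != 0 by rewrite invr_eq0 expf_neq0.
have [m [u [uu FE]]] := lr_decomp (mulf_neq0 F0 cd) (lr_form pQ ni hF).
have [m' [u' [uu' GE]]] := lr_decomp (mulf_neq0 G0 cd) (lr_form pQ ni hG).
exists (m%:Z - m'%:Z), (u / u'); split; first by apply: local_unitM => //; exact: local_unitV.
rewrite fE (divr_div_pow (me F) (me G) d ci) FE GE expfzDr ?unif_neq0 // -mulf_div.
by congr (_ * _); rewrite -invr_expz.
Qed.

Lemma unif_lr (n : nat) u : local_unit x u -> lm (w ^+ n.+1 * u).
Proof.
move=> [lu _]; apply/uw; exists (u * w ^+ n); last by rewrite exprSr mulrC mulrA.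
by apply: lrM => //; apply: lrX; apply: lm_lr; exact: unif_lm.
Qed.

End Uniformizer.

(** Two uniformizers differ by a unit, so w'^(m - m') is a unit, whereas a positive power of w' lies
    in the maximal ideal. This makes the value chosen in [ord] independent of the choice. *)
Lemma unif_unique w w' (m m' : int) u u' : uniformizer Q w -> uniformizer Q w' ->
  local_unit x u -> local_unit x u' -> w ^ m * u = w' ^ m' * u' -> m = m'.
Proof.
move=> uw uw' uu uu' e.
have w0 := unif_neq0 uw; have w'0 := unif_neq0 uw'.
have [a la wE] := (uw' w).1 (unif_lm uw); have [b lb wE'] := (uw w').1 (unif_lm uw').
have ab : a * b = 1.
  by apply: (mulIf w0); rewrite mul1r {2}wE wE' mulrA.
have ua : local_unit x a.
  by split=> // ma; apply: (lm_not1 pQ); rewrite -ab mulrC; exact: lmM.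
have a0 : a != 0 by exact: not_lm_neq0 ua.2.
have : w' ^ (m - m') = u' / (a ^ m * u).
  have u0 := not_lm_neq0 uu.2; have u'0 := not_lm_neq0 uu'.2.
  have am : a ^ m != 0 by rewrite expfz_neq0.
  apply: (mulIf (mulf_neq0 am u0)); rewrite divfK ?mulf_neq0 //.
  apply: (mulfI (expfz_neq0 m' w'0)); rewrite -e wE mulrA -expfzDr //.
  by rewrite addrC subrK mulrA -expfzMl [w' * a]mulrC.
have : local_unit x (u' / (a ^ m * u)).
  by apply: local_unitM => //; apply: local_unitV; apply: local_unitM => //; exact: local_unitXz.
move: (u' / _) => t ut; case: (ltrgtP m m') => // lt.
  have -> : m - m' = - ((`|m' - m|.-1).+1)%:Z by lia.
  rewrite -invr_expz => /(congr1 (fun z => z^-1)); rewrite invrK -exprnP => tE.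
  have := unif_lr uw' (`|m' - m|.-1) local_unit1; rewrite mulr1 tE.
  by case: (local_unitV ut).
have -> : m - m' = ((`|m - m'|.-1).+1)%:Z by lia.
rewrite -exprnP => tE; have := unif_lr uw' (`|m - m'|.-1) local_unit1.
by rewrite mulr1 tE; case: ut.
Qed.

Lemma ordE w (m : int) u : uniformizer Q w -> local_unit x u -> ord x (w ^ m * u) = m.
Proof.
move=> uw uu; rewrite /ord; case: xgetP => [m' _ [w' [u' [uw' uu' e]]]|/(_ m) []].
  exact/esym/(unif_unique uw uw' uu uu' e).
by exists w, u.
Qed.

End AtPoint.
End RegularCurve.

(** * Closed points as the places of the function field *)

Section RegularCurve.
Variables (k : fieldType) (X : regular_projective_curve k).
Local Notation K := (ProjectiveGeometry.Rat X).
Local Notation cst := (@Rat_const k X).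
Local Notation c := (@gcoord k X).
Local Notation form := {mpoly k[(adim X).+1]}.
Local Notation me F := (mmap cst c F).
Local Notation hideal := (@hideal k X).
Implicit Types (F G : form) (P Q : form -> Prop) (f g w u : K) (x y : closed_point X).
Local Notation incl := ProjectiveGeometry.incl.
Local Notation ord := (@ord k X).
Local Notation lr x := (@local_ring k X (cp_ideal x)).
Local Notation lm x := (@local_max k X (cp_ideal x)).

Let pt x : is_point (cp_ideal x) := (cp_closed x).1.

Lemma lr_val x w (m : int) f : uniformizer (cp_ideal x) w ->
  vge ord x m f <-> exists2 a, lr x a & f = w ^ m * a.
Proof.
move=> uw; have w0 := unif_neq0 uw; split.
  have [-> _|f0] := eqVneq f 0.
    by exists 0; rewrite ?mulr0 //; apply: lm_lr; exact: lm0.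
  case=> [/eqP|]; first by rewrite (negPf f0).
  have [n [u [uu fE]]] := unif_decomp uw f0; rewrite fE (ordE n uw uu) => mn.
  exists (w ^+ `|n - m| * u).
    by apply: (lrM (pt x)); [apply: lrX; apply: lm_lr; exact: unif_lm|exact: uu.1].
  by rewrite mulrA exprnP -expfzDr // gez0_abs ?subr_ge0 // [m + _]addrC subrK.
move=> [a la ->]; have [->|a0] := eqVneq a 0; first by rewrite mulr0; left.
have [n [u [uu ->]]] := lr_decomp uw a0 la.
by right; rewrite mulrA exprnP -expfzDr // (ordE _ uw uu) lerDl.
Qed.

Lemma vge0_lr x f : vge ord x 0 f <-> lr x f.
Proof.
have [w uw] := curve_regular (cp_closed x).
apply: iff_trans (lr_val 0 f uw) _.
split=> [[a la ->]|lf]; first by rewrite expr0z mul1r.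
by exists f; rewrite // expr0z mul1r.
Qed.

Lemma vge1_lm x f : vge ord x 1 f <-> lm x f.
Proof.
have [w uw] := curve_regular (cp_closed x).
apply: iff_trans (lr_val 1 f uw) _; apply: iff_trans (iff_sym (uw f)).
by split=> -[a la ->]; exists a; rewrite // expr1z mulrC.
Qed.

Lemma ord_unit0 x u : local_unit x u -> ord x u = 0.
Proof.
have [w uw] := curve_regular (cp_closed x).
by move=> /(ordE 0 uw); rewrite expr0z mul1r.
Qed.

Lemma cst_unit x (a : k) : a != 0 -> local_unit x (cst a).
Proof.
move=> a0; split; first exact: (lr_cst (pt x)).
move=> ma; apply: (lm_not1 (pt x)).
rewrite -(rmorph1 cst) -(mulVf a0) rmorphM; exact: (lmM (pt x)) (lr_cst (pt x) _) ma.
Qed.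

Lemma ord_at0 x : ord x 0 = 0.
Proof.
rewrite /Defs.ord; case: xgetP => // m _ [w [u [uw uu /esym/eqP]]].
rewrite mulf_eq0 (negPf (expfz_neq0 _ (unif_neq0 uw))) /=.
by rewrite (negPf (not_lm_neq0 uu.2)).
Qed.

Lemma point_separation x y : x != y -> exists d F,
  [/\ F \is d.-homog, cp_ideal y F & ~ cp_ideal x F].
Proof.
move=> xy; apply: contrapT => H; move/eqP: xy; apply.
have yx : incl (cp_ideal y) (cp_ideal x).
  apply: (incl_homog (pt y) (pt x)) => d F hF yF; apply: contrapT => nF.
  by apply: H; exists d, F.
have xy : incl (cp_ideal x) (cp_ideal y) by exact: (cp_closed y).2.
move: x y {H} xy yx => [P cP] [P' cP'] /= PP' P'P.
have e : P = P' by apply/funext => F; apply/propext; split; [exact: PP'|exact: P'P].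
by subst P'; congr ClosedPoint; exact: Prop_irrelevance.
Qed.

Lemma ord_valuations : valuations cst ord.
Proof.
split.
- move=> x f g f0 g0; have [w uw] := curve_regular (cp_closed x).
  have w0 := unif_neq0 uw.
  have [m [u [uu ->]]] := unif_decomp uw f0; have [n [u' [uu' ->]]] := unif_decomp uw g0.
  by rewrite mulrACA -expfzDr // !(ordE _ uw) //; exact: local_unitM.
- move=> x m f g; have [w uw] := curve_regular (cp_closed x).
  move=> /(lr_val m _ uw)[a la ->] /(lr_val m _ uw)[b lb ->]; apply/(lr_val m _ uw).
  exists (a + b); last by rewrite mulrDr.
  rewrite -[b]opprK; apply: (lrB (pt x)) => //.
  rewrite -sub0r; apply: (lrB (pt x)) => //.
  by apply: lm_lr; exact: lm0 (pt x).
- move=> x a; have [->|a0] := eqVneq a 0; first by rewrite rmorph0 ord_at0.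
  by apply: ord_unit0; exact: cst_unit.
- move=> x; have [w uw] := curve_regular (cp_closed x).
  exists w; first exact: unif_neq0 uw.
  by rewrite -[w]mulr1 -{1}[w]expr1z; apply: (ordE 1 uw); exact: local_unit1.
- move=> x y xy; have [d [F [hF yF nF]]] := point_separation xy.
  have [i ni] := chart_exists y; have ci := coord_neq0 (pt y) ni.
  have F0 := me_neq0 (pt x) hF nF.
  have a0 : c i ^+ d / me F != 0 by rewrite mulf_neq0 ?invr_eq0 ?expf_neq0.
  (* The inverse of this function vanishes at y, because F does and c_i does not; its denominator
     does not vanish at x. *)
  exists (c i ^+ d / me F); split=> //.
    have /vge0_lr : lr x (c i ^+ d / me F).
      by exists d, ('X_i ^+ d), F; split=> //; [exact: homogXn|rewrite me_Xn].
    by case=> // /eqP; rewrite (negPf a0).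
  rewrite ltNge; apply/negP => l.
  have {}l : lr y (c i ^+ d / me F) by apply/vge0_lr; right.
  apply: (lm_not1 (pt y)); rewrite -(divff a0) invf_div.
  by apply: (lmM (pt y)) => //; exact/(lm_form (pt y) ni hF).
Qed.

(** A place centred at the generic point has a valuation ring containing the local ring there, which
    is all of K. *)
Lemma place_closed_point O J : place O J -> (forall a, O (cst a)) -> ~ (forall f, O f) ->
  exists x, lr x `<=` O /\ lm x `<=` J.
Proof.
move=> pl Oc nO; have [i [P [ci Oci pP PE [lO lJ]]]] := place_center pl Oc.
have cP : @is_closed_point k X P.
  apply: closed_of_not_generic => // Ph; apply: nO => f; apply: lO.
  by have [d [F [G [hF hG nG ->]]]] := Rat_frac f; exists d, F, G; split=> // /Ph.
by exists (ClosedPoint cP).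
Qed.

(** With 1/y for f, this is the set I + k[1/y]/y: a place whose maximal ideal contains it has y as a
    pole and sends I to 0. *)
Definition nonunital_poly (f : K) (I : set K) : set K :=
  [set a + ev cst f q * f | a in I & q in [set: {poly k}]].

Lemma nonunital_polyP (f : K) (I : set K) : I 0 ->
  (forall a b, I a -> I b -> I (a - b)) -> (forall a b, I a -> I b -> I (a * b)) ->
  (forall (a : k) b, I b -> I (cst a * b)) -> (forall b, I b -> I (f * b)) ->
  ~ nonunital_poly f I 1 ->
  nonunital (range cst) (nonunital_poly f I).
Proof.
move=> I0 IB IM Ic If n1.
have ID a b : I a -> I b -> I (a + b).
  by move=> Ia Ib; rewrite -[b]opprK; apply: (IB) => //; rewrite -sub0r; exact: IB.
have Iev q b : I b -> I (ev cst f q * b).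
  move=> Ib; rewrite (ev_coef _ _ (leqnn _)) mulr_suml.
  elim/big_ind: _ => // j _; rewrite -mulrA; apply: Ic.
  by elim: (nat_of_ord j) => [|n IH]; rewrite ?expr0 ?mul1r // exprS -mulrA; exact: If.
split=> //.
- move=> _ _ [a Ia [q _ <-]] [b Ib [r _ <-]]; exists (a - b); first exact: IB.
  by exists (q - r) => //; rewrite evD evN; ring.
- move=> _ _ [a Ia [q _ <-]] [b Ib [r _ <-]].
  exists (a * b + ev cst f ('X * r) * a + ev cst f (q * 'X) * b).
    by apply: (ID); [apply: (ID); [exact: IM|exact: Iev]|exact: Iev].
  by exists (q * r * 'X) => //; rewrite !evM evX; ring.
- move=> _ _ [e _ <-] [a Ia [q _ <-]]; exists (cst e * a); first exact: Ic.
  by exists (e%:P * q) => //; rewrite evM evC; ring.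
Qed.

Lemma place_avoiding (f : K) (I : set K) : f != 0 -> I 0 ->
  nonunital (range cst) (nonunital_poly f^-1 I) ->
  exists O J, [/\ place O J, forall a, O (cst a), I `<=` J, J f^-1 & ~ O f].
Proof.
move=> f0 I0 nuI.
have [|O [J [pl IJ FO]]] := exists_place _ nuI.
  by exists 0 => //; exists 0 => //; rewrite ev0 mul0r addr0.
have Jf : J f^-1.
  by apply: IJ; exists 0 => //; exists 1 => //; rewrite ev1 mul1r add0r.
exists O, J; split=> //.
- by move=> a; apply: FO; exists a.
- by move=> a Ia; apply: IJ; exists a => //; exists 0 => //; rewrite ev0 mul0r addr0.
- by move=> Of; apply: (place_id1 pl); rewrite -(divff f0); exact: (place_idM pl).
Qed.

(* The residue field at a closed point is algebraic over k: otherwise a place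
   above the point would be centred at a strict specialization. *)
Lemma residue_algebraic x (y : K) : lr x y -> exists2 p, p != 0 & lm x (ev cst y p).
Proof.
move=> ly; apply: contrapT => H; have pQ := pt x.
have {}H p : p != 0 -> ~ lm x (ev cst y p) by move=> p0 m; apply: H; exists p.
have ny : ~ lm x y by rewrite -[y](evX cst); apply: H; rewrite polyX_eq0.
have y0 := not_lm_neq0 ny; have lV := lrV ly ny.
have [] := @place_avoiding y (lm x) y0 (lm0 pQ).
  apply: nonunital_polyP => //.
  - exact: lm0.
  - exact: (lmB pQ).
  - by move=> a b la lb; apply: lmM => //; exact: lm_lr.
  - by move=> a b lb; apply: lmM => //; exact: (lr_cst pQ).
  - by move=> b lb; apply: lmM.
  - move=> [a la [q _ e]]; pose n := size q.
    pose p : {poly k} := 'X^n - \sum_(j < n) q`_j *: 'X^(n - j.+1).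
    apply: (H p).
      apply/eqP => /(congr1 (fun r : {poly k} => r`_n)); rewrite coef0 coefB coefXn eqxx.
      rewrite coef_sum big1 ?subr0 => [/eqP|j _]; first by rewrite oner_eq0.
      rewrite coefZ coefXn (_ : n == _ = false) ?mulr0 //; have := ltn_ord j.
      by apply: contraTF => /eqP; lia.
    have -> : ev cst y p = y ^+ n * a.
      have -> : a = 1 - ev cst y^-1 q / y by rewrite -e addrK.
      rewrite mulrBr mulr1 /p evD evN; congr (_ - _).
        by rewrite /ev map_polyXn hornerXn.
      rewrite ev_sum (ev_coef _ _ (leqnn _)) mulr_suml mulr_sumr; apply: eq_bigr => j _.
      rewrite -mul_polyC evM evC /ev map_polyXn hornerXn.
      rewrite -[in RHS](subnK (ltn_ord j)) exprD exprVn exprS.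
      by field; rewrite y0 expf_neq0.
    by apply: lmM => //; exact: lrX.
move=> O [J [pl Oc mJ Jy nO]].
have [i [P [ci Oci pP PE [lO lJ]]]] := place_center pl Oc.
have [i0 ni0] := chart_exists x; have ci0 := coord_neq0 pQ ni0.
have QP : incl (cp_ideal x) P.
  apply: (incl_homog pQ pP) => d F hF QF; apply/(PE _ _ hF).
  have -> : me F / c i ^+ d = (c i0 / c i) ^+ d * (me F / c i0 ^+ d).
    by rewrite expr_div_n; field; rewrite !expf_neq0.
  apply: (place_idM pl).
    by elim: (d) => [|n IH]; [rewrite expr0; exact: place1 pl|rewrite exprS; exact: (placeM pl)].
  by apply: mJ; apply/(lm_form pQ ni0 hF).
(* The centre lies in the closure of x, hence equals x, as x is closed. Its local ring contains y
   and is contained in O, although y is not in O. *)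
have PQ := (cp_closed x).2 _ pP QP.
apply: nO; apply: lO; case: ly => d [F [G [hF hG nG ->]]].
by exists d, F, G; split=> // /PQ.
Qed.

(** Transcendence of 1/f keeps 1 out of k[1/f]/f, so some place has f as a pole. Its centre is a
    closed point at which f is not regular. *)
Lemma transc_pole f : transc cst f -> exists x, ord x f < 0.
Proof.
move=> tf; have f0 := transc_neq0 tf.
have [] := @place_avoiding f [set 0] f0 erefl.
  apply: nonunital_polyP => //.
  - by move=> a b -> ->; rewrite subr0.
  - by move=> a b -> ->; rewrite mul0r.
  - by move=> a b ->; rewrite mulr0.
  - by move=> b ->; rewrite mulr0.
  - move=> [_ -> [q _]]; rewrite add0r => e.
    have nz : 1 - q * 'X != 0.
      apply/eqP => /(congr1 (fun p : {poly k} => p`_0)).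
      by rewrite coefB coefMX eqxx coef0 coef1 subr0 => /eqP; rewrite oner_eq0.
    by have := transc_ev (transcV f0 tf) nz; rewrite evD ev1 evN evM evX e subrr eqxx.
move=> O [J [pl Oc _ Jf nO]].
have [|x [lO _]] := place_closed_point pl Oc; first by move=> /(_ f).
exists x; rewrite ltNge; apply/negP => xf; apply: nO; apply: lO.
by apply/vge0_lr; right.
Qed.

(** * Algebraicity of the function field over k(z) *)

Definition ratfun (z : K) : set K :=
  [set f | exists p q, [/\ q != 0 & f = ev cst z p / ev cst z q]].

Section Ratfun.
Variable z : K.
Hypothesis tz : transc cst z.
Let F := ratfun z.
Let nz q : q != 0 -> ev cst z q != 0. Proof. exact: transc_ev. Qed.

Lemma ratfun_ev p : F (ev cst z p).
Proof. by exists p, 1; rewrite oner_neq0 ev1 divr1. Qed.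

Lemma ratfun_cst a : F (cst a). Proof. by rewrite -(evC cst z); exact: ratfun_ev. Qed.

Lemma ratfunB f g : F f -> F g -> F (f - g).
Proof.
move=> [p [q [q0 ->]]] [p' [q' [q'0 ->]]].
exists (p * q' - p' * q), (q * q'); split; first by rewrite mulf_neq0.
by rewrite evD evN !evM -mulNr addf_div ?nz // mulNr.
Qed.

Lemma ratfunD f g : F f -> F g -> F (f + g).
Proof.
move=> Ff Fg; rewrite -[g]opprK; apply: ratfunB => //; rewrite -sub0r.
by apply: ratfunB => //; rewrite -(rmorph0 cst); exact: ratfun_cst.
Qed.

Lemma ratfunM f g : F f -> F g -> F (f * g).
Proof.
move=> [p [q [q0 ->]]] [p' [q' [q'0 ->]]].
exists (p * p'), (q * q'); split; first by rewrite mulf_neq0.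
by rewrite !evM mulf_div.
Qed.

Lemma common_denominator n (f : nat -> K) : (forall j, F (f j)) ->
  exists r (p : nat -> {poly k}), r != 0 /\ forall j, (j < n)%N -> ev cst z r * f j = ev cst z (p j).
Proof.
move=> Ff; elim: n => [|n [r [p [r0 pE]]]]; first by exists 1, (fun=> 0); rewrite oner_neq0.
have [p' [q [q0 fE]]] := Ff n.
exists (r * q), (fun j => if j == n then r * p' else q * p j); split; first by rewrite mulf_neq0.
move=> j; rewrite ltnS leq_eqVlt; case: eqVneq => [-> _|_ /= jn].
  by rewrite !evM fE -mulrA; congr (_ * _); rewrite mulrC divfK // nz.
by rewrite !evM -mulrA mulrCA pE.
Qed.

(** If y were transcendental over k(z), a place trivial on k(z) would have y as a pole. At its
    centre z is regular with a residue algebraic over k, so some p(z) with p != 0 lies in J, whereas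
    the inverse of p(z) belongs to k(z), hence to O. *)
Lemma alg_over_transc (y : K) : alg_over cst z y.
Proof.
have [->|y0] := eqVneq y 0.
  exists 1%N, (fun j => (j == 1%N)%:R); split; first exact: oner_neq0.
  by rewrite big_ord_recl big_ord1 /= ev0 mul0r add0r mulr0.
apply: contrapT => nalg.
pose I : set K := [set q.[y^-1] / y | q in [set q : {poly K} | forall j, F q`_j]].
have F0 : F 0 by rewrite -(rmorph0 cst); exact: ratfun_cst.
have nuI : nonunital F I.
  split.
  - move=> _ _ [p Fp <-] [q Fq <-]; exists (p - q); last by rewrite hornerD hornerN mulrBl.
    by move=> j; rewrite coefB; exact: ratfunB.
  - move=> _ _ [p Fp <-] [q Fq <-]; exists (p * q * 'X); last by rewrite !hornerM hornerX; ring.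
    move=> j; rewrite coefMX; case: eqP => // _; rewrite coefM.
    by elim/big_ind: _ => // [f g|l _]; [exact: ratfunD|exact: ratfunM].
  - move=> f _ Ff [p Fp <-]; exists (f *: p); last by rewrite hornerZ mulrA.
    by move=> j; rewrite coefZ; exact: ratfunM.
  - move=> [q Fq e]; apply: nalg; pose n := size q.
    have [r [p [r0 pE]]] := common_denominator n Fq.
    exists n, (fun j => if j == n then r else - p (n - j.+1)%N); rewrite eqxx; split=> //.
    rewrite big_ord_recr /= eqxx.
    have yn : y ^+ n = \sum_(j < n) q`_(n - j.+1) * y ^+ j.
      rewrite -[LHS]mulr1 -e horner_coef mulr_suml mulr_sumr (reindex_inj rev_ord_inj) /=.
      apply: eq_bigr => j _; rewrite -/n; have jn := ltn_ord j.
      have -> : y ^+ n = y ^+ (n - j.+1) * y * y ^+ j by rewrite -exprSr -exprD addSnnS subnK.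
      by rewrite exprVn; field; rewrite y0 expf_neq0.
    rewrite yn mulr_sumr -big_split big1 //= => j _; rewrite ltn_eqF // evN mulrA pE; last first.
      by have := ltn_ord j; lia.
    by rewrite mulNr addNr.
have [|O [J [pl IJ FO]]] := exists_place _ nuI.
  by exists 0 => [j|]; rewrite ?coef0 // horner0 mul0r.
have Jy : J y^-1.
  apply: IJ; exists 1 => [j|]; last by rewrite hornerC mul1r.
  by rewrite coef1 -(rmorph_nat cst); exact: ratfun_cst.
have [x [lO lJ]] : exists x, lr x `<=` O /\ lm x `<=` J.
  apply: (place_closed_point pl); first by move=> a; apply: FO; exact: ratfun_cst.
  move=> /(_ y) Oy; apply: (place_id1 pl); rewrite -(divff y0); exact: (place_idM pl).
have Fz : F z by rewrite -[z](evX cst); exact: ratfun_ev.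
have lz : lr x z.
  apply/vge0_lr; have [xz|xz] := leP 0 (ord x z); [by right|exfalso].
  have z0 := transc_neq0 tz.
  apply: (place_id1 pl); rewrite -(divff z0); apply: (place_idM pl); first exact: FO.
  by apply: lJ; apply/vge1_lm; right; rewrite (valV ord_valuations) //; lia.
have [p p0 /lJ Jp] := residue_algebraic lz.
apply: (place_id1 pl); rewrite -(mulVf (nz p0)); apply: (place_idM pl) => //.
by apply: FO; exists 1, p; rewrite p0 ev1 mul1r.
Qed.

End Ratfun.

Lemma generated_chart : exists a : seq K, forall f, exists g h,
  [/\ gen_alg cst a g, gen_alg cst a h, h != 0 & f = g / h].
Proof.
have pX := hideal_point X.
have [i ni] := rp_relevant (@hideal_prime k X); have ci := coord_neq0 pX ni.
pose a := [seq c j / c i | j <- enum 'I_(adim X).+1]; exists a => f.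
have ga d F : F \is d.-homog -> gen_alg cst a (me F / c i ^+ d).
  have g1 : gen_alg cst a 1 by rewrite -(rmorph1 cst); exact: gen_cst.
  move=> /dhomogP hF; rewrite /mmap mulr_suml big_seq.
  elim/big_ind: _ => [||m mF]; first by rewrite -(rmorph0 cst); exact: gen_cst.
    exact: gen_add.
  rewrite -mulrA; apply: gen_mul; first exact: gen_cst.
  have -> : mmap1 c m / c i ^+ d = \prod_j (c j / c i) ^+ m j.
    have dE : mdeg m = d := hF _ mF.
    rewrite /mmap1 -dE mdegE -prodrXr -prodf_div.
    by apply: eq_bigr => j _; rewrite expr_div_n.
  elim/big_ind: _ => // [|j _]; first exact: gen_mul.
  elim: (m j) => [|n IH]; rewrite ?expr0 // exprS; apply: gen_mul => //.
  by apply: gen_mem; apply/mapP; exists j; rewrite ?mem_enum.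
have [d [F [G [hF hG nG ->]]]] := Rat_frac f.
exists (me F / c i ^+ d), (me G / c i ^+ d); split; [exact: ga|exact: ga| |exact: divr_div_pow].
by rewrite mulf_neq0 ?(me_neq0 pX hG nG) ?invr_eq0 ?expf_neq0.
Qed.

Theorem ord_complete : complete_valuations cst ord.
Proof.
split; [exact: ord_valuations|exact: transc_pole|].
move=> z tz; have [a ga] := generated_chart.
by apply: (zindep_bounded tz _ ga) => y _; exact: alg_over_transc.
Qed.

(** Elements independent modulo the maximal ideal at x are independent over k[w] for a uniformizer
    w, so their number is bounded. This shows that [residue_degree] is not the default value of its
    choice. *)
Theorem residue_degreeP x : exists e : 'I_(residue_degree x) -> K, residue_basis cst ord x e.
Proof.
have vP := ord_complete; have vP0 := cval vP.
have [w w0 w1] := val_unif vP0 x.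
have tw : transc cst w by apply: (val_transc vP0 (x := x)); rewrite w1.
have [N NP] := cval_finite vP tw.
have [|m u Vu iu|r [e [Ve eP]]] := @exists_quotient_basis _ _ cst (vge ord x 0) (vge ord x 1) N
  (vge_lin vP0 x 0) (vge_lin vP0 x 1).
- by move=> f; apply: vge_le.
- apply: (NP m u); apply: (@reg_zindep _ _ _ _ _ vP0 _ [:: x]) => //.
  + by move=> y; rewrite inE => /eqP->; rewrite w1.
  + by move=> i y; rewrite inE => /eqP->.
  + by move=> d /(_ x (mem_head _ _)); rewrite w1; exact: iu.
rewrite /residue_degree; case: xgetP => [r' _ [e' [le' eP']]|/(_ r)[]].
  exists e'; split=> [i|f]; first exact/vge0_lr.
  move=> /vge0_lr/eP'[d [d1 du]]; exists d; split; first exact/vge1_lm.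
  by move=> d' /vge1_lm; exact: du.
exists e; split=> [i|f]; first exact/vge0_lr.
move=> /vge0_lr/eP[d [d1 du]]; exists d; split; first exact/vge1_lm.
by move=> d' /vge1_lm; exact: du.
Qed.

End RegularCurve.

End CurveValuations.
Import CurveValuations.

From mathcomp Require Import all_reals all_analysis.
Import numFieldNormedType.Exports.

(** * Real divisors *)

Section RealDivisors.
Variables (R : realType) (k : fieldType) (X : regular_projective_curve k).
Local Notation K := (ProjectiveGeometry.Rat X).
Local Notation cst := (@Rat_const k X).
Local Notation P := (closed_point X).
Local Notation ord := (@ord k X).
Local Notation pdiv := (@Defs.pdiv k X R).
Implicit Types (D E : P -> R) (s : seq P) (x : P) (f : K).

Definition dgr x : R := (residue_degree x)%:R.

Lemma dgr_gt0 x : 0 < dgr x.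
Proof.
rewrite ltr0n; apply: (@residue_degree_gt0 _ _ cst _ ord); first exact: ord_valuations.
exact: residue_degreeP.
Qed.

Definition supported D s := uniq s /\ forall x, x \notin s -> D x = 0.

Lemma Rdivisor_supported D : Rdivisor D -> exists s, supported D s.
Proof.
move=> /finite_seqP[s sE]; exists (undup s); split; first exact: undup_uniq.
move=> x; rewrite mem_undup => xs; apply/eqP; apply: contraNT xs => Dx.
by have : [set x | D x != 0] x by []; rewrite sE.
Qed.

Lemma supported_Rdivisor D s : supported D s -> Rdivisor D.
Proof.
move=> [us Ds]; apply: (@sub_finite_set _ _ [set` s]); last by apply/finite_seqP; exists s.
by move=> x /= Dx; apply: contraNT Dx => /Ds ->.
Qed.

Lemma supported_sum D s t : supported D s -> supported D t ->
  \sum_(x <- s) D x * dgr x = \sum_(x <- t) D x * dgr x.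
Proof.
move=> [us Ds] [ut Dt]; apply: sum_support => // x; apply: contraNT.
  by move=> /Ds ->; rewrite mul0r.
by move=> /Dt ->; rewrite mul0r.
Qed.

Lemma supportedW D s t : supported D s -> uniq t -> {subset s <= t} -> supported D t.
Proof. by move=> [us Ds] ut st; split=> // x xt; apply: Ds; apply: contra xt; exact: st. Qed.

Lemma pdiv_deg0 f : f != 0 -> exists s, supported (pdiv f) s /\
  \sum_(x <- s) pdiv f x * dgr x = 0.
Proof.
move=> f0; have [s [us sP]] := val_support (ord_complete X) (@residue_degreeP _ X) f0.
exists s; split.
  by split=> // x xs; rewrite /Defs.pdiv; apply/eqP; apply: contraNT xs; rewrite intr_eq0 => /sP.
have := degree_eq0 (ord_complete X) (@residue_degreeP _ X) f0 us (fun x => (sP x).2).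
move=> /(congr1 (fun n : int => n%:~R : R)); rewrite rmorph_sum rmorph0 => H.
by rewrite -[RHS]H; apply: eq_bigr => x _; rewrite rmorphM.
Qed.

Lemma pdivR_deg0 (r : RatR X R) : exists s, supported (pdivR r) s /\
  \sum_(x <- s) pdivR r x * dgr x = 0.
Proof.
elim: r => [|[a f] r [s [sr r0]]].
  by exists [::]; rewrite big_nil; split=> //; split=> // x _; rewrite /pdivR big_nil.
have [t [tf f0]] := pdiv_deg0 (valP f).
pose q := undup (s ++ t); have uq : uniq q by exact: undup_uniq.
have sq : supported (pdivR r) q.
  by apply: (supportedW sr) => // x xs; rewrite mem_undup mem_cat xs.
have tq : supported (pdiv (val f)) q.
  by apply: (supportedW tf) => // x xs; rewrite mem_undup mem_cat xs orbT.
have E x : pdivR ((a, f) :: r) x = a * pdiv (val f) x + pdivR r x.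
  by rewrite /pdivR big_cons.
exists q; split; first by split=> // x xq; rewrite E sq.2 // tq.2 // mulr0 addr0.
under eq_bigr => x _ do rewrite E mulrDl -mulrA.
rewrite big_split /= -mulr_sumr (supported_sum tq tf) (supported_sum sq sr).
by rewrite f0 r0 mulr0 addr0.
Qed.

Lemma H0_ord D f : f != 0 -> H0 D f -> forall x, 0 <= (ord x f)%:~R + D x.
Proof. by move=> f0 [/eqP|[_ h]]; [rewrite (negPf f0)|exact: h]. Qed.

Lemma dim_H0_large E s : supported E s -> 0 < \sum_(x <- s) E x * dgr x ->
  exists (e : R) (N : nat), 0 < e /\ forall n : nat, (N <= n)%N -> exists r : nat,
    e * n%:R <= r%:R /\ dim_ge cst (H0 (fun x => n%:R * E x)) r.
Proof.
move=> [us Es]; set d := \sum_(x <- s) _ => d0.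
have [x0] := closed_point_exists X.
have [c cP] := riemann_inequality (ord_complete X) (@residue_degreeP _ X) x0.
pose T : R := \sum_(x <- s) dgr x.
have T0 : 0 <= T by apply: sumr_ge0 => x _; exact/ltW/dgr_gt0.
(* Rounding n E down loses at most T in degree, so Riemann's inequality leaves n d - T - c sections.
   This is at least n d / 2 once n > 2 (T + c) / d. *)
exists (d / 2), (Num.truncn (2 * (T + c%:R) / d)).+1; split; first by rewrite divr_gt0.
move=> n nN; pose F x := Num.floor (n%:R * E x).
have h1 : n%:R * d - T <= (\sum_(x <- s) F x * (residue_degree x)%:Z)%:~R.
  rewrite rmorph_sum /d mulr_sumr -sumrB; apply: ler_sum => x _.
  rewrite rmorphM /= -/(dgr x) mulrA -[X in _ - X]mul1r -mulrBl.
  apply: ler_wpM2r; first exact/ltW/dgr_gt0.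
  by rewrite lerBlDr ltW // -[1]/(1%:~R) -intrD floorD1_gt.
have h2 : d / 2 * n%:R <= n%:R * d - T - c%:R.
  have : 2 * (T + c%:R) / d < n%:R.
    apply: lt_le_trans (truncnS_gt _) _; by rewrite ler_nat.
  by rewrite ltr_pdivrMr //; lra.
set S := \sum_(x <- s) F x * _ in h1 *.
have S0 : 0 <= S - c%:Z.
  rewrite -(ler_int R) rmorphB /=; apply: le_trans (_ : d / 2 * n%:R <= _).
    by rewrite mulr_ge0 // ltW // divr_gt0.
  by move: h1 h2; rewrite -/(c%:R : R); lra.
exists `|S - c%:Z|%N; split.
  rewrite natr_absz ger0_norm ?ler0z // rmorphB /=.
  by move: h1 h2; lra.
apply: dim_ge_sub (cP s F _ us _ _) => [f LF|x xs|].
- have [->|f0] := eqVneq f 0; [by left|right; split=> // x].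
  have := vge_nz f0 (LF x); rewrite -(ler_int R) rmorphN /= => h.
  by rewrite -lerBlDr sub0r; apply: le_trans h; rewrite lerN2 floor_le.
- by rewrite /F Es // mulr0 floor0.
- by rewrite gez0_abs // subrK.
Qed.

(** A non-zero section f makes (f) + E effective of degree at most 0, so E = -(f). Division by f
    then embeds the sections into L(0), whose dimension is at most the degree of a fixed point; the
    bound is thus uniform in E. *)
Lemma dim_H0_small : exists c : nat, forall E s m, supported E s ->
  \sum_(x <- s) E x * dgr x <= 0 -> dim_ge cst (H0 E) m -> (m <= c)%N.
Proof.
have [x0] := closed_point_exists X; exists (residue_degree x0) => E s m sE dE.
case: m => // m dm; have [f f0 Hf] := dim_ge_gt0 (ltn0Sn m) dm.
have [t [tf f_deg]] := pdiv_deg0 f0.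
pose q := undup (s ++ t); have uq : uniq q by exact: undup_uniq.
have sq : supported E q.
  by apply: (supportedW sE) => // x xs; rewrite mem_undup mem_cat xs.
have tq : supported (pdiv f) q.
  by apply: (supportedW tf) => // x xs; rewrite mem_undup mem_cat xs orbT.
have ge0 x : 0 <= pdiv f x + E x by exact: H0_ord.
have fE x : pdiv f x = - E x.
  apply/eqP; rewrite -addr_eq0; have [xq|xq] := boolP (x \in q); last first.
    by rewrite sq.2 // tq.2 // addr0.
  have S0 : \sum_(x <- q) (pdiv f x + E x) * dgr x <= 0.
    under eq_bigr => y _ do rewrite mulrDl.
    by rewrite big_split /= (supported_sum tq tf) f_deg add0r (supported_sum sq sE).
  have p0 y : 0 <= (pdiv f y + E y) * dgr y by rewrite mulr_ge0 // ltW // dgr_gt0.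
  have : (pdiv f x + E x) * dgr x <= 0.
    apply: le_trans S0; rewrite (bigD1_seq x) //= lerDl.
    by apply: sumr_ge0.
  by rewrite pmulr_lle0 ?dgr_gt0 // => h; rewrite eq_le h ge0.
apply: (dim_sections0 (ord_complete X) (@residue_degreeP _ X)).
have d2 : dim_ge cst (sections ord (fun x => - ord x f)) m.+1.
  apply: dim_ge_sub dm => g Hg x; have [->|g0] := eqVneq g 0; first by left.
  right; have := H0_ord g0 Hg x; rewrite opprK -[E x]opprK -fE /Defs.pdiv -rmorphB /=.
  by rewrite ler0z subr_ge0.
have := dim_ge_mul (ord_complete X) f0 d2.
by rewrite (@eq_sections _ _ _ _ (fun=> 0)) // => x; rewrite addNr.
Qed.

(** Some multiple n E has a non-zero section f, and the real coefficient 1/n may be put in front of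
    (f). *)
Lemma effective_representative E s : supported E s -> 0 < \sum_(x <- s) E x * dgr x ->
  exists r : RatR X R, forall x, 0 <= E x + pdivR r x.
Proof.
move=> sE /(dim_H0_large sE)[e [N [e0 H]]].
have [|r [er dr]] := H (N + 1)%N; first by rewrite leq_addr.
have r0 : (0 < r)%N.
  by rewrite -(ltr_nat R); apply: lt_le_trans er; rewrite mulr_gt0 // ltr0n addn1.
have [f f0 Hf] := dim_ge_gt0 r0 dr.
exists [:: ((N + 1)%:R^-1, exist _ f f0)] => x; rewrite /pdivR big_seq1 /= /Defs.pdiv.
have n0 : 0 < (N + 1)%:R :> R by rewrite ltr0n addn1.
have := H0_ord f0 Hf x; rewrite addrC.
by rewrite -[in X in _ -> X](pmulr_rge0 _ n0) mulrDr mulrA divff ?gt_eqF // mul1r.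
Qed.

End RealDivisors.

(** * Green functions *)

Section BerkovichTopology.
Variables (R : realType) (k : fieldType) (X : regular_projective_curve k).
Local Notation Xan := (berkovich R X).
Local Notation P := (closed_point X).
Implicit Types (D : P -> R) (x : P) (phi : Xan -> R) (g : Xan -> \bar R).

Lemma xi0 x : xi x 0%E = eta0 :> Xan.
Proof. by rewrite /xi insubN // ltxx. Qed.

Lemma xi_gt0 x (t : \bar R) (t0 : (0 < t)%E) : xi x t = branch x (exist _ t t0).
Proof. by rewrite /xi insubT. Qed.

Lemma xi_branch x (u : {t : \bar R | (0 < t)%E}) : branch x u = xi x (val u).
Proof. by rewrite /xi valK. Qed.

Lemma canonical_green_xi D x (t : \bar R) : (0 <= t)%E ->
  canonical_green D (xi x t) = ((D x)%:E * t)%E.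
Proof.
rewrite le_eqVlt => /orP[/eqP<-|t0]; first by rewrite xi0 mule0.
by rewrite xi_gt0.
Qed.

Lemma xi_nbhs x (t : \bar R) (U : set Xan) : (0 <= t)%E -> nbhs (xi x t) U ->
  exists2 W : set (\bar R), nbhs t W & forall s, (0 <= s)%E -> W s -> U (xi x s).
Proof.
move=> t0; rewrite nbhsE => -[V [oV Vt] VU].
have [W oW WV] := (open_subspaceP _ _).1 (oV.1 x).
exists W; first by apply: open_nbhs_nbhs; split=> //; have [] : (W `&` @segment R) t by rewrite WV.
by move=> s s0 Ws; apply: VU; have [] : (xi x @^-1` V `&` @segment R) s by rewrite -WV.
Qed.

Lemma eta0_nbhs (U : set Xan) : nbhs eta0 U ->
  finite_set [set x | ~ forall t : \bar R, (0 <= t)%E -> U (xi x t)].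
Proof.
rewrite nbhsE => -[V [oV V0] VU]; apply: sub_finite_set (oV.2 V0) => x /= nU nV.
by apply: nU => t t0; apply: VU; apply: nV; exists t.
Qed.

Lemma xi_cvg_leaf x : xi x t%:E @[t --> +oo%R] --> (xi x +oo%E : Xan).
Proof.
move=> U /(@xi_nbhs x _ U (leey _))[W [M [Mr MW]] WU].
rewrite nbhs_simpl /=; near=> t; apply: WU; first by rewrite lee_fin; near: t; exact: nbhs_pinfty_ge.
by apply: MW; rewrite lte_fin; near: t; exact: nbhs_pinfty_gt.
Unshelve. all: by end_near. Qed.

Lemma xi_cvg_root x : xi x t%:E @[t --> 0^'+] --> (eta0 : Xan).
Proof.
rewrite -(xi0 x) => U /(@xi_nbhs x _ U (lexx _))[W W0 WU].
rewrite nbhs_simpl /=; near=> t; apply: WU; first by rewrite lee_fin; near: t; exact: nbhs_right_ge.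
by near: t; apply: cvg_at_right_filter W0; exact: cvg_id.
Unshelve. all: by end_near. Qed.

(** Normal form of a Green function. Infinite values come from [canonical_green] alone, so sums and
    multiples act on phi and D separately. *)
Definition nform phi D : Xan -> \bar R := fun p => ((phi p)%:E + canonical_green D p)%E.

Lemma nform_xi phi D x (t : R) : 0 <= t -> nform phi D (xi x t%:E) = (phi (xi x t%:E) + D x * t)%:E.
Proof. by move=> t0; rewrite /nform canonical_green_xi ?lee_fin // EFinD EFinM. Qed.

Lemma nform_root phi D : nform phi D eta0 = (phi eta0)%:E.
Proof. by rewrite /nform /= adde0. Qed.

Lemma cvg_EFin_pinfty : (fun t : R => t%:E) @ +oo%R --> (+oo%E : \bar R).
Proof. by apply/cvgeryP; exact: cvg_id. Qed.

Lemma nform_cvg_leaf phi D x : continuous phi ->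
  nform phi D (xi x t%:E) @[t --> +oo%R] --> nform phi D (xi x +oo%E).
Proof.
move=> cphi; rewrite /nform canonical_green_xi ?leey //.
apply: cvgeD => //.
  apply: cvg_EFin; first by near=> t.
  by apply: (cvg_comp _ _ (@xi_cvg_leaf x)); exact: cphi.
have : ((D x)%:E * t%:E)%E @[t --> +oo%R] --> ((D x)%:E * +oo)%E.
  by apply: cvgeZl => //; exact: cvg_EFin_pinfty.
apply: cvg_trans; apply: near_eq_cvg; near=> t.
by rewrite canonical_green_xi // lee_fin; near: t; exact: nbhs_pinfty_ge.
Unshelve. all: by end_near. Qed.

Lemma canonical_green_continuous D : Rdivisor D -> continuous (canonical_green D : Xan -> \bar R).
Proof.
move=> fD; apply/continuousP => A oA; split=> [x|A0].
  apply/open_subspaceP; exists ( *%E (D x)%:E @^-1` A).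
    by move/continuousP: (@mule_continuous R (D x)); exact.
  apply/seteqP; split=> t /= [At t0]; split=> //.
    by rewrite canonical_green_xi.
  by move: At; rewrite canonical_green_xi.
apply: sub_finite_set fD => x /= nA; apply/eqP => Dx0; apply: nA => _ [t t0 <-] /=.
by rewrite canonical_green_xi // Dx0 mul0e.
Qed.

Lemma nform_green phi D : continuous phi -> Rdivisor D -> green D (nform phi D).
Proof.
move=> cphi fD; split.
  move=> p.
  have h1 : (phi q)%:E @[q --> p] --> (phi p)%:E.
    have hE : r%:E @[r --> phi p] --> (phi p)%:E.
      by apply: cvg_EFin; [near=> r|exact: cvg_id].
    exact: (cvg_comp _ _ (cphi p) hE).
  have h2 := @canonical_green_continuous D fD p.
  have hd : ((phi p)%:E +? canonical_green D p)%E by [].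
  exact: (cvgeD hd h1 h2).
exists phi; split=> // x t t0.
by rewrite nform_xi // EFinD addeK.
Unshelve. all: by end_near. Qed.

(** The two sides agree at finite parameters by definition of a Green function, and at a leaf both
    are limits of these values. *)
Lemma green_nform D g : green D g -> exists2 phi, continuous phi & g = nform phi D.
Proof.
move=> [cg [phi [cphi gE]]]; exists phi => //; apply/funext => p.
have fin x (t : R) : 0 <= t -> g (xi x t%:E) = nform phi D (xi x t%:E).
  move=> t0; have := gE x t t0; rewrite nform_xi //.
  by case: (g _) => [r| |] //= [->]; rewrite subrK.
case: p => [|x [t t0]].
  have [x] := closed_point_exists X.
  by rewrite -(xi0 x); exact: fin.
rewrite xi_branch /=; case: t t0 => [t| |] t0 //.
  by apply: fin; rewrite ltW // -lte_fin.
have h1 := cvg_comp _ _ (@xi_cvg_leaf x) (cg _).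
apply: (cvg_unique (@ereal_hausdorff R) h1).
apply: cvg_trans (@nform_cvg_leaf phi D x cphi).
by apply: near_eq_cvg; near=> s; rewrite /= fin //; near: s; exact: nbhs_pinfty_ge.
Unshelve. all: by end_near. Qed.

Lemma canonical_green_nform D : canonical_green D = nform (fun=> 0) D.
Proof. by apply/funext => p; rewrite /nform add0e. Qed.

Lemma green_add_nform phi1 phi2 D1 D2 : continuous phi1 -> continuous phi2 ->
  green_add (nform phi1 D1) (nform phi2 D2) = nform (phi1 \+ phi2) (D1 \+ D2).
Proof.
move=> c1 c2; apply/funext => -[|x [t t0]].
  by rewrite /green_add !nform_root.
have c12 : continuous (phi1 \+ phi2) by move=> p; exact: (cvgD (c1 p) (c2 p)).
rewrite {1}/green_add /=; case: t t0 => [t| |] t0 //=.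
  have t0' : 0 <= t by rewrite ltW // -lte_fin.
  by rewrite !xi_branch /= !nform_xi // -EFinD; congr (_%:E) => /=; ring.
rewrite xi_branch /=; apply/cvg_lim; first exact: ereal_hausdorff.
apply: cvg_trans (nform_cvg_leaf (x := x) (D := D1 \+ D2) c12).
apply: near_eq_cvg; near=> s.
have s0 : 0 <= s by near: s; exact: nbhs_pinfty_ge.
by rewrite !nform_xi // -EFinD; congr (_%:E) => /=; ring.
Unshelve. all: by end_near. Qed.

Lemma green_scale_nform n phi D :
  green_scale n (nform phi D) = nform (fun p => n%:R * phi p) (fun x => n%:R * D x).
Proof.
apply/funext => p; rewrite /green_scale /nform muleDr // EFinM; congr (_ + _)%E.
case: p => [|x t] /=; first by rewrite mule0.
by rewrite muleA -EFinM.
Qed.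

Lemma nform_ge phi D (c : \bar R) : continuous phi ->
  (forall x (t : R), 0 <= t -> (c <= nform phi D (xi x t%:E))%E) -> forall p, (c <= nform phi D p)%E.
Proof.
move=> cphi h [|x [t t0]].
  by have [x] := closed_point_exists X; rewrite -(xi0 x); exact: h.
rewrite xi_branch /=; case: t t0 => [t| |] t0 //.
  by apply: h; rewrite ltW // -lte_fin.
apply: cvge_ge (nform_cvg_leaf (x := x) (D := D) cphi).
by near=> s; apply: h; near: s; exact: nbhs_pinfty_ge.
Unshelve. all: by end_near. Qed.

Lemma leaf_bounded phi x : continuous phi ->
  exists M C : R, forall t : R, M < t -> `|phi (xi x t%:E)| <= C.
Proof.
move=> cphi; have := cvg_comp _ _ (@xi_cvg_leaf x) (cphi _).
move=> /cvgrPdist_le /(_ 1 ltr01) [M [_ MP]].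
exists M, (`|phi (xi x +oo%E)| + 1) => t Mt; have := MP t Mt => /= h.
rewrite -[X in `|X|](subrK (phi (xi x +oo%E))) addrC; apply: le_trans (ler_normD _ _) _.
by rewrite lerD2l distrC.
Qed.

(** As phi is bounded near the leaf, only the slopes count for large t; the chosen t lies beyond the
    region M and beyond the crossing point (C - a) / (e - D x). *)
Lemma slope_le phi D x (a e : R) : continuous phi ->
  (forall t : R, 0 < t -> a + e * t <= phi (xi x t%:E) + D x * t) -> e <= D x.
Proof.
move=> cphi h; have [M [C MC]] := leaf_bounded x cphi.
rewrite leNgt; apply/negP => lt.
pose t := Num.max 1 (Num.max (M + 1) ((C - a) / (e - D x) + 1)).
have t1 : 1 <= t by rewrite le_max lexx.
have tM : M < t by apply: lt_le_trans (_ : M + 1 <= _); rewrite ?ltrDl // !le_max lexx orbT.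
have tC : (C - a) / (e - D x) < t.
  by apply: lt_le_trans (_ : (C - a) / (e - D x) + 1 <= _); rewrite ?ltrDl // !le_max lexx !orbT.
have := h t (lt_le_trans ltr01 t1); have := MC t tM; have := ler_norm (phi (xi x t%:E)).
move: tC; rewrite ltr_pdivrMr ?subr_gt0 //; lra.
Qed.

End BerkovichTopology.

(** * Bigness *)

Section LimSup.
Variables (R : realType) (u : (\bar R)^nat).

Lemma limn_esup_inf : limn_esup u = ereal_inf (range (esups u)).
Proof. by rewrite limn_esup_lim; apply/cvg_lim => //; exact: cvg_esups_inf. Qed.

Lemma limn_esup_ge (c : \bar R) N : (forall n, (N <= n)%N -> (c <= u n)%E) -> (c <= limn_esup u)%E.
Proof.
move=> h; rewrite limn_esup_inf; apply: le_ereal_inf_tmp => _ [n _ <-].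
apply: le_trans (h (maxn n N) (leq_maxr _ _)) _.
by apply: ereal_sup_ubound; exists (maxn n N) => //=; rewrite leq_maxl.
Qed.

Lemma limn_esup_le0 (a : R) : (forall n, (0 < n)%N -> (u n <= (a / n%:R)%:E)%E) ->
  (limn_esup u <= 0)%E.
Proof.
move=> h; rewrite limn_esup_inf; apply/lee_addgt0Pr => e e0; rewrite add0e.
pose N := (Num.truncn (`|a| / e)).+1.
apply: le_trans (_ : esups u N <= _)%E; first by apply: ereal_inf_lbound; exists N.
apply: ge_ereal_sup => _ [n /= Nn <-]; have n0 : (0 < n)%N by exact: leq_trans Nn.
apply: le_trans (h n n0) _; rewrite lee_fin ler_pdivrMr ?ltr0n //.
apply: le_trans (ler_norm _) _; rewrite mulrC -ler_pdivrMr //.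
apply: le_trans (ltW (truncnS_gt _)) _; by rewrite ler_nat.
Qed.

End LimSup.

Section Bigness.
Variables (R : realType) (k : fieldType) (X : regular_projective_curve k).
Local Notation Xan := (berkovich R X).
Local Notation P := (closed_point X).
Local Notation K := (ProjectiveGeometry.Rat X).
Local Notation cst := (@Rat_const k X).
Local Notation ord := (@ord k X).
Local Notation pdiv := (@Defs.pdiv k X R).
Local Notation dgr := (dgr R).
Implicit Types (D E : P -> R) (x : P) (phi : Xan -> R) (g : Xan -> \bar R) (f : K).

Lemma scale_continuous n phi : continuous phi -> continuous (fun p => n%:R * phi p : R).
Proof. by move=> cphi p; exact: (cvgM (cvg_cst _) (cphi p)). Qed.

Section Norm.
Variables (phi : Xan -> R) (D : P -> R) (n : nat).
Hypothesis cphi : continuous phi.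
Local Notation N := (green_norm (green_scale n (nform phi D))).
Local Notation height f x t := (n%:R * (phi (xi x t%:E) + D x * t) + (ord x f)%:~R * t).
(** The maximum with 0 also covers an infimum equal to -oo, where [fine] returns 0 and the norm
    becomes 1. *)
Let C := Num.max 0 (phi eta0).

Lemma norm_form f : f != 0 -> exists psi M, [/\ continuous psi,
  N f = expR (- fine (ereal_inf (range (nform psi M)))), psi eta0 = n%:R * phi eta0 &
  forall x t, 0 <= t -> nform psi M (xi x t%:E) = (height f x t)%:E].
Proof.
move=> f0; rewrite /green_norm (negPf f0) green_scale_nform canonical_green_nform.
have cn := @scale_continuous n _ cphi.
have c0 : continuous ((fun=> 0) : Xan -> R) by exact: cst_continuous.
rewrite (green_add_nform _ _ c0 cn).
eexists _, _; split; [|reflexivity|by rewrite /= add0r|].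
  by move=> p; exact: (cvgD (cvg_cst _) (cn p)).
by move=> x t t0; rewrite nform_xi //=; congr (_%:E); rewrite /Defs.pdiv; ring.
Qed.

Lemma norm_le f (c : R) : f != 0 ->
  (forall x t, 0 <= t -> c <= height f x t) -> N f <= expR (- c).
Proof.
move=> f0 h; have [psi [M [cpsi -> _ psiE]]] := norm_form f0.
have ge : (c%:E <= ereal_inf (range (nform psi M)))%E.
  apply: le_ereal_inf_tmp => _ [p _ <-]; apply: nform_ge => // x t t0.
  by rewrite psiE // lee_fin; exact: h.
(* The value at the root rules out an infimum of +oo, which [fine] would turn into 0. *)
have : (ereal_inf (range (nform psi M)) <= (psi eta0)%:E)%E.
  by apply: ereal_inf_lbound; exists eta0; rewrite ?nform_root.
move: ge; case: (ereal_inf _) => [r| |] //=.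
by rewrite lee_fin ler_expR lerN2.
Qed.

Lemma norm_ge f : f != 0 -> expR (- (n%:R * C)) <= N f.
Proof.
move=> f0; have [psi [M [cpsi -> psi0 _]]] := norm_form f0.
have : (ereal_inf (range (nform psi M)) <= (psi eta0)%:E)%E.
  by apply: ereal_inf_lbound; exists eta0; rewrite ?nform_root.
have nC : 0 <= n%:R * C by rewrite mulr_ge0 // le_max lexx.
rewrite psi0; case: (ereal_inf _) => [r| |] //=; rewrite ?lee_fin => h; rewrite ler_expR lerN2 //.
by apply: le_trans h _; rewrite ler_wpM2l // le_max lexx orbT.
Qed.

Lemma norm_lt1 f : f != 0 -> N f < 1 -> exists2 r : R, 0 < r &
  forall x t, 0 <= t -> r <= height f x t.
Proof.
move=> f0; have [psi [M [cpsi -> _ psiE]]] := norm_form f0.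
have lb x t : 0 <= t -> (ereal_inf (range (nform psi M)) <= (height f x t)%:E)%E.
  by move=> t0; rewrite -psiE //; apply: ereal_inf_lbound; exists (xi x t%:E).
rewrite -[X in _ < X -> _]expR0 ltr_expR oppr_lt0; move: lb; case: (ereal_inf _) => [r| |] //= h r0.
- by exists r => // x t t0; have := h x t t0; rewrite lee_fin.
- by rewrite ltxx in r0.
- by rewrite ltxx in r0.
Qed.

End Norm.

Definition positive_below phi D := exists (r : R) E s, [/\ 0 < r, supported E s,
  0 < \sum_(x <- s) E x * dgr x &
  forall x t, 0 <= t -> r + E x * t <= phi (xi x t%:E) + D x * t].

Section DetNorm.
Variables (N : K -> R) (r : nat) (e : 'I_r -> K).

Lemma det_norm_le : (forall f, 0 <= N f) -> det_norm N e <= \prod_i N (e i).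
Proof.
move=> N0; apply: ge_inf.
  by exists 0 => _ [A _ <-]; apply: prodr_ge0 => i _.
exists 1%:M; first exact: det1.
apply: eq_bigr => i _; rewrite (bigD1 i) //= mxE eqxx rmorph1 mul1r big1 ?addr0 // => j ji.
by rewrite mxE eq_sym (negPf ji) rmorph0 mul0r.
Qed.

Lemma det_norm_ge (L : R) : indep_mod cst [set 0] e ->
  (forall s : 'I_r -> K, indep_mod cst [set 0] s ->
    (forall i, exists c, s i = lcomb cst c e) -> L <= \prod_i N (s i)) ->
  L <= det_norm N e.
Proof.
move=> ie h; apply: lb_le_inf.
  by exists (\prod_i N (\sum_j cst ((1%:M : 'M[k]_r) i j) * e j)), 1%:M; rewrite /= ?det1.
move=> _ [A /= dA <-].
have sE i : \sum_j cst (A i j) * e j = lcomb cst (row i A) e.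
  by apply: eq_bigr => j _; rewrite mxE.
under eq_bigr => i _ do rewrite sE; apply: h; last by move=> i; exists (row i A).
by apply: indep_mod_mul => //; rewrite row_free_unit unitmxE dA unitr1.
Qed.

End DetNorm.

Lemma indep_subfamily m r (u : 'I_r -> K) (h : 'I_m -> 'I_r) : injective h ->
  indep_mod cst [set 0] u -> indep_mod cst [set 0] (u \o h).
Proof.
move=> hi iu; have fB : row_free (\matrix_i (delta_mx 0 (h i) : 'rV[k]_r)).
  apply/row_freeP; exists (\matrix_(j, i) (h i == j)%:R).
  apply/matrixP => i j; rewrite !mxE (bigD1 (h i)) //= !mxE !eqxx mul1r big1 ?addr0.
    by rewrite (inj_eq hi) eq_sym.
  by move=> l li; rewrite !mxE (negPf li) andbF mul0r.
have := indep_mod_mul fB iu; move=> H c Hc; apply: H; rewrite /= -[RHS]Hc.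
apply: eq_lcomb => i; rewrite /lcomb (bigD1 (h i)) //= rowK mxE !eqxx rmorph1 mul1r big1 ?addr0 //.
by move=> j ji; rewrite mxE (negPf ji) andbF rmorph0 mul0r.
Qed.

Lemma big_nform phi D : continuous phi -> positive_below phi D -> big D (nform phi D).
Proof.
move=> cphi [rho [E [s [rho0 sE degE below]]]].
have [e [N [e0 large]]] := dim_H0_large sE degE.
have ED x : E x <= D x by apply: (slope_le (x := x) (a := rho) cphi) => t t0; apply: below; exact: ltW.
(* At least e n sections of norm at most exp(-n rho) give degree at least e rho n^2; division by n^2
   / 2 yields this constant. *)
rewrite /big; apply: lt_le_trans (_ : (2 * (e * rho))%:E <= _)%E.
  by rewrite lte_fin !mulr_gt0.
apply: (@limn_esup_ge _ _ _ N.+1) => n Nn; have n0 : (0 < n)%N by exact: leq_trans Nn.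
have n0R : 0 < n%:R :> R by rewrite ltr0n.
have [r [er [u [Hu iu]]]] := large n (ltnW Nn).
set NN := green_norm _; have u0 i := indep_neq0 i iu.
have NN0 f : 0 <= NN f by rewrite /NN /green_norm; case: ifP => // _; exact: expR_ge0.
pose F := [set lcomb cst c u | c in [set: 'rV[k]_r]].
have HD : F `<=` H0 (fun x => n%:R * D x).
  move=> _ [c _ <-]; have [->|f0] := eqVneq (lcomb cst c u) 0; [by left|right; split=> // x].
  (* Orders are integers, so membership in H^0(nE) can be tested against the floor of n E, which is
     a condition stable under linear combinations. *)
  have : vge ord x (- Num.floor (n%:R * E x)) (lcomb cst c u).
    apply: lin_subset_lcomb; first exact: vge_lin (ord_valuations X) _ _.
    move=> i; right; have := H0_ord (u0 i) (Hu i) x => h.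
    have : - (ord x (u i)) <= Num.floor (n%:R * E x).
      by rewrite floor_ge_int rmorphN /= -subr_ge0 opprK addrC.
    by lia.
  move=> /(vge_nz f0); rewrite -(ler_int R) rmorphN /= => h.
  rewrite /Defs.pdiv; have := floor_le (n%:R * E x).
  have : n%:R * E x <= n%:R * D x by rewrite ler_pM2l.
  by lra.
have bF : is_basis F u.
  split=> [i|_ [c _ <-]].
    exists (delta_mx 0 i) => //; rewrite /lcomb (bigD1 i) //= mxE !eqxx rmorph1 mul1r.
    by rewrite big1 ?addr0 // => j ji; rewrite mxE (negPf ji) andbF rmorph0 mul0r.
  exists c; split=> // d dE; apply/eqP; rewrite -subr_eq0; apply/eqP/iu.
  by rewrite lcombB /= [X in X - _]dE /lcomb subrr.
have sF : subspace_Rat F.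
  split; first by exists 0 => //; rewrite lcomb0.
  by move=> a _ _ [c _ <-] [d _ <-]; exists (a *: c + d) => //; rewrite lcombP.
have le_prod : \prod_i NN (u i) <= expR (- (r%:R * (n%:R * rho))).
  rewrite -mulrN expRM_natl -[in X in _ ^+ X](card_ord r) -prodr_const.
  apply: ler_prod => i _; rewrite NN0 /=; apply: norm_le => // x t t0.
  have h1 := below x t t0; have h2 := H0_ord (u0 i) (Hu i) x.
  have : n%:R * (rho + E x * t) <= n%:R * (phi (xi x t%:E) + D x * t) by rewrite ler_pM2l.
  have : 0 <= ((ord x (u i))%:~R + n%:R * E x) * t by rewrite mulr_ge0.
  by nra.
(* Monotonicity of [ln] needs a positive determinant norm. This follows from the lower bound on the
   norm of every non-zero section. *)
have pos : 0 < det_norm NN u.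
  apply: lt_le_trans (_ : \prod_(i < r) expR (- (n%:R * Num.max 0 (phi eta0))) <= _).
    by apply: prodr_gt0 => i _; exact: expR_gt0.
  apply: det_norm_ge => // v iv _; apply: ler_prod => i _.
  by rewrite expR_ge0 /=; apply: norm_ge => //; exact: indep_neq0 iv.
have ge_d : r%:R * (n%:R * rho) <= - ln (det_norm NN u).
  rewrite lerNr -[leRHS]expRK ler_ln ?posrE ?expR_gt0 //.
  exact: le_trans (det_norm_le _ NN0) le_prod.
apply: le_trans (_ : (- ln (det_norm NN u))%:E * ((n%:R ^+ 2 / 2)^-1)%:E <= _)%E; last first.
  apply: lee_wpmul2r; first by rewrite lee_fin invr_ge0 divr_ge0 // sqr_ge0.
  apply: ereal_sup_ubound; exists (- ln (det_norm NN u)) => //.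
  by exists F; split=> //; exists r, u.
rewrite -EFinM lee_fin ler_pdivlMr ?divr_gt0 ?exprn_gt0 //.
apply: le_trans ge_d.
have : e * n%:R * (n%:R * rho) <= r%:R * (n%:R * rho) by rewrite ler_wpM2r // mulr_ge0 // ltW.
by lra.
Qed.

Section NotBig.
Variables (phi : Xan -> R) (D : P -> R).
Hypothesis cphi : continuous phi.
Hypothesis not_below : ~ positive_below phi D.
Local Notation N n := (green_norm (green_scale n (nform phi D))).

(* Independent sections of norm < 1 all lie in H^0(nE) for some E with
   g >= rho + g_E, so that deg E <= 0. *)
Lemma small_sections_bounded : exists c : nat, forall n m (s : 'I_m -> K), (0 < n)%N ->
  indep_mod cst [set 0] s -> (forall i, N n (s i) < 1) -> (m <= c)%N.
Proof.
have [c cP] := dim_H0_small R X; exists c => n [//|m] s n0 is_ Ns.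
have n0R : 0 < n%:R :> R by rewrite ltr0n.
have s0 i := indep_neq0 i is_.
have /choice[rho rhoP] : forall i, exists r : R, 0 < r /\ forall x t, 0 <= t ->
    r <= n%:R * (phi (xi x t%:E) + D x * t) + (ord x (s i))%:~R * t.
  by move=> i; have [r r0 rP] := norm_lt1 cphi (s0 i) (Ns i); exists r.
have [i0 _ i0P] : exists2 i0, true & forall i, rho i0 <= rho i.
  by case: (@Order.TotalTheory.arg_minP _ _ _ ord0 predT rho isT) => i _ h; exists i => // j; exact: h.
have /choice[j jP] : forall x, exists j, forall i, ord x (s j) <= ord x (s i).
  move=> x; case: (@Order.TotalTheory.arg_minP _ _ _ ord0 predT (fun i => ord x (s i)) isT).
  by move=> i _ h; exists i => l; exact: h.
(* E is the least divisor such that all the s i lie in H^0(nE). On the branch of x, the height bound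
   of the section of least order there gives g >= rho i0 / n + E x t. *)
pose E x : R := - (ord x (s (j x)))%:~R / n%:R.
have /choice[t tP] : forall i, exists t, supported (pdiv (s i)) t.
  by move=> i; have [t []] := pdiv_deg0 R (s0 i); exists t.
pose q := undup (flatten [seq t i | i <- enum 'I_m.+1]).
have sE : supported E q.
  split; first exact: undup_uniq.
  move=> x xq; have := (tP (j x)).2 x; rewrite /Defs.pdiv /E => -> //.
    by rewrite oppr0 mul0r.
  apply: contra xq => xt; rewrite mem_undup; apply/flattenP; exists (t (j x)) => //.
  by apply/mapP; exists (j x); rewrite ?mem_enum.
have [degE|degE] := ltP 0 (\sum_(x <- q) E x * dgr x).
  case: not_below; exists (rho i0 / n%:R), E, q; split=> //.
    by rewrite divr_gt0 //; exact: (rhoP i0).1.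
  move=> x y y0; rewrite -(ler_pM2l n0R) mulrDr mulrCA divff ?gt_eqF // mulr1.
  have := (rhoP (j x)).2 x y y0; have := i0P (j x).
  rewrite mulrA /E mulrCA divff ?gt_eqF // mulr1; lra.
apply: (cP (fun x => n%:R * E x) q).
- by split; [exact: sE.1|move=> x /sE.2 ->; rewrite mulr0].
- under eq_bigr => x _ do rewrite -mulrA.
  by rewrite -mulr_sumr pmulr_rle0.
- exists s; split=> // i; right; split=> // x.
  by rewrite /Defs.pdiv /E mulrCA divff ?gt_eqF // mulr1 subr_ge0 ler_int.
Qed.

(** In any basis at most c members have norm below 1, and these have norm at least exp(-nC). Hence
    every subspace has degree at most n C c, and the quotient by n^2 / 2 is 2 C c / n. *)
Lemma not_big : (avol D (nform phi D) <= 0)%E.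
Proof.
have [c cP] := small_sections_bounded.
set C := Num.max 0 (phi eta0); have C0 : 0 <= C by rewrite le_max lexx.
apply: (@limn_esup_le0 _ _ (2 * (C * c%:R))) => n n0.
have n0R : 0 < n%:R :> R by rewrite ltr0n.
apply: le_trans (_ : (n%:R * C * c%:R)%:E * ((n%:R ^+ 2 / 2)^-1)%:E <= _)%E; last first.
  by rewrite -EFinM lee_fin le_eqVlt; apply/orP; left; apply/eqP; field; rewrite gt_eqF.
apply: lee_wpmul2r; first by rewrite lee_fin invr_ge0 divr_ge0 // sqr_ge0.
apply: ge_ereal_sup => _ [d [F [sF FH [r [e [[Fe eP] ->]]]]] <-].
rewrite lee_fin lerNl -[leLHS]expRK.
have ie : indep_mod cst [set 0] e.
  move=> a a0; have [b [_ bU]] := eP 0 sF.1.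
  have <- : b = a by apply: bU; exact/esym.
  by apply: bU; exact/esym/lcomb0.
suff h : expR (- (n%:R * C * c%:R)) <= det_norm (N n) e.
  rewrite ler_ln ?posrE ?expR_gt0 //; exact: lt_le_trans (expR_gt0 _) h.
apply: det_norm_ge => // s is_ se.
pose B := [pred i | N n (s i) < 1]; have s0 i := indep_neq0 i is_.
have Bc : (#|B| <= c)%N.
  apply: (cP n _ (s \o @enum_val _ (mem B))) => //.
    by apply: indep_subfamily => //; exact: enum_val_inj.
  by move=> i; have := enum_valP i; rewrite inE.
apply: le_trans (_ : \prod_i (if i \in B then expR (- (n%:R * C)) else 1) <= _).
  rewrite -big_mkcond prodr_const -mulNr expRM_natr ler_wiXn2l ?expR_ge0 //.
  by rewrite expR_le1 oppr_le0 mulr_ge0.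
apply: ler_prod => i _; rewrite inE; case: ltP => Ni; rewrite ?expR_ge0 ?ler01 //=.
by apply: norm_ge.
Qed.

End NotBig.

Lemma big_nformP phi D : continuous phi -> big D (nform phi D) <-> positive_below phi D.
Proof.
move=> cphi; split; last exact: big_nform.
by move=> bD; apply: contrapT => /(not_big cphi); rewrite leNgt => /negP.
Qed.

End Bigness.

(** * The invariant mu_inf *)

Lemma ler_sum_lists (R : numDomainType) (T : eqType) (f : T -> R) (s t : seq T) :
  uniq s -> uniq t -> (forall x, x \in t -> x \notin s -> f x <= 0) ->
  (forall x, x \in s -> x \notin t -> 0 <= f x) ->
  \sum_(x <- t) f x <= \sum_(x <- s) f x.
Proof.
move=> us ut ft fs; pose q := undup (s ++ t).
have H r : uniq r -> {subset r <= q} -> \sum_(x <- r) f x = \sum_(x <- q) (if x \in r then f x else 0).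
  move=> ur rq; rewrite (eq_big_seq (fun x => if x \in r then f x else 0)); last by move=> x ->.
  apply: sum_support => //; first exact: undup_uniq.
    by move=> x; case: ifP => //; rewrite eqxx.
  by move=> x; case: ifP => [/rq//|]; rewrite eqxx.
rewrite (H s us) ?(H t ut); last 2 first.
- by move=> x xt; rewrite mem_undup mem_cat xt orbT.
- by move=> x xs; rewrite mem_undup mem_cat xs.
apply: ler_sum => x _; case: ifPn => xt; case: ifPn => xs //; [exact: ft|exact: fs].
Qed.

Section EsumLists.
Variables (R : realType) (T : choiceType).
Implicit Types (a : T -> \bar R) (s : seq T).

Lemma esum_ge_seq a s : uniq s -> (\sum_(x <- s) a x <= \esum_(x in [set: T]) a x)%E.
Proof.
move=> us; apply: esum_ge; exists [set` s]; last by rewrite -fsbig_seq.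
by split=> //; apply/finite_seqP; exists s.
Qed.

Lemma esum_le_seq a (v : \bar R) : (forall s, uniq s -> (\sum_(x <- s) a x <= v)%E) ->
  (\esum_(x in [set: T]) a x <= v)%E.
Proof.
move=> h; apply: ge_ereal_sup => _ [A [fA _] <-].
by rewrite fsbig_finite //; apply: h; exact: finmap.fset_uniq.
Qed.

Lemma esum_EFin_supported (f : T -> R) s : uniq s -> (forall x, 0 <= f x) ->
  (forall x, x \notin s -> f x = 0) ->
  \esum_(x in [set: T]) (f x)%:E = (\sum_(x <- s) f x)%:E.
Proof.
move=> us f0 fs; apply/eqP; rewrite eq_le; apply/andP; split; last first.
  by apply: le_trans (esum_ge_seq _ us); rewrite sumEFin.
apply: esum_le_seq => t ut; rewrite sumEFin lee_fin; apply: ler_sum_lists => // x _.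
by move=> /fs->.
Qed.

End EsumLists.

Section MuInf.
Variables (R : realType) (k : fieldType) (X : regular_projective_curve k).
Local Notation Xan := (berkovich R X).
Local Notation P := (closed_point X).
Local Notation dgr := (dgr R).
Variables (phi : Xan -> R) (D : P -> R) (S0 : seq P).
Hypotheses (cphi : continuous phi) (DS : supported D S0).
Local Notation g := (nform phi D).
Local Notation mu := (mu_inf_at g).

Lemma mu_geP x (e : R) : (e%:E <= mu x)%E <->
  forall t : R, 0 < t -> e * t <= phi (xi x t%:E) + D x * t.
Proof.
have E (t : R) : 0 < t -> (g (xi x t%:E) * (t^-1)%:E)%E = ((phi (xi x t%:E) + D x * t) / t)%:E.
  by move=> t0; rewrite nform_xi ?EFinM // ltW.
split=> [h t t0|h].
  rewrite -ler_pdivlMr // -lee_fin; apply: le_trans h _.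
  by apply: ereal_inf_lbound; exists t => //; exact: E.
apply: le_ereal_inf_tmp => _ [t /= t0 <-].
by rewrite E // lee_fin ler_pdivlMr //; exact: h.
Qed.

Lemma mu_le_D x : (mu x <= (D x)%:E)%E.
Proof.
case E: (mu x) => [e| |] //; last by rewrite leNye.
  rewrite lee_fin; apply: (@slope_le _ _ _ phi D x 0) => // t t0; rewrite add0r.
  by apply: (mu_geP x e).1 => //; rewrite E.
have : ((D x + 1)%:E <= mu x)%E by rewrite E leey.
move=> /mu_geP h; have : D x + 1 <= D x.
  by apply: (@slope_le _ _ _ phi D x 0) => // t t0; rewrite add0r; exact: h.
by rewrite gerDl ler10.
Qed.

(** Let t tend to 0 in e t <= g: a finite slope bound on a single branch already controls the sign
    at the root. *)
Lemma root_ge0 x (e : R) : (e%:E <= mu x)%E -> 0 <= phi eta0.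
Proof.
move=> /mu_geP h.
have c1 : phi (xi x t%:E) @[t --> 0^'+] --> phi eta0.
  exact: (cvg_comp _ _ (@xi_cvg_root R k X x) (@cphi eta0)).
have c2 : (D x - e) * t @[t --> 0^'+] --> (D x - e) * 0.
  by apply: cvgM; [exact: cvg_cst|apply: cvg_at_right_filter; exact: cvg_id].
have c3 : phi (xi x t%:E) + (D x - e) * t @[t --> 0^'+] --> phi eta0 + (D x - e) * 0.
  exact: cvgD c1 c2.
rewrite mulr0 addr0 in c3.
rewrite -(cvg_lim _ c3) //; apply: limr_ge; first by apply/cvg_ex; exists (phi eta0).
near=> t; have t0 : 0 < t by near: t; exact: nbhs_right_gt.
by have := h t t0; lra.
Unshelve. all: by end_near. Qed.

Let m x := (mu x * (dgr x)%:E)%E.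

Lemma esum_pos_finite : (\esum_(x in [set: P]) maxe (m x) 0 < +oo)%E.
Proof.
apply: le_lt_trans (_ : \esum_(x in [set: P]) (Num.max (D x * dgr x) 0)%:E < _)%E.
  apply: le_esum => x _; rewrite EFin_max EFinM.
  rewrite ge_max; apply/andP; split; last by rewrite le_max lexx orbT.
  rewrite le_max; apply/orP; left; apply: lee_wpmul2r; last exact: mu_le_D.
  by rewrite lee_fin ltW // dgr_gt0.
rewrite (@esum_EFin_supported _ _ _ S0) ?ltry //; first exact: DS.1.
  by move=> x; rewrite le_max lexx orbT.
by move=> x /(DS.2) ->; rewrite mul0r maxxx.
Qed.

(** The positive part of the sum is finite, being bounded through D, so one infinite slope would
    make the whole sum -oo. *)
Lemma mu_inf_finite : (-oo < mu_inf g)%E -> exists f : P -> R, forall x, mu x = (f x)%:E.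
Proof.
move=> h; suff /choice[f fE] : forall x, exists r : R, mu x = r%:E by exists f.
move=> x; have := mu_le_D x; case E: (mu x) => [r| |] //; first by exists r.
move=> _; move: h; rewrite /mu_inf -/m.
have -> : (\esum_(x in [set: P]) maxe (- m x) 0 = +oo)%E.
  apply/eqP; rewrite -leye_eq.
  have : uniq [:: x] by []. move=> /(esum_ge_seq (fun x => maxe (- m x) 0)%E).
  apply: le_trans; rewrite big_seq1 /m E gt0_mulNye ?lte_fin ?dgr_gt0 //.
by move: esum_pos_finite; case: (\esum_(_ in _) _).
Qed.

Variable f : P -> R.
Hypothesis muf : forall x, mu x = (f x)%:E.

Lemma mu_real_le_D x : f x <= D x.
Proof. by have := mu_le_D x; rewrite muf lee_fin. Qed.

Let pos x := Num.max (f x * dgr x) 0.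
Let neg x := Num.max (- (f x * dgr x)) 0.

Let mu_infE : mu_inf g = (\esum_(x in [set: P]) (pos x)%:E - \esum_(x in [set: P]) (neg x)%:E)%E.
Proof.
rewrite /mu_inf; congr (_ - _)%E; apply: eq_esum => x _; rewrite muf -EFinM.
  by rewrite -EFin_max.
by rewrite -EFinN -EFin_max.
Qed.

Let pos_ge0 x : 0 <= pos x. Proof. by rewrite le_max lexx orbT. Qed.
Let neg_ge0 x : 0 <= neg x. Proof. by rewrite le_max lexx orbT. Qed.

Let posnegE x : f x * dgr x = pos x - neg x.
Proof. by rewrite /pos /neg; case: (lerP (f x * dgr x) 0) => h; case: (lerP (- (f x * dgr x)) 0) => h'; lra. Qed.

Let pos_out x : x \notin S0 -> pos x = 0.
Proof.
move=> /(DS.2) Dx; have := mu_real_le_D x; rewrite Dx => h.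
by apply/max_idPr; rewrite mulr_le0_ge0 // ltW // dgr_gt0.
Qed.

(** Outside S0 the terms are at most D x = 0, so partial sums decrease as the list grows beyond S0.
    Together with [mu_inf_ge], this describes [mu_inf] as their infimum, without splitting into
    signs. *)
Lemma mu_inf_le (s : seq P) : uniq s -> {subset S0 <= s} ->
  (mu_inf g <= (\sum_(x <- s) f x * dgr x)%:E)%E.
Proof.
move=> us Ss; rewrite mu_infE (@esum_EFin_supported _ _ pos s) //; last first.
  by move=> x xs; apply: pos_out; apply: contra xs; exact: Ss.
under [in leRHS]eq_bigr => x _ do rewrite posnegE.
rewrite sumrB EFinB; apply: leeB => //.
by apply: le_trans (esum_ge_seq _ us); rewrite sumEFin.
Qed.

Lemma mu_inf_ge (s : seq P) (v : R) : (forall t, uniq t -> {subset s <= t} -> v <= \sum_(x <- t) f x * dgr x) ->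
  (v%:E <= mu_inf g)%E.
Proof.
move=> h; rewrite mu_infE (@esum_EFin_supported _ _ pos S0) //; last exact: DS.1.
set p := \sum_(_ <- _) _.
have : (\esum_(x in [set: P]) (neg x)%:E <= (p - v)%:E)%E.
  apply: esum_le_seq => t ut; rewrite sumEFin lee_fin.
  pose q := undup (s ++ S0 ++ t); have uq : uniq q by exact: undup_uniq.
  have sq : {subset s <= q} by move=> x xs; rewrite mem_undup mem_cat xs.
  have Sq : {subset S0 <= q} by move=> x xs; rewrite mem_undup !mem_cat xs orbT.
  have tq : {subset t <= q} by move=> x xs; rewrite mem_undup !mem_cat xs !orbT.
  have := h q uq sq; under eq_bigr => x _ do rewrite posnegE.
  rewrite sumrB (_ : \sum_(x <- q) pos x = p); last first.
    apply/esym/sum_support => //; first exact: DS.1.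
      by move=> x; apply: contraNT => /pos_out->.
    by move=> x px; apply: Sq; apply: contraNT px => /pos_out->.
  have : \sum_(x <- t) neg x <= \sum_(x <- q) neg x.
    by apply: ler_sum_lists => // x xt; rewrite (tq _ xt).
  by lra.
have : (0 <= \esum_(x in [set: P]) (neg x)%:E)%E by apply: esum_ge0 => x _; rewrite lee_fin.
by case: (\esum_(_ in _) _) => [r| |] //=; rewrite !lee_fin => r0; lra.
Qed.

End MuInf.

(** * Pseudo-effectivity and effectivity up to equivalence *)

Lemma ge0_of_perturbation (R : realFieldType) (a b : R) : 0 <= b ->
  (forall e, 0 < e -> - (e * b) <= a) -> 0 <= a.
Proof.
move=> b0 h; rewrite leNgt; apply/negP => a0.
have b1 : 0 < b + 1 by rewrite ltr_wpDl.
have := h (- a / (2 * (b + 1))).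
rewrite divr_gt0 ?oppr_gt0 ?mulr_gt0 // => /(_ isT).
rewrite mulrAC -mulNr ler_pdivrMr ?mulr_gt0 //; nra.
Qed.

Section Equivalence.
Variables (R : realType) (k : fieldType) (X : regular_projective_curve k).
Local Notation Xan := (berkovich R X).
Local Notation P := (closed_point X).
Local Notation dgr := (dgr R).
Implicit Types (x y : P).
Variables (phi : Xan -> R) (D : P -> R).
Hypotheses (cphi : continuous phi) (RD : Rdivisor D).
Local Notation g := (nform phi D).
Local Notation mu := (mu_inf_at g).

(** The test divisor is e y, with the constant e added to its canonical Green function; it is big.
    The divisor that witnesses bigness of the sum, minus e y, is the required one. *)
Lemma pseudo_effective_perturbation (e : R) y S : 0 < e -> pseudo_effective D g ->
  uniq S -> (forall x, x \notin S -> D x = 0) -> y \in S -> exists E : P -> R,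
  [/\ - (e * dgr y) < \sum_(x <- S) E x * dgr x, forall x, E x <= D x &
      forall x t, 0 <= t -> E x * t <= phi (xi x t%:E) + D x * t + e].
Proof.
move=> e0 pe uS DS yS; pose D0 x : R := if x == y then e else 0.
have sD0 : supported D0 [:: y].
  by split=> // x; rewrite inE /D0 => /negPf->.
have ce : continuous ((fun=> e) : Xan -> R) by exact: cst_continuous.
have RD0 := supported_Rdivisor sD0.
have bigD0 : big D0 (nform (fun=> e) D0).
  apply: big_nform => //; exists e, D0, [:: y]; split=> //.
  by rewrite big_seq1 /D0 eqxx mulr_gt0 // dgr_gt0.
have := pe D0 (nform (fun=> e) D0) (conj RD0 (nform_green ce RD0)) bigD0.
rewrite green_add_nform // => /big_nformP[p|].
  exact: (cvgD (@cphi p) (ce p)).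
move=> rho [E [s [rho0 sE degE below]]].
have ED x : E x <= D x + D0 x.
  apply: (@slope_le _ _ _ (phi \+ fun=> e) (D \+ D0) x rho).
    by move=> p; exact: (cvgD (@cphi p) (ce p)).
  by move=> t t0; apply: below; exact: ltW.
have sumD0 : \sum_(x <- S) D0 x * dgr x = e * dgr y.
  rewrite (bigD1_seq y) //= /D0 eqxx big1 ?addr0 // => x /negPf->.
  by rewrite mul0r.
exists (fun x => E x - D0 x); split=> [|x|x t t0].
- under eq_bigr => x _ do rewrite mulrBl.
  rewrite sumrB sumD0 -[ltLHS]add0r ltrD2r; apply: lt_le_trans degE _.
  (* Outside S both D and D0 vanish, so E is at most 0 there, and restricting its degree to S can
     only increase it. *)
  apply: ler_sum_lists => //; first exact: sE.1.
    move=> x _ xS; rewrite pmulr_lle0 ?dgr_gt0 //; have := ED x.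
    by rewrite DS // /D0; case: eqP => [xy|_]; [rewrite xy yS in xS|rewrite addr0].
  by move=> x _ xs; rewrite sE.2 // mul0r.
- by rewrite lerBlDr.
- by have := below x t t0; rewrite /=; lra.
Qed.

Lemma pseudo_effective_mu_inf : pseudo_effective D g -> (0 <= mu_inf g)%E.
Proof.
move=> pe; have [S0 sD] := Rdivisor_supported RD.
have [y0] := closed_point_exists X.
have Q x : exists S, [/\ uniq S, {subset S0 <= S}, x \in S & y0 \in S].
  exists (undup (x :: y0 :: S0)); split; first exact: undup_uniq.
  - by move=> z zS; rewrite mem_undup !inE zS !orbT.
  - by rewrite mem_undup mem_head.
  - by rewrite mem_undup !inE eqxx orbT.
have out (S : seq P) : {subset S0 <= S} -> forall x, x \notin S -> D x = 0.
  by move=> SS x xS; apply: sD.2; apply: contra xS; exact: SS.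
have /choice[f fE] : forall x, exists r : R, mu x = r%:E.
  move=> x; have [S [uS SS xS yS]] := Q x.
  (* Since E <= D and the degree of E is almost non-negative, E x cannot fall much below -B / deg x,
     whatever e is. Letting e tend to 0 for fixed t bounds the slope at x. *)
  pose B := \sum_(z <- S | z != x) `|D z| * dgr z.
  have : ((- (B / dgr x))%:E <= mu x)%E.
    apply/mu_geP => t t0; rewrite -subr_ge0.
    apply: (@ge0_of_perturbation _ _ (1 + dgr y0 / dgr x * t)).
      by rewrite addr_ge0 // mulr_ge0 ?divr_ge0 // ltW // dgr_gt0.
    move=> e e0.
    have [E [degE ED EB]] := pseudo_effective_perturbation e0 pe uS (out S SS) yS.
    have : - (e * dgr y0) - B <= E x * dgr x.
      rewrite lerBlDr; apply: le_trans (ltW degE) _; rewrite (bigD1_seq x) //= lerD2l.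
      apply: ler_sum => z _; apply: ler_wpM2r; first by rewrite ltW // dgr_gt0.
      exact: le_trans (ED z) (ler_norm _).
    rewrite -ler_pdivrMr ?dgr_gt0 // => h.
    have := EB x t (ltW t0); have : (- (e * dgr y0) - B) / dgr x * t <= E x * t by rewrite ler_pM2r.
    by rewrite mulrBl mulNr; lra.
  have := mu_le_D D cphi x.
  by case: (mu x) => [r| |] //; exists r.
rewrite -[0%E]/((0 : R)%:E); apply: (mu_inf_ge cphi sD fE (s := y0 :: S0)) => S uS SS.
have yS : y0 \in S by apply: SS; rewrite mem_head.
have SS0 : {subset S0 <= S} by move=> x xS; apply: SS; rewrite inE xS orbT.
pose T := \sum_(x <- S) dgr x; have T0 : 0 <= T by apply: sumr_ge0 => x _; rewrite ltW // dgr_gt0.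
apply: (ge0_of_perturbation T0) => eta eta0'.
(* Each t x depends on eta but not on e. So e can tend to 0 first, with the error terms e deg(x) / t
   x for x in S, and eta only afterwards. *)
have /choice[t tP] : forall x, exists t : R, 0 < t /\ phi (xi x t%:E) + D x * t <= (f x + eta) * t.
  move=> x; apply: contrapT => nt.
  have : ((f x + eta)%:E <= mu x)%E.
    apply/mu_geP => t t0; rewrite leNgt; apply/negP => lt; apply: nt; exists t; split=> //.
    exact: ltW.
  by rewrite fE lee_fin gerDl leNgt eta0'.
rewrite -subr_ge0 opprK.
apply: (@ge0_of_perturbation _ _ (dgr y0 + \sum_(x <- S) dgr x / t x)).
  rewrite addr_ge0 ?(ltW (dgr_gt0 _ _)) //; apply: sumr_ge0 => x _.
  by rewrite divr_ge0 ?(ltW (dgr_gt0 _ _)) // ltW //; have [] := tP x.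
move=> e e0.
have [E [degE ED EB]] := pseudo_effective_perturbation e0 pe uS (out S SS0) yS.
have : \sum_(x <- S) E x * dgr x <= \sum_(x <- S) (f x * dgr x + eta * dgr x + e * (dgr x / t x)).
  apply: ler_sum => x _; have [t0 tle] := tP x; have := EB x (t x) (ltW t0) => h.
  have : E x * t x <= (f x + eta) * t x + e by lra.
  rewrite -ler_pdivlMr // mulrDl mulfK ?gt_eqF // => h'.
  have -> : f x * dgr x + eta * dgr x + e * (dgr x / t x) = (f x + eta + e / t x) * dgr x by ring.
  by rewrite ler_pM2r ?dgr_gt0.
rewrite !big_split /= -!mulr_sumr -/T; lra.
Qed.

(** The slopes of g on finitely many branches are added to the witness E0 of bigness. On all other
    branches the slope 0 suffices, at the price of half of rho. *)
Lemma mu_inf_pseudo_effective : (0 <= mu_inf g)%E -> pseudo_effective D g.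
Proof.
move=> mu0 D0 g0 [RD0 /green_nform[phi0 cphi0 ->]] /(big_nformP _ cphi0)[rho [E0 [s [rho0 sE degE below]]]].
have [S0 sD] := Rdivisor_supported RD; have [S1 sD0] := Rdivisor_supported RD0.
have c12 : continuous (phi \+ phi0) by move=> p; exact: (cvgD (@cphi p) (cphi0 p)).
have [f fE] := mu_inf_finite cphi sD (lt_le_trans (ltNyr 0) mu0).
have [y0] := closed_point_exists X.
have p0 : 0 <= phi eta0 by apply: (@root_ge0 _ _ _ phi D cphi y0 (f y0)); rewrite fE.
rewrite green_add_nform //; apply: big_nform => //.
(* A neighbourhood of the root contains all but finitely many whole branches, so phi >= -rho/2 fails
   on finitely many branches only. *)
have : nbhs (eta0 : Xan) [set p | - (rho / 2) <= phi p].
  have lt : - (rho / 2) < phi eta0 by rewrite (lt_le_trans _ p0) // oppr_lt0 divr_gt0.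
  have h := cvgr_ge _ (@cphi eta0 : phi p @[p --> eta0] --> phi eta0).
  exact: (h (nbhs_filter _) _ lt).
move=> /eta0_nbhs /finite_seqP[B BE].
pose S := undup (S0 ++ s ++ B); have uS : uniq S by exact: undup_uniq.
have S0S : {subset S0 <= S} by move=> x xS; rewrite mem_undup mem_cat xS.
have sS : {subset s <= S} by move=> x xS; rewrite mem_undup !mem_cat xS orbT.
have BS : {subset B <= S} by move=> x xS; rewrite mem_undup !mem_cat xS !orbT.
pose E x := if x \in S then f x + E0 x else 0.
exists (rho / 2), E, S; split; first by rewrite divr_gt0.
- by split=> // x xS; rewrite /E (negPf xS).
- rewrite (eq_big_seq (fun x => f x * dgr x + E0 x * dgr x)); last first.
    by move=> x xS; rewrite /E xS mulrDl.
  rewrite big_split /= (supported_sum (supportedW sE uS sS) sE).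
  apply: ltr_wpDl => //; rewrite -lee_fin; apply: le_trans mu0 _.
  exact: (mu_inf_le cphi sD fE).
- move=> x t t0; rewrite /= /E; have b0 := below x t t0.
  case: ifPn => xS.
    move: t0; rewrite le_eqVlt => /orP[/eqP t0|t0].
      move: b0; rewrite -t0 !mulr0 !addr0 xi0 => b0; lra.
    have : f x * t <= phi (xi x t%:E) + D x * t by apply: (mu_geP phi D x (f x)).1; rewrite ?fE.
    by lra.
  have Dx : D x = 0 by apply: sD.2; apply: contra xS; exact: S0S.
  have Ex : E0 x = 0 by apply: sE.2; apply: contra xS; exact: sS.
  have : - (rho / 2) <= phi (xi x t%:E).
    have xB : ~ [set` B] x by apply/negP; apply: contra xS; exact: BS.
    move: xB; rewrite -BE /= => /contrapT; apply; by rewrite lee_fin.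
  by move: b0; rewrite Dx Ex; lra.
Qed.

Lemma pdivR_opp (r : RatR X R) : exists r' : RatR X R, forall x, pdivR r' x = - pdivR r x.
Proof.
exists [seq (- q.1, q.2) | q <- r] => x; rewrite /pdivR big_map -sumrN.
by apply: eq_bigr => q _; rewrite mulNr.
Qed.

Let c0 : continuous ((fun=> 0) : Xan -> R). Proof. exact: cst_continuous. Qed.

(** Effectivity of g + g_(r) says that each slope is at least -ord_x(r). If all are equal, the
    slopes form a principal divisor; one strict inequality makes their sum positive, because (r) has
    degree 0. *)
Lemma effective_mu D' g' : metrised D' g' -> effective D' g' -> linearly_equivalent D g D' g' ->
  finite_set [set x | ~ (0 <= mu x)%E] /\
    ((0 < mu_inf g)%E \/
     (exists Q : P -> R, principal Q /\ forall x, mu x = (Q x)%:E)).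
Proof.
move=> _ [_ g0] [r [_ gE]]; have [S0 sD] := Rdivisor_supported RD.
have [s [sr r0]] := pdivR_deg0 r.
have ge x : ((- pdivR r x)%:E <= mu x)%E.
  apply/mu_geP => t t0; have := g0 (xi x t%:E).
  rewrite gE canonical_green_nform green_add_nform // nform_xi ?(ltW t0) //= lee_fin; lra.
have /choice[f fE] : forall x, exists u : R, mu x = u%:E.
  move=> x; have := ge x; have := mu_le_D D cphi x.
  by case: (mu x) => [u| |] //; exists u.
have fge x : - pdivR r x <= f x by rewrite -lee_fin -fE.
split.
  apply: (@sub_finite_set _ _ [set` s]); last by apply/finite_seqP; exists s.
  move=> x /= nmu; apply: contrapT => /negP xs; apply: nmu; rewrite fE lee_fin.
  by have := fge x; rewrite sr.2 // oppr0.
have [eqf|] := pselect (forall x, f x = - pdivR r x).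
  right; have [r' r'E] := pdivR_opp r; exists (pdivR r'); split; first by exists r'.
  by move=> x; rewrite fE r'E eqf.
move=> /existsNP[x /eqP nx]; left.
have v0 : 0 < (f x + pdivR r x) * dgr x.
  by rewrite mulr_gt0 ?dgr_gt0 // -ltrBlDr sub0r lt_neqAle eq_sym nx fge.
apply: lt_le_trans (_ : ((f x + pdivR r x) * dgr x)%:E <= _)%E; first by rewrite lte_fin.
apply: (mu_inf_ge cphi sD fE (s := x :: s)) => t ut st.
have xt : x \in t by apply: st; rewrite mem_head.
have <- : \sum_(z <- t) (f z + pdivR r z) * dgr z = \sum_(z <- t) f z * dgr z.
  under eq_bigr => z _ do rewrite mulrDl.
  rewrite big_split /= (supported_sum (supportedW sr ut _) sr) ?r0 ?addr0 // => z zs.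
  by apply: st; rewrite inE zs orbT.
rewrite (bigD1_seq x) //= lerDl; apply: sumr_ge0 => z _.
by rewrite mulr_ge0 ?(ltW (dgr_gt0 _ _)) // -lerBlDr sub0r.
Qed.

(** Either condition provides r such that the slopes plus (r) are non-negative, and these bound the
    new Green function from below on each branch. *)
Lemma mu_effective : finite_set [set x | ~ (0 <= mu x)%E] ->
    (0 < mu_inf g)%E \/
     (exists Q : P -> R, principal Q /\ forall x, mu x = (Q x)%:E) ->
  exists (D' : P -> R) (g' : Xan -> \bar R),
    [/\ metrised D' g', effective D' g' & linearly_equivalent D g D' g'].
Proof.
move=> /finite_seqP[B BE] H; have [S0 sD] := Rdivisor_supported RD.
have [f [r [fE fr]]] : exists (f : P -> R) (r : RatR X R),
    (forall x, mu x = (f x)%:E) /\ forall x, 0 <= f x + pdivR r x.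
  case: H => [mu0|[_ [[r ->] fE]]]; last first.
    have [r' r'E] := pdivR_opp r; exists (pdivR r), r'; split=> // x.
    by rewrite r'E subrr.
  have [f fE] := mu_inf_finite cphi sD (lt_trans (ltNyr 0) mu0).
  pose S := undup (S0 ++ B); have uS : uniq S by exact: undup_uniq.
  have S0S : {subset S0 <= S} by move=> x xS; rewrite mem_undup mem_cat xS.
  have BS : {subset B <= S} by move=> x xS; rewrite mem_undup !mem_cat xS !orbT.
  (* Outside S0 a slope is at most D x = 0, and outside B it is non-negative. So the slopes form an
     R-divisor, whose degree is at least [mu_inf]. *)
  have sf : supported f S.
    split=> // x xS; apply/eqP; rewrite eq_le; apply/andP; split.
      have := mu_real_le_D cphi fE x; rewrite sD.2 //; apply: contra xS; exact: S0S.
    have xB : ~ [set` B] x by apply/negP; apply: contra xS; exact: BS.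
    by move: xB; rewrite -BE /= fE lee_fin => /contrapT.
  have [|r rP] := effective_representative sf; last by exists f, r.
  by rewrite -lte_fin; apply: lt_le_trans mu0 _; exact: (mu_inf_le cphi sD fE).
have [s [sr _]] := pdivR_deg0 r.
have RDr : Rdivisor (D \+ pdivR r).
  have uq : uniq (undup (S0 ++ s)) by exact: undup_uniq.
  apply: (@supported_Rdivisor _ _ _ _ (undup (S0 ++ s))); split=> // x xq /=.
  rewrite (supportedW sD uq _).2 ?(supportedW sr uq _).2 ?addr0 // => z zs.
    by rewrite mem_undup mem_cat zs orbT.
  by rewrite mem_undup mem_cat zs.
exists (D \+ pdivR r), (nform phi (D \+ pdivR r)); split.
- by split=> //; exact: nform_green.
- split=> [x|]; first by apply: le_trans (fr x) _; rewrite /= lerD2r; exact: (mu_real_le_D cphi fE).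
  apply: nform_ge => // x t t0; rewrite nform_xi // lee_fin /=.
  move: t0; rewrite le_eqVlt => /orP[/eqP<-|t0].
    by rewrite mulr0 addr0 xi0; apply: (@root_ge0 _ _ _ phi D cphi x (f x)); rewrite fE.
  have : f x * t <= phi (xi x t%:E) + D x * t by apply: (mu_geP phi D x (f x)).1; rewrite ?fE.
  have : 0 <= (f x + pdivR r x) * t by rewrite mulr_ge0 // ltW.
  by lra.
- exists r; split=> //; rewrite canonical_green_nform green_add_nform //.
  by congr nform; apply/funext => p /=; rewrite addr0.
Qed.

End Equivalence.

Unset Implicit Arguments.

Theorem theorem1p2 (R : realType) (k : fieldType)
    (X : regular_projective_curve k)
    (D : closed_point X -> R) (g : berkovich R X -> \bar R)
    (Dg : metrised D g) :
  (pseudo_effective D g <-> (0 <= mu_inf g)%E) /\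
  ((exists (D' : closed_point X -> R) (g' : berkovich R X -> \bar R),
      [/\ metrised D' g', effective D' g' & linearly_equivalent D g D' g'])
   <->
   (finite_set [set x | ~ (0 <= mu_inf_at g x)%E] /\
    ((0 < mu_inf g)%E \/
     (exists P : closed_point X -> R,
        principal P /\ forall x, mu_inf_at g x = (P x)%:E)))).
Proof.
have [RD /green_nform[phi cphi ->]] := Dg.
split; split.
- exact: pseudo_effective_mu_inf.
- exact: mu_inf_pseudo_effective.
- by move=> [D' [g' [mD' eD' lD']]]; exact: effective_mu lD'.
- by move=> [fB H]; exact: mu_effective.
Qed.
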